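(* Let $T\in\mathcal{BC}^{0,1}(V_5)$ and let $\mathsf{P}$ be any one of the operators $\mathcal{D}$, $\Delta\mathcal{D}$, $\Delta$, $\overline{\mathcal{D}}$, $\overline{\mathcal{D}}^2$, $\Delta\overline{\mathcal{D}}$, $\mathcal{D}^2$. For $f\in\mathcal{SH}_L(\sigma_S(T))$ the integral $$(\mathsf{P}f)(T):=\frac1{2\pi}\int_{\partial(U\cap\mathbb{C}_J)}S^{-1}_{\mathsf{P},L}(s,T)\,ds_J\,f(s),$$ and for $f\in\mathcal{SH}_R(\sigma_S(T))$ the integral $$(f\mathsf{P})(T):=\frac1{2\pi}\int_{\partial(U\cap\mathbb{C}_J)}f(s)\,ds_J\,S^{-1}_{\mathsf{P},R}(s,T),$$ where $J\in\mathbb{S}$, $ds_J=ds(-J)$, and $U$ is a bounded slice Cauchy domain with $\sigma_S(T)\subset U$ and $\overline{U}\subset\operatorname{dom}(f)$, depend neither on the imaginary unit $J\in\mathbb{S}$ nor on the slice Cauchy domain $U$.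
   Context: $\mathbb{R}_5$ is the real Clifford algebra generated by $e_1,\dots,e_5$ ($e_i^2=-1$, $e_ie_j=-e_je_i$ for $i\neq j$), with basis $e_A$; $\mathbb{R}^6$ is identified with paravectors $x=x_0+\underline{x}$, $\underline{x}=\sum_{i=1}^5x_ie_i$. $\mathbb{S}=\{\underline{x}:|\underline{x}|=1\}$; $\mathbb{C}_J=\{u+Jv:u,v\in\mathbb{R}\}$ for $J\in\mathbb{S}$. $\mathcal{D}=\partial_{x_0}+\sum_{i=1}^5e_i\partial_{x_i}$, $\overline{\mathcal{D}}=\partial_{x_0}-\sum_{i=1}^5e_i\partial_{x_i}$, $\Delta=\sum_{i=0}^5\partial_{x_i}^2$ (here these only label the resolvent operators below). A set $U\subset\mathbb{R}^6$ is axially symmetric if $u+Iv\in U$ for some $I\in\mathbb{S}$ implies $u+Jv\in U$ for all $J\in\mathbb{S}$. An axially symmetric open set $U$ is a slice Cauchy domain if for every $J\in\mathbb{S}$ the boundary of $U\cap\mathbb{C}_J$ in $\mathbb C_J$ is a finite union of nonintersecting piecewise continuously differentiable Jordan curves. Left (resp. right) slice hyperholomorphic functions on an axially symmetric open $U$: $f(u+Jv)=\alpha(u,v)+J\beta(u,v)$ (resp. $\alpha(u,v)+\beta(u,v)J$) for all $u+Jv\in U$, $J\in\mathbb{S}$, with $\alpha,\beta$ differentiable $\mathbb{R}_5$-valued, $\alpha(u,-v)=\alpha(u,v)$, $\beta(u,-v)=-\beta(u,v)$, $\partial_u\alpha=\partial_v\beta$, $\partial_v\alpha=-\partial_u\beta$.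 $\mathcal{SH}_L(\sigma_S(T))$ (resp. $\mathcal{SH}_R(\sigma_S(T))$) is the set of left (resp. right) slice hyperholomorphic $f$ with $\sigma_S(T)\subset\operatorname{dom}(f)$. $V$ is a real Banach space, $\mathcal{B}(V)$ the bounded $\mathbb{R}$-linear operators on $V$, $V_5=V\otimes\mathbb{R}_5$ with norm $\|\sum_Av_Ae_A\|=\sum_A\|v_A\|$. $\mathcal{B}(V_5)$ is the set of $T=\sum_AT_Ae_A$, $T_A\in\mathcal{B}(V)$, acting by $T(\sum_Bv_Be_B)=\sum_{A,B}T_A(v_B)e_Ae_B$, with norm $\sum_A\|T_A\|$; $a\in\mathbb{R}_5$ is identified with $a\mathcal{I}$. $\mathcal{BC}^{0,1}(V_5)$ is the set of $T=T_0+\sum_{j=1}^5e_jT_j$ with pairwise commuting $T_j\in\mathcal{B}(V)$; $\overline{T}=T_0-\sum_{j=1}^5e_jT_j$. $\mathcal{Q}_{c,s}(T)=s^2\mathcal{I}-s(T+\overline{T})+T\overline{T}$; $\sigma_S(T)$ is the set of $s\in\mathbb{R}^6$ for which it is not invertible, $\rho_S(T)=\mathbb{R}^6\setminus\sigma_S(T)$. Resolvent operators for $s\in\rho_S(T)$, writing $Q=\mathcal{Q}_{c,s}(T)$: $S^{-1}_{\mathcal{D},L}=S^{-1}_{\mathcal{D},R}=-4Q^{-1}$; $S^{-1}_{\Delta,L}=-8(s-\overline{T})Q^{-2}$, $S^{-1}_{\Delta,R}=-8Q^{-2}(s-\overline{T})$; $S^{-1}_{\Delta\mathcal{D},L}=S^{-1}_{\Delta\mathcal{D},R}=16Q^{-2}$;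 $S^{-1}_{\mathcal{D}^2,L}=-8(s-T)Q^{-2}$, $S^{-1}_{\mathcal{D}^2,R}=-8Q^{-2}(s-T)$; $S^{-1}_{\overline{\mathcal{D}},L}=4(s-\overline{T})Q^{-2}(s-T_0)+2Q^{-1}$, $S^{-1}_{\overline{\mathcal{D}},R}=4(s-T_0)Q^{-2}(s-\overline{T})+2Q^{-1}$; $S^{-1}_{\overline{\mathcal{D}}^2,L}=32(s-\overline{T})Q^{-3}(s-T_0)^2$, $S^{-1}_{\overline{\mathcal{D}}^2,R}=32(s-T_0)^2Q^{-3}(s-\overline{T})$; $S^{-1}_{\Delta\overline{\mathcal{D}},L}=-64(s-\overline{T})Q^{-3}(s-T_0)$, $S^{-1}_{\Delta\overline{\mathcal{D}},R}=-64(s-T_0)Q^{-3}(s-\overline{T})$ (all evaluated at $(s,T)$). *)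

(* Defs.v *)
(* Real and functional analysis follow Coquelicot on Stdlib's R; MathComp is
   used only for the finite index sets A of the Clifford basis (e_A) and for
   finite sums. *)
From HB Require Import structures.
From Stdlib Require Import Reals Lra ClassicalEpsilon.
From Stdlib Require Import FunctionalExtensionality ProofIrrelevance.
From mathcomp Require Import all_boot.
From Coquelicot Require Import Coquelicot.

Set Implicit Arguments.
Unset Strict Implicit.
Unset Printing Implicit Defensive.

Local Open Scope R_scope.

HB.instance Definition _ (G : AbelianMonoid) :=
  Monoid.isComLaw.Build G zero plus
    (@plus_assoc G) (@plus_comm G) (@plus_zero_l G).
HB.instance Definition _ :=
  Monoid.isComLaw.Build R 0 Rplus
    (fun x y z => esym (Rplus_assoc x y z)) Rplus_comm Rplus_0_l.

Declare Scope alg_scope.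
Delimit Scope alg_scope with alg.
Notation "0" := zero : alg_scope.
Notation "1" := one : alg_scope.
Notation "x + y" := (plus x y) : alg_scope.
Notation "x - y" := (minus x y) : alg_scope.
Notation "- x" := (opp x) : alg_scope.
Notation "x * y" := (mult x y) : alg_scope.
Notation "x ^ n" := (pow_n x n) : alg_scope.
Notation "k *: x" := (scal k x) (at level 40) : alg_scope.
Notation "\sum_ ( i : T ) F" := (\big[plus/zero]_(i : T) F) : alg_scope.
Notation "\sum_ ( i : T | P ) F" := (\big[plus/zero]_(i : T | P) F) : alg_scope.

(* The index i : 'I_5 stands for i+1, and A : cindex for the basis element
   e_A = e_{a_1} ... e_{a_k}, where A = {a_1 < ... < a_k} and e_set0 = 1. *)
Definition cindex := {set 'I_5}.

Definition symdiff (A B : cindex) : cindex := (A :\: B) :|: (B :\: A).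

(* e_A e_B = (-1)^m e_{A symdiff B}, where m counts the pairs (i, j) in A x B
   with j <= i: the pairs j < i come from anticommutation and the pairs i = j
   from e_i^2 = -1. *)
Definition csign (A B : cindex) : bool :=
  odd #|[set p in setX A B | (p.2 <= p.1)%N]|.

Definition signed (G : AbelianGroup) (b : bool) (x : G) : G :=
  if b then opp x else x.

(* X (x) R_5, an element being the family of its coordinates on (e_A) *)
Definition clifford (X : Type) := {ffun cindex -> X}.

(* (sum_A a_A e_A, sum_B b_B e_B) |-> sum_{A,B} m(a_A, b_B) e_A e_B *)
Definition cprod (X Y : Type) (Z : AbelianGroup) (m : X -> Y -> Z)
    (a : clifford X) (b : clifford Y) : clifford Z :=
  [ffun D : cindex => (\sum_(A : cindex) \sum_(B : cindex | symdiff A B == D)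
      signed (csign A B) (m (a A) (b B)))%alg].

Definition cmono (G : AbelianGroup) (A : cindex) (x : G) : clifford G :=
  [ffun B : cindex => if B == A then x else zero].

Lemma signedD (G : AbelianGroup) b (x y : G) :
  signed b (plus x y) = plus (signed b x) (signed b y).
Proof. by case: b => //=; rewrite opp_plus. Qed.

Lemma signed0 (G : AbelianGroup) b : signed b (zero : G) = zero.
Proof. by case: b => //=; rewrite opp_zero. Qed.

Lemma signed_signed (G : AbelianGroup) b c (x : G) :
  signed b (signed c x) = signed (b (+) c) x.
Proof. by case: b; case: c => //=; rewrite opp_opp. Qed.

Lemma signed_sum (G : AbelianGroup) (I : finType) (P : pred I) b (F : I -> G) :
  signed b (\big[plus/zero]_(i | P i) F i)
  = \big[plus/zero]_(i | P i) signed b (F i).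
Proof.
apply: (big_morph (signed b)); first exact: signedD.
exact: signed0.
Qed.

Section AdditiveMap.

Variables (X Y : AbelianGroup) (h : X -> Y).
Hypothesis hD : forall x y, h (plus x y) = plus (h x) (h y).

Lemma additive0 : h zero = zero.
Proof.
apply: (plus_reg_l (h zero)).
by rewrite -hD !plus_zero_r.
Qed.

Lemma additiveN x : h (opp x) = opp (h x).
Proof.
apply: (plus_reg_l (h x)).
by rewrite -hD !plus_opp_r additive0.
Qed.

Lemma additive_signed b x : h (signed b x) = signed b (h x).
Proof. by case: b => //=; exact: additiveN. Qed.

Lemma additive_sum (I : finType) (P : pred I) (F : I -> X) :
  h (\big[plus/zero]_(i | P i) F i) = \big[plus/zero]_(i | P i) h (F i).
Proof. exact: (big_morph h hD additive0). Qed.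

End AdditiveMap.

Lemma in_symdiff A B i : (i \in symdiff A B) = (i \in A) (+) (i \in B).
Proof. by rewrite !inE; case: (i \in A); case: (i \in B). Qed.

Lemma symdiffA A B D : symdiff (symdiff A B) D = symdiff A (symdiff B D).
Proof. by apply/setP => i; rewrite !in_symdiff addbA. Qed.

Lemma symdiff0s A : symdiff set0 A = A.
Proof. by apply/setP => i; rewrite in_symdiff inE. Qed.

Lemma symdiffs0 A : symdiff A set0 = A.
Proof. by apply/setP => i; rewrite in_symdiff inE addbF. Qed.

Lemma csignE A B :
  csign A B = \big[addb/false]_(p : 'I_5 * 'I_5)
                [&& p.1 \in A, p.2 \in B & (p.2 <= p.1)%N].
Proof.
rewrite /csign cardsE -sum1_card big_mkcond /=.
rewrite (big_morph odd oddD (erefl : odd 0 = false)).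
apply: eq_bigr => -[i j] _.
by rewrite unfold_in /= !inE /= andbA; case: ifP.
Qed.

Lemma csign_symdiffl A B D : csign (symdiff A B) D = csign A D (+) csign B D.
Proof.
rewrite !csignE -big_split /=; apply: eq_bigr => p _.
rewrite in_symdiff.
by case: (_ \in A); case: (_ \in B); case: (_ \in D); case: (_ <= _)%N.
Qed.

Lemma csign_symdiffr A B D : csign D (symdiff A B) = csign D A (+) csign D B.
Proof.
rewrite !csignE -big_split /=; apply: eq_bigr => p _.
rewrite in_symdiff.
by case: (_ \in D); case: (_ \in A); case: (_ \in B); case: (_ <= _)%N.
Qed.

Lemma csign0s A : csign set0 A = false.
Proof. by rewrite csignE big1 // => p _; rewrite inE. Qed.

Lemma csigns0 A : csign A set0 = false.
Proof. by rewrite csignE big1 // => p _; rewrite inE andbF. Qed.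

Lemma cprodE (X Y : Type) (Z : AbelianGroup) (m : X -> Y -> Z) a b D :
  cprod m a b D = \big[plus/zero]_(A : cindex)
    signed (csign A (symdiff A D)) (m (a A) (b (symdiff A D))).
Proof.
rewrite ffunE; apply: eq_bigr => A _.
rewrite (big_pred1 (symdiff A D)) // => B /=.
apply/eqP/eqP => [<-|->]; apply/setP => i; rewrite !in_symdiff addbA;
  by case: (_ \in A).
Qed.

Lemma cprodA (X Y Z : Type) (XY YZ XYZ : AbelianGroup)
    (m1 : X -> Y -> XY) (m2 : XY -> Z -> XYZ)
    (m3 : X -> YZ -> XYZ) (m4 : Y -> Z -> YZ) :
    (forall x y z, m2 (plus x y) z = plus (m2 x z) (m2 y z)) ->
    (forall x y z, m3 x (plus y z) = plus (m3 x y) (m3 x z)) ->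
    (forall x y z, m3 x (m4 y z) = m2 (m1 x y) z) ->
  forall a b c, cprod m3 a (cprod m4 b c) = cprod m2 (cprod m1 a b) c.
Proof.
move=> m2D m3D m34 a b c; apply/ffunP => D; rewrite !cprodE.
have m20 z : forall u v, m2 (plus u v) z = plus (m2 u z) (m2 v z).
  by move=> u v; exact: m2D.
under [RHS]eq_bigr => E _.
  rewrite cprodE (additive_sum (h := m2^~ _)); last by move=> *; exact: m2D.
  rewrite signed_sum.
  over.
rewrite exchange_big /=; apply: eq_bigr => A _.
rewrite cprodE (additive_sum (h := m3 _)) // signed_sum.
rewrite [RHS](reindex_inj (h := symdiff A)) /=; last first.
  move=> B B' /setP eqBB'; apply/setP => i.
  by move: (eqBB' i); rewrite !in_symdiff; case: (_ \in A) => // /negb_inj.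
apply: eq_bigr => B _.
have -> : symdiff A (symdiff A B) = B.
  by apply/setP => i; rewrite !in_symdiff; case: (_ \in A); case: (_ \in B).
have -> : symdiff (symdiff A B) D = symdiff B (symdiff A D).
  apply/setP => i; rewrite !in_symdiff.
  by case: (_ \in A); case: (_ \in B); case: (_ \in D).
rewrite (additive_signed (h := m3 _)) //.
rewrite (additive_signed (h := m2^~ _)); last by move=> *; exact: m2D.
rewrite m34 !signed_signed !csign_symdiffl !csign_symdiffr.
congr (signed _ _).
by case: (csign A A); case: (csign A B); case: (csign A D); case: (csign B A);
  case: (csign B D); case: (csign B B).
Qed.

Section CliffordAbelianGroup.

Variable G : AbelianGroup.
Implicit Types x y z : clifford G.

Definition clifford_plus x y : clifford G := [ffun A => plus (x A) (y A)].
Definition clifford_zero : clifford G := [ffun=> zero].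
Definition clifford_opp x : clifford G := [ffun A => opp (x A)].

Lemma clifford_plusC x y : clifford_plus x y = clifford_plus y x.
Proof. by apply/ffunP => A; rewrite !ffunE plus_comm. Qed.

Lemma clifford_plusA x y z :
  clifford_plus x (clifford_plus y z) = clifford_plus (clifford_plus x y) z.
Proof. by apply/ffunP => A; rewrite !ffunE plus_assoc. Qed.

Lemma clifford_plus0 x : clifford_plus x clifford_zero = x.
Proof. by apply/ffunP => A; rewrite !ffunE plus_zero_r. Qed.

Lemma clifford_plusN x : clifford_plus x (clifford_opp x) = clifford_zero.
Proof. by apply/ffunP => A; rewrite !ffunE plus_opp_r. Qed.

Definition clifford_AbelianMonoid_mixin :=
  AbelianMonoid.Mixin (clifford G) _ _
    clifford_plusC clifford_plusA clifford_plus0.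
Canonical clifford_AbelianMonoid :=
  AbelianMonoid.Pack (clifford G) clifford_AbelianMonoid_mixin (clifford G).

Definition clifford_AbelianGroup_mixin :=
  AbelianGroup.Mixin clifford_AbelianMonoid clifford_opp clifford_plusN.
Canonical clifford_AbelianGroup :=
  AbelianGroup.Pack (clifford G)
    (AbelianGroup.Class _ _ clifford_AbelianGroup_mixin) (clifford G).

End CliffordAbelianGroup.

Section CliffordRing.

Variable K : Ring.
Implicit Types x y z : clifford K.

Definition clifford_mult x y : clifford K := cprod mult x y.
Definition clifford_one : clifford K := cmono set0 one.

Lemma clifford_multA x y z :
  clifford_mult x (clifford_mult y z) = clifford_mult (clifford_mult x y) z.
Proof.
apply: cprodA => [u v w|u v w|u v w].
- exact: mult_distr_r.
- exact: mult_distr_l.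
- exact: mult_assoc.
Qed.

Lemma clifford_mult1 x : clifford_mult x clifford_one = x.
Proof.
apply/ffunP => D; rewrite /clifford_mult cprodE (bigD1 D) //= big1 => [|A nA].
  have -> : symdiff D D = set0.
    by apply/setP => i; rewrite in_symdiff inE addbb.
  by rewrite csigns0 /= /clifford_one ffunE eqxx mult_one_r plus_zero_r.
rewrite ffunE ifF ?mult_zero_r ?signed0 //.
apply: contraNF nA => /eqP/setP eqAD; apply/eqP/setP => i.
by move: (eqAD i); rewrite in_symdiff inE; case: (_ \in A); case: (_ \in D).
Qed.

Lemma clifford_1mult x : clifford_mult clifford_one x = x.
Proof.
apply/ffunP => D; rewrite /clifford_mult cprodE (bigD1 set0) //= big1 => [|A nA].
  by rewrite csign0s /= symdiff0s ffunE eqxx mult_one_l plus_zero_r.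
by rewrite ffunE (negbTE nA) mult_zero_l signed0.
Qed.

Lemma clifford_mult_distr_r x y z :
  clifford_mult (plus x y) z = plus (clifford_mult x z) (clifford_mult y z).
Proof.
apply/ffunP => D; rewrite /clifford_mult [RHS]ffunE !cprodE -big_split /=.
by apply: eq_bigr => A _; rewrite -signedD ffunE mult_distr_r.
Qed.

Lemma clifford_mult_distr_l x y z :
  clifford_mult x (plus y z) = plus (clifford_mult x y) (clifford_mult x z).
Proof.
apply/ffunP => D; rewrite /clifford_mult [RHS]ffunE !cprodE -big_split /=.
by apply: eq_bigr => A _; rewrite -signedD ffunE mult_distr_l.
Qed.

Definition clifford_Ring_mixin :=
  Ring.Mixin (clifford_AbelianGroup K) _ _ clifford_multA clifford_mult1
    clifford_1mult clifford_mult_distr_r clifford_mult_distr_l.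
Canonical clifford_Ring :=
  Ring.Pack (clifford K) (Ring.Class _ _ clifford_Ring_mixin) (clifford K).

End CliffordRing.

Section NormUniformSpace.

Variables (G : AbelianGroup) (N : G -> R).
Hypothesis N_zero : N zero = 0.
Hypothesis N_opp : forall x, N (opp x) = N x.
Hypothesis N_triangle : forall x y, N (plus x y) <= N x + N y.

Definition norm_ball (x : G) (eps : R) (y : G) := N (minus y x) < eps.

Lemma norm_ball_center x (eps : posreal) : norm_ball x eps x.
Proof. by rewrite /norm_ball minus_eq_zero N_zero; exact: cond_pos. Qed.

Lemma norm_ball_sym x y eps : norm_ball x eps y -> norm_ball y eps x.
Proof. by rewrite /norm_ball -(opp_minus x y) N_opp. Qed.

Lemma norm_ball_triangle x y z eps1 eps2 :
  norm_ball x eps1 y -> norm_ball y eps2 z -> norm_ball x (eps1 + eps2) z.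
Proof.
rewrite /norm_ball => xy yz; rewrite (minus_trans y).
apply: Rle_lt_trans (N_triangle _ _) _.
by rewrite Rplus_comm; exact: Rplus_lt_compat.
Qed.

Definition norm_UniformSpace_mixin :=
  UniformSpace.Mixin G zero norm_ball
    norm_ball_center norm_ball_sym norm_ball_triangle.

End NormUniformSpace.

Section CliffordNormedModule.

Variable X : NormedModule R_AbsRing.
Implicit Types x y : clifford X.

Definition clifford_scal (k : R) x : clifford X := [ffun A => scal k (x A)].

Lemma clifford_scalA k l x :
  clifford_scal k (clifford_scal l x) = clifford_scal (mult k l) x.
Proof. by apply/ffunP => A; rewrite !ffunE scal_assoc. Qed.

Lemma clifford_scal1 x : clifford_scal one x = x.
Proof. by apply/ffunP => A; rewrite ffunE scal_one. Qed.

Lemma clifford_scal_distr_l k x y :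
  clifford_scal k (plus x y) = plus (clifford_scal k x) (clifford_scal k y).
Proof. by apply/ffunP => A; rewrite !ffunE scal_distr_l. Qed.

Lemma clifford_scal_distr_r k l x :
  clifford_scal (plus k l) x = plus (clifford_scal k x) (clifford_scal l x).
Proof. by apply/ffunP => A; rewrite !ffunE scal_distr_r. Qed.

Definition clifford_ModuleSpace_mixin :=
  ModuleSpace.Mixin R_Ring (clifford_AbelianGroup X) clifford_scal
    clifford_scalA clifford_scal1 clifford_scal_distr_l clifford_scal_distr_r.
Canonical clifford_ModuleSpace :=
  ModuleSpace.Pack R_Ring (clifford X)
    (ModuleSpace.Class _ _ _ clifford_ModuleSpace_mixin) (clifford X).

Definition clifford_norm x : R := \big[Rplus/0]_(A : cindex) norm (x A).

Lemma Rsum_le (I : finType) (F H : I -> R) : (forall i, F i <= H i) ->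
  \big[Rplus/0]_i F i <= \big[Rplus/0]_i H i.
Proof.
move=> FH; apply: (big_ind2 Rle) => //; first exact: Rle_refl.
by move=> *; exact: Rplus_le_compat.
Qed.

Lemma clifford_norm_triangle x y :
  clifford_norm (plus x y) <= clifford_norm x + clifford_norm y.
Proof.
rewrite /clifford_norm -big_split /=.
by apply: Rsum_le => A; rewrite ffunE; exact: norm_triangle.
Qed.

Lemma clifford_norm_scal k x :
  clifford_norm (scal k x) <= abs k * clifford_norm x.
Proof.
rewrite /clifford_norm.
rewrite (big_morph (Rmult (abs k)) (Rmult_plus_distr_l _) (Rmult_0_r _)).
by apply: Rsum_le => A; rewrite ffunE; exact: norm_scal.
Qed.

Lemma clifford_norm0 : clifford_norm zero = 0.
Proof. by apply: big1 => A _; rewrite ffunE norm_zero. Qed.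

Lemma clifford_normN x : clifford_norm (opp x) = clifford_norm x.
Proof. by apply: eq_bigr => A _; rewrite ffunE norm_opp. Qed.

Lemma clifford_norm_eq0 x : clifford_norm x = 0 -> x = zero.
Proof.
move=> x0; apply/ffunP => A; rewrite ffunE; apply: norm_eq_zero.
have nn : 0 <= \big[Rplus/0]_(B | B != A) norm (x B).
  apply: (big_ind (Rle 0)) => [|u v|B _]; [exact: Rle_refl| |exact: norm_ge_0].
  exact: Rplus_le_le_0_compat.
move: x0; rewrite /clifford_norm (bigD1 A) //=.
exact: (Rplus_eq_0_l _ _ (norm_ge_0 _) nn).
Qed.

Definition clifford_UniformSpace_mixin :=
  norm_UniformSpace_mixin clifford_norm0 clifford_normN clifford_norm_triangle.
Canonical clifford_UniformSpace :=
  UniformSpace.Pack (clifford X) clifford_UniformSpace_mixin (clifford X).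
Canonical clifford_NormedModuleAux :=
  NormedModuleAux.Pack R_AbsRing (clifford X)
    (NormedModuleAux.Class R_AbsRing _
      (ModuleSpace.class _ clifford_ModuleSpace) clifford_UniformSpace_mixin)
    (clifford X).

Lemma clifford_norm_compat1 x y (eps : R) :
  clifford_norm (minus y x) < eps -> ball x eps y.
Proof. by []. Qed.

Lemma clifford_norm_compat2 x y (eps : posreal) :
  ball x eps y -> clifford_norm (minus y x) < 1 * eps.
Proof. by rewrite Rmult_1_l. Qed.

Definition clifford_NormedModule_mixin :=
  NormedModule.Mixin R_AbsRing clifford_NormedModuleAux clifford_norm 1
    clifford_norm_triangle clifford_norm_scal
    clifford_norm_compat1 clifford_norm_compat2 clifford_norm_eq0.
Canonical clifford_NormedModule :=
  NormedModule.Pack R_AbsRing (clifford X)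
    (NormedModule.Class _ _ _ clifford_NormedModule_mixin) (clifford X).

End CliffordNormedModule.

Section BoundedOperators.

Variable V : NormedModule R_AbsRing.

Record bop := Bop { bop_fun :> V -> V; bopP : is_linear bop_fun }.
Implicit Types S T : bop.

Lemma bop_ext S T : (forall v, S v = T v) -> S = T.
Proof.
case: S T => [f fP] [g gP] /= fg.
have {}fg : f = g by apply: functional_extensionality.
by subst g; rewrite (proof_irrelevance _ fP gP).
Qed.

Definition bop_norm T : R :=
  real (Lub_Rbar (fun r => exists2 v : V, norm v <= 1 & r = norm (T v))).

Lemma bop_plus_subproof S T : is_linear (fun v => plus (S v) (T v)).
Proof.
apply: (is_linear_comp (fun v => (S v, T v)) (fun p : V * V => plus p.1 p.2)).
  exact: is_linear_prod (bopP S) (bopP T).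
exact: is_linear_plus.
Qed.
Definition bop_plus S T := Bop (bop_plus_subproof S T).

Lemma bop_zero_subproof : is_linear (fun _ : V => zero : V).
Proof. exact: is_linear_zero. Qed.
Definition bop_zero := Bop bop_zero_subproof.

Lemma bop_opp_subproof T : is_linear (fun v => opp (T v)).
Proof. exact: (is_linear_comp _ _ (bopP T) is_linear_opp). Qed.
Definition bop_opp T := Bop (bop_opp_subproof T).

Lemma bop_comp_subproof S T : is_linear (fun v => S (T v)).
Proof. exact: (is_linear_comp _ _ (bopP T) (bopP S)). Qed.
Definition bop_comp S T := Bop (bop_comp_subproof S T).

Lemma bop_id_subproof : is_linear (fun v : V => v).
Proof. exact: is_linear_id. Qed.
Definition bop_id := Bop bop_id_subproof.

Lemma bop_scal_subproof (k : R) T : is_linear (fun v => scal k (T v)).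
Proof.
apply: (is_linear_comp _ _ (bopP T)).
by apply: is_linear_scal_r => x y; exact: Rmult_comm.
Qed.
Definition bop_scal (k : R) T := Bop (bop_scal_subproof k T).

Lemma bop_plusC S T : bop_plus S T = bop_plus T S.
Proof. by apply: bop_ext => v; exact: plus_comm. Qed.
Lemma bop_plusA R S T :
  bop_plus R (bop_plus S T) = bop_plus (bop_plus R S) T.
Proof. by apply: bop_ext => v; exact: plus_assoc. Qed.
Lemma bop_plus0 T : bop_plus T bop_zero = T.
Proof. by apply: bop_ext => v; exact: plus_zero_r. Qed.
Lemma bop_plusN T : bop_plus T (bop_opp T) = bop_zero.
Proof. by apply: bop_ext => v; exact: plus_opp_r. Qed.

Definition bop_AbelianMonoid_mixin :=
  AbelianMonoid.Mixin bop _ _ bop_plusC bop_plusA bop_plus0.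
Canonical bop_AbelianMonoid :=
  AbelianMonoid.Pack bop bop_AbelianMonoid_mixin bop.
Definition bop_AbelianGroup_mixin :=
  AbelianGroup.Mixin bop_AbelianMonoid bop_opp bop_plusN.
Canonical bop_AbelianGroup :=
  AbelianGroup.Pack bop (AbelianGroup.Class _ _ bop_AbelianGroup_mixin) bop.

Lemma bop_compA R S T :
  bop_comp R (bop_comp S T) = bop_comp (bop_comp R S) T.
Proof. exact: bop_ext. Qed.
Lemma bop_comp1 T : bop_comp T bop_id = T.
Proof. exact: bop_ext. Qed.
Lemma bop_1comp T : bop_comp bop_id T = T.
Proof. exact: bop_ext. Qed.
Lemma bop_comp_distr_r R S T :
  bop_comp (plus R S) T = plus (bop_comp R T) (bop_comp S T).
Proof. exact: bop_ext. Qed.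
Lemma bop_comp_distr_l R S T :
  bop_comp R (plus S T) = plus (bop_comp R S) (bop_comp R T).
Proof. by apply: bop_ext => v; exact: (linear_plus _ (bopP R)). Qed.

Definition bop_Ring_mixin :=
  Ring.Mixin bop_AbelianGroup _ _ bop_compA bop_comp1 bop_1comp
    bop_comp_distr_r bop_comp_distr_l.
Canonical bop_Ring := Ring.Pack bop (Ring.Class _ _ bop_Ring_mixin) bop.

Lemma bop_scalA k l T : bop_scal k (bop_scal l T) = bop_scal (mult k l) T.
Proof. by apply: bop_ext => v; exact: scal_assoc. Qed.
Lemma bop_scal1 T : bop_scal one T = T.
Proof. by apply: bop_ext => v; exact: scal_one. Qed.
Lemma bop_scal_distr_l k S T :
  bop_scal k (plus S T) = plus (bop_scal k S) (bop_scal k T).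
Proof. by apply: bop_ext => v; exact: scal_distr_l. Qed.
Lemma bop_scal_distr_r k l T :
  bop_scal (plus k l) T = plus (bop_scal k T) (bop_scal l T).
Proof. by apply: bop_ext => v; exact: scal_distr_r. Qed.

Definition bop_ModuleSpace_mixin :=
  ModuleSpace.Mixin R_Ring bop_AbelianGroup bop_scal
    bop_scalA bop_scal1 bop_scal_distr_l bop_scal_distr_r.
Canonical bop_ModuleSpace :=
  ModuleSpace.Pack R_Ring bop (ModuleSpace.Class _ _ _ bop_ModuleSpace_mixin)
    bop.

Lemma bop_norm_lub T :
  is_lub_Rbar (fun r => exists2 v : V, norm v <= 1 & r = norm (T v))
    (Finite (bop_norm T)).
Proof.
rewrite /bop_norm; set E := fun r : R => _.
case: (linear_norm _ (bopP T)) => M [M0 TM].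
have [ubE lubE] := Lub_Rbar_correct E.
have E0 : E 0.
  exists zero; first by rewrite norm_zero; lra.
  by rewrite (additive0 (linear_plus _ (bopP T))) norm_zero.
have EM : is_ub_Rbar E (Finite M).
  move=> r [v v1 ->] /=; apply: Rle_trans (TM v) _.
  rewrite -[X in _ <= X]Rmult_1_r; apply: Rmult_le_compat_l => //; lra.
move: (ubE _ E0) (lubE _ EM); rewrite -/E.
by case L : (Lub_Rbar E) => [l| |] //= _ _; rewrite -L; split.
Qed.

Lemma bop_norm_ub T v : norm v <= 1 -> norm (T v) <= bop_norm T.
Proof. by move=> v1; apply: (proj1 (bop_norm_lub T)); exists v. Qed.

Lemma bop_norm_le T (M : R) :
  (forall v, norm v <= 1 -> norm (T v) <= M) -> bop_norm T <= M.
Proof.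
move=> TM; apply: (proj2 (bop_norm_lub T) (Finite M)) => r [v v1 ->].
exact: TM.
Qed.

Lemma bop_norm_ge0 T : 0 <= bop_norm T.
Proof.
apply: Rle_trans (norm_ge_0 (T zero)) (bop_norm_ub _ _).
by rewrite norm_zero; lra.
Qed.

Lemma bop_normP T v : norm (T v) <= bop_norm T * norm v.
Proof.
case: (Req_dec (norm v) 0) => [v0|v0].
  rewrite (norm_eq_zero _ v0) (additive0 (linear_plus _ (bopP T))) !norm_zero.
  lra.
have vp : 0 < norm v by move: (norm_ge_0 v); lra.
have vip : 0 < / norm v by exact: Rinv_0_lt_compat.
have w1 : norm (scal (/ norm v) v) <= 1.
  apply: Rle_trans (norm_scal _ _) _.
  rewrite /abs /= Rabs_pos_eq; last lra.
  by rewrite Rinv_l //; lra.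
have -> : v = scal (norm v) (scal (/ norm v) v).
  by rewrite scal_assoc /mult /= Rinv_r // scal_one.
set w := scal (/ _) v in w1 *.
rewrite (linear_scal _ (bopP T)).
have nw : norm (scal (norm v) w) = norm v.
  by rewrite /w scal_assoc /mult /= Rinv_r // scal_one.
rewrite nw; apply: Rle_trans (norm_scal _ _) _.
rewrite /abs /= Rabs_pos_eq; last lra.
rewrite Rmult_comm; apply: Rmult_le_compat_r; first lra.
exact: bop_norm_ub.
Qed.

Lemma bop_norm_triangle S T : bop_norm (plus S T) <= bop_norm S + bop_norm T.
Proof.
apply: bop_norm_le => v v1; apply: Rle_trans (norm_triangle _ _) _.
by apply: Rplus_le_compat; exact: bop_norm_ub.
Qed.

Lemma bop_norm_scal (k : R) T : bop_norm (scal k T) <= abs k * bop_norm T.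
Proof.
apply: bop_norm_le => v v1; apply: Rle_trans (norm_scal _ _) _.
by apply: Rmult_le_compat_l; [exact: abs_ge_0|exact: bop_norm_ub].
Qed.

Lemma bop_norm0 : bop_norm zero = 0.
Proof.
apply: Rle_antisym (bop_norm_ge0 _); apply: bop_norm_le => v _ /=.
by rewrite norm_zero; exact: Rle_refl.
Qed.

Lemma bop_normN T : bop_norm (opp T) = bop_norm T.
Proof.
have le S : bop_norm (opp S) <= bop_norm S.
  by apply: bop_norm_le => v v1 /=; rewrite norm_opp; exact: bop_norm_ub.
by apply: Rle_antisym => //; rewrite -{1}(opp_opp T).
Qed.

Lemma bop_norm_eq0 T : bop_norm T = 0 -> T = zero.
Proof.
move=> T0; apply: bop_ext => v; apply: norm_eq_zero.
move: (bop_normP T v) (norm_ge_0 (T v)); rewrite T0 Rmult_0_l; lra.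
Qed.

Definition bop_UniformSpace_mixin :=
  norm_UniformSpace_mixin bop_norm0 bop_normN bop_norm_triangle.
Canonical bop_UniformSpace :=
  UniformSpace.Pack bop bop_UniformSpace_mixin bop.
Canonical bop_NormedModuleAux :=
  NormedModuleAux.Pack R_AbsRing bop
    (NormedModuleAux.Class R_AbsRing _
      (ModuleSpace.class _ bop_ModuleSpace) bop_UniformSpace_mixin) bop.

Lemma bop_norm_compat1 S T (eps : R) :
  bop_norm (minus T S) < eps -> ball S eps T.
Proof. by []. Qed.

Lemma bop_norm_compat2 S T (eps : posreal) :
  ball S eps T -> bop_norm (minus T S) < 1 * eps.
Proof. by rewrite Rmult_1_l. Qed.

Definition bop_NormedModule_mixin :=
  NormedModule.Mixin R_AbsRing bop_NormedModuleAux bop_norm 1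
    bop_norm_triangle bop_norm_scal
    bop_norm_compat1 bop_norm_compat2 bop_norm_eq0.
Canonical bop_NormedModule :=
  NormedModule.Pack R_AbsRing bop
    (NormedModule.Class _ _ _ bop_NormedModule_mixin) bop.

End BoundedOperators.

Notation R5 := (clifford R).
Notation V5 V := (clifford V).
Notation BV5 V := (clifford (bop V)).

Section CliffordOperators.

Variable V : NormedModule R_AbsRing.
Implicit Types S T : BV5 V.

(* T (sum_B v_B e_B) = sum_{A,B} T_A(v_B) e_A e_B *)
Definition op_act T (v : V5 V) : V5 V := cprod (fun t : bop V => t) T v.

(* The product of the ring BV5 V is the composition of operators *)
Lemma op_act_mult S T v : op_act (S * T)%alg v = op_act S (op_act T v).
Proof.
symmetry; apply: cprodA => // t.
exact: (linear_plus _ (bopP t)).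
Qed.

(* a : R_5 seen as the operator a I *)
Definition cliff_op (a : R5) : BV5 V := [ffun A => scal (a A) (bop_id V)].

End CliffordOperators.

Definition para (G : AbelianGroup) (x0 : G) (x : 'I_5 -> G) : clifford G :=
  (cmono set0 x0 + \sum_(i : 'I_5) cmono [set i] (x i))%alg.

Definition e_ (i : 'I_5) : R5 := cmono [set i] 1.

Lemma cmono_mult (K : Ring) A B (x y : K) :
  (cmono A x * cmono B y)%alg
  = cmono (symdiff A B) (signed (csign A B) (x * y)%alg).
Proof.
apply/ffunP => D; rewrite -[LHS]/(cprod mult (cmono A x) (cmono B y) D) cprodE.
rewrite (bigD1 A) //= big1 => [|E nE].
  rewrite !ffunE eqxx plus_zero_r.
  have -> : (symdiff A D == B) = (D == symdiff A B).
    apply/eqP/eqP => [<-|->]; apply/setP => i; rewrite !in_symdiff addbA;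
      by case: (_ \in A).
  case: eqP => [->|_]; last by rewrite mult_zero_r signed0.
  have -> // : symdiff A (symdiff A B) = B.
  by apply/setP => i; rewrite !in_symdiff addbA addbb.
by rewrite [cmono A x E]ffunE (negbTE nE) mult_zero_l signed0.
Qed.

Lemma csign1 i j : csign [set i] [set j] = (j <= i)%N.
Proof.
rewrite csignE (bigD1 (i, j)) //= !inE !eqxx /= big1 ?addbF // => -[k l] /=.
by rewrite xpair_eqE !inE; case: eqP; case: eqP.
Qed.

Lemma e_sqr i : (e_ i * e_ i)%alg = (- one)%alg.
Proof.
rewrite cmono_mult csign1 leqnn /=.
have -> : symdiff [set i] [set i] = set0.
  by apply/setP => j; rewrite in_symdiff in_set0 addbb.
apply/ffunP => A; rewrite !ffunE; case: eqP => _.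
  by rewrite /mult /one /= Rmult_1_r.
by rewrite opp_zero.
Qed.

Lemma e_anticomm i j : i != j -> (e_ i * e_ j)%alg = (- (e_ j * e_ i))%alg.
Proof.
move=> nij; rewrite !cmono_mult !csign1.
have -> : symdiff [set j] [set i] = symdiff [set i] [set j].
  by apply/setP => k; rewrite !in_symdiff addbC.
apply/ffunP => A; rewrite !ffunE; case: eqP => _; last by rewrite opp_zero.
have -> : (i <= j)%N = ~~ (j <= i)%N.
  by rewrite -ltnNge ltn_neqAle [(i <= j)%N]leq_eqVlt (inj_eq val_inj) nij /=
    (negbTE nij).
by case: (j <= i)%N => //=; rewrite opp_opp.
Qed.

Notation paravector := (R * ('I_5 -> R))%type.

Definition norm5 (x : 'I_5 -> R) : R := sqrt (\big[Rplus/0]_(i : 'I_5) (x i) ^ 2).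

Definition para_norm (x : paravector) : R :=
  sqrt (x.1 ^ 2 + \big[Rplus/0]_(i : 'I_5) (x.2 i) ^ 2).

Definition sphere (J : 'I_5 -> R) : Prop := norm5 J = 1.

Definition cliff (x : paravector) : R5 := para x.1 x.2.

Definition imag (J : 'I_5 -> R) : R5 := para 0 J.

(* u + J v; C_J is identified with C by u + J v <-> (u, v) *)
Definition slice_pt (J : 'I_5 -> R) (z : C) : paravector :=
  (z.1, fun i => z.2 * J i).

Definition slice (U : paravector -> Prop) (J : 'I_5 -> R) : C -> Prop :=
  fun z => U (slice_pt J z).

Definition axially_symmetric (U : paravector -> Prop) : Prop :=
  forall u v, (exists2 I, sphere I & U (slice_pt I (u, v))) ->
  forall J, sphere J -> U (slice_pt J (u, v)).

Section Closure.

Variable X : UniformSpace.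
Implicit Types A : X -> Prop.

Definition adherent A (x : X) : Prop :=
  forall P, locally x P -> exists2 y, A y & P y.

Definition boundary A (x : X) : Prop :=
  adherent A x /\ adherent (fun y => ~ A y) x.

End Closure.

Definition bounded_set (U : paravector -> Prop) : Prop :=
  exists M : R, forall x, U x -> para_norm x <= M.

(* C^1 on a closed interval: restriction of a C^1 function on R *)
Definition C1_on (g : R -> C) (a b : R) : Prop :=
  exists h dh : R -> C,
    [/\ forall t, a <= t <= b -> g t = h t,
        forall t, is_derive (V := C_R_NormedModule) h t (dh t)
      & forall t, continuous dh t].

Definition piecewise_C1 (g : R -> C) : Prop :=
  exists (m : nat) (tau : nat -> R),
    [/\ tau 0%N = 0, tau m = 1
      & forall i, (i < m)%N ->
          tau i < tau i.+1 /\ C1_on g (tau i) (tau i.+1)].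

(* Curves are parametrized by [0, 1]; values outside [0, 1] are irrelevant *)
Definition pw_C1_jordan (g : R -> C) : Prop :=
  [/\ piecewise_C1 g, g 0 = g 1
    & forall s t, 0 <= s < 1 -> 0 <= t < 1 -> g s = g t -> s = t].

Definition in_curve (g : R -> C) (z : C) : Prop :=
  exists2 t, 0 <= t <= 1 & g t = z.

(* The boundary of A is the union of n nonintersecting piecewise C^1 Jordan
   curves, parametrized by g *)
Definition jordan_boundary (A : C -> Prop) n (g : 'I_n -> R -> C) : Prop :=
  [/\ forall k, pw_C1_jordan (g k),
      forall k l z, in_curve (g k) z -> in_curve (g l) z -> k = l
    & forall z, boundary A z <-> exists k, in_curve (g k) z].

Definition slice_cauchy_domain (U : paravector -> Prop) : Prop :=
  [/\ open U, axially_symmetric U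
    & forall J, sphere J ->
        exists n (g : 'I_n -> R -> C), jordan_boundary (slice U J) g].

(* g'(t); at the finitely many t where a piecewise C^1 curve is not
   differentiable the value is irrelevant for the integrals *)
Definition velocity (g : R -> C) (t : R) : C :=
  (Derive (fun s => fst (g s)) t, Derive (fun s => snd (g s)) t).

(* 1 / (2 pi i) sum_k int_{g_k} dw / (w - z) *)
Definition winding n (g : 'I_n -> R -> C) (z : C) : C :=
  (/ (2 * PI * Ci) * \big[Cplus/RtoC 0]_(k < n)
     RInt (V := C_R_CompleteNormedModule)
       (fun t => velocity (g k) t / (g k t - z)) 0 1)%C.

(* Boundary orientation of a bounded plane open set A: off its boundary, the
   curves wind once around the points of A and do not wind around the others *)
Definition positively_oriented (A : C -> Prop) n (g : 'I_n -> R -> C) : Prop :=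
  forall z, ~ boundary A z ->
    (A z -> winding g z = 1%C) /\ (~ A z -> winding g z = 0%C).

(* Conditions on (al, be) on the set of (u, v) with u + J v in D *)
Definition slice_CR (D : paravector -> Prop) (al be : R -> R -> R5) : Prop :=
  forall u v, (exists2 J, sphere J & D (slice_pt J (u, v))) ->
  [/\ al u (- v) = al u v, be u (- v) = opp (be u v),
      ex_filterdiff (fun p : R * R => al p.1 p.2) (locally (u, v)),
      ex_filterdiff (fun p : R * R => be p.1 p.2) (locally (u, v))
    & exists a b : R5,
      [/\ is_derive (fun x => al x v) u a, is_derive (fun y => be u y) v a,
          is_derive (fun y => al u y) v b
        & is_derive (fun x => be x v) u (opp b)]].

(* D is the domain of f; the values of f outside D are irrelevant *)
Definition slice_hyperholomorphic_L (D : paravector -> Prop)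
    (f : paravector -> R5) : Prop :=
  [/\ open D, axially_symmetric D
    & exists2 ab : (R -> R -> R5) * (R -> R -> R5), slice_CR D ab.1 ab.2 &
      forall u v J, sphere J -> D (slice_pt J (u, v)) ->
        f (slice_pt J (u, v)) = (ab.1 u v + imag J * ab.2 u v)%alg].

Definition slice_hyperholomorphic_R (D : paravector -> Prop)
    (f : paravector -> R5) : Prop :=
  [/\ open D, axially_symmetric D
    & exists2 ab : (R -> R -> R5) * (R -> R -> R5), slice_CR D ab.1 ab.2 &
      forall u v J, sphere J -> D (slice_pt J (u, v)) ->
        f (slice_pt J (u, v)) = (ab.1 u v + ab.2 u v * imag J)%alg].

Section SFunctionalCalculus.

Variable V : CompleteNormedModule R_AbsRing.
Implicit Types T X Y : BV5 V.

Definition BC01 T : Prop :=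
  exists (T0 : bop V) (Tv : 'I_5 -> bop V),
    [/\ T = para T0 Tv, forall i, (T0 * Tv i)%alg = (Tv i * T0)%alg
      & forall i j, (Tv i * Tv j)%alg = (Tv j * Tv i)%alg].

Definition op_T0 T : BV5 V := cmono set0 (T set0).

(* Meaningful for T = T_0 + sum_j e_j T_j *)
Definition op_conj T : BV5 V := para (T set0) (fun j => opp (T [set j])).

Definition para_op (s : paravector) : BV5 V := cliff_op V (cliff s).

Definition Qcs (s : paravector) T : BV5 V :=
  (para_op s ^ 2 - para_op s * (T + op_conj T) + T * op_conj T)%alg.

Definition is_inverse X Y : Prop := (X * Y)%alg = 1%alg /\ (Y * X)%alg = 1%alg.

Definition S_spectrum T (s : paravector) : Prop :=
  ~ exists Y, is_inverse (Qcs s T) Y.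

(* The inverse of X when X is invertible *)
Definition op_inv X : BV5 V := epsilon (inhabits zero) (is_inverse X).

Inductive fine_op :=
  | opD | opDeltaD | opDelta | opDbar | opDbar2 | opDeltaDbar | opD2.

Definition resolvent_L (P : fine_op) (s : paravector) T : BV5 V :=
  let x := para_op s in
  let Tbar := op_conj T in
  let T0 := op_T0 T in
  let Qi := op_inv (Qcs s T) in
  match P with
  | opD => ((-4)%R *: Qi)%alg
  | opDelta => ((-8)%R *: ((x - Tbar) * Qi ^ 2))%alg
  | opDeltaD => (16%R *: Qi ^ 2)%alg
  | opD2 => ((-8)%R *: ((x - T) * Qi ^ 2))%alg
  | opDbar => (4%R *: ((x - Tbar) * Qi ^ 2 * (x - T0)) + 2%R *: Qi)%alg
  | opDbar2 => (32%R *: ((x - Tbar) * Qi ^ 3 * (x - T0) ^ 2))%alg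
  | opDeltaDbar => ((-64)%R *: ((x - Tbar) * Qi ^ 3 * (x - T0)))%alg
  end.

Definition resolvent_R (P : fine_op) (s : paravector) T : BV5 V :=
  let x := para_op s in
  let Tbar := op_conj T in
  let T0 := op_T0 T in
  let Qi := op_inv (Qcs s T) in
  match P with
  | opD => ((-4)%R *: Qi)%alg
  | opDelta => ((-8)%R *: (Qi ^ 2 * (x - Tbar)))%alg
  | opDeltaD => (16%R *: Qi ^ 2)%alg
  | opD2 => ((-8)%R *: (Qi ^ 2 * (x - T)))%alg
  | opDbar => (4%R *: ((x - T0) * Qi ^ 2 * (x - Tbar)) + 2%R *: Qi)%alg
  | opDbar2 => (32%R *: ((x - T0) ^ 2 * Qi ^ 3 * (x - Tbar)))%alg
  | opDeltaDbar => ((-64)%R *: ((x - T0) * Qi ^ 3 * (x - Tbar)))%alg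
  end.

(* ds_J = ds (-J) along s = u + J v, (u, v) = g(t) *)
Definition dsJ (J : 'I_5 -> R) (g : R -> C) (t : R) : R5 :=
  (cliff (slice_pt J (velocity g t)) * (- imag J))%alg.

Definition integrand_L (P : fine_op) T (f : paravector -> R5)
    (J : 'I_5 -> R) (g : R -> C) (t : R) : BV5 V :=
  let s := slice_pt J (g t) in
  (resolvent_L P s T * cliff_op V (dsJ J g t) * cliff_op V (f s))%alg.

Definition integrand_R (P : fine_op) T (f : paravector -> R5)
    (J : 'I_5 -> R) (g : R -> C) (t : R) : BV5 V :=
  let s := slice_pt J (g t) in
  (cliff_op V (f s) * cliff_op V (dsJ J g t) * resolvent_R P s T)%alg.

(* The integrals over the n curves exist in the norm of B(V_5), and 1 / (2 pi)
   times their sum is L *)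
Definition is_contour_integral n (F : 'I_n -> R -> BV5 V) (L : BV5 V) : Prop :=
  exists I : 'I_n -> BV5 V,
    (forall k, is_RInt (F k) 0 1 (I k)) /\
    L = ((/ (2 * PI))%R *: \sum_(k : 'I_n) I k)%alg.

(* J, U and the parametrization g of the boundary of U \cap C_J are admissible
   for the functional calculus on functions with domain D *)
Definition admissible T (D : paravector -> Prop) (J : 'I_5 -> R)
    (U : paravector -> Prop) n (g : 'I_n -> R -> C) : Prop :=
  [/\ sphere J,
      bounded_set U /\ slice_cauchy_domain U,
      forall s, S_spectrum T s -> U s,
      forall s, adherent U s -> D s
    & jordan_boundary (slice U J) g /\ positively_oriented (slice U J) g].

End SFunctionalCalculus.

(* Main.v *)
From Stdlib Require Import Reals Lra ClassicalEpsilon.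
From Stdlib Require Import FunctionalExtensionality PropExtensionality.
From mathcomp Require Import all_boot.
From Coquelicot Require Import Coquelicot.
Require Import Defs.

(** Both integrals have the form of F(s) ds_J G(s) along the boundary of the
    slice of U, with F right and G left slice hyperholomorphic off the spectrum:
    one of them is the resolvent operator, the other is the function f.  In the
    coordinates s = u + J v the hypotheses say F_v = F_u J and G_v = J G_u, so
    (F G)_v = (F J G)_u and (F J G)_v = - (F G)_u: the pair (F G, F J G)
    satisfies the Cauchy-Riemann equations (holo_slice_pair), although neither
    factor commutes with J, and the form is that of a holomorphic function
    with values in a real Banach space.

    The resolvent operators are slice functions because Q = a + b J, where a and
    b commute and act on the coefficients only (Qcs_slice).  The product of
    a + b J with its image under the grade involution, which exchanges J and
    - J, is a^2 + b^2 for every J; so if Q is invertible for one J it is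
    invertible for all, and the coefficients of the inverse do not depend on J
    (inverse_units).  The Neumann series makes the set of invertible elements
    open (locally_inverse), and the identity for the difference of two inverses
    gives the derivative of Q^-1 (has_diff_inverse, intrinsic_Qinv).  The other
    factors of the resolvent operators are affine functions of s.

    For a fixed J let A and A' be the slices of two domains.  Every point off
    E = (cl A union cl A') minus (A inter A') has the same winding number with
    respect to both boundaries: 1 in A inter A', 0 outside the closures.  The
    spectrum lies in A inter A', so the pair is holomorphic around E, and the two
    integrals agree by the homological form of Cauchy's theorem
    (cauchy_homology, chain_int_bounds_eq).  To prove that theorem, a square grid
    is taken so fine that the cells meeting E lie where the pair is holomorphic.
    By Cauchy's formula on these cells (cauchy_rect) the value of the pair at a
    point of E is a sum of integrals of Cauchy's kernel over edges; an edge that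
    meets E belongs to two such cells and cancels.  For the other edges the
    order of integration along the edge and along the chain is exchanged, and
    the inner integral is then a winding number around a point off E, hence 0
    (negligible_kernel).

    For a fixed U, two units J and K are compared by means of the reflection
    v |-> - v.  The slice of U is symmetric since U contains u + J v and
    u - J v together, so the reflected boundary bounds the same region and gives
    the same integral.  The sum of the form and of its reflection contains J
    only in even degree, that is, not at all (slice_form_reflect, chain_int_unit).

    Cauchy's theorem for a rectangle and the exchange of two integrals both
    follow from the principle that a function of rectangles vanishes if it is
    additive under subdivision and small compared with the area near each point
    (additive_on_rect_eq0).  The integrals exist because B(V_5) is complete. *)

Set Implicit Arguments.
Unset Strict Implicit.
Unset Printing Implicit Defensive.

Local Open Scope R_scope.

(** * Linear identities in a real vector space *)

(** Formal linear combinations of atoms.  They turn an identity between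
    vectors into the equality of the coefficients, which is a problem about
    real numbers. *)
Inductive lin_expr :=
  | LVar of nat
  | LZero
  | LPlus of lin_expr & lin_expr
  | LOpp of lin_expr
  | LScal of R & lin_expr.

Section LinExpr.

Variable X : ModuleSpace R_Ring.

Fixpoint lin_eval (xs : seq X) (e : lin_expr) : X :=
  match e with
  | LVar i => nth zero xs i
  | LZero => zero
  | LPlus a b => plus (lin_eval xs a) (lin_eval xs b)
  | LOpp a => opp (lin_eval xs a)
  | LScal r a => scal r (lin_eval xs a)
  end.

Fixpoint lin_coef (e : lin_expr) (i : nat) : R :=
  match e with
  | LVar j => if Nat.eqb i j then 1 else 0
  | LZero => 0
  | LPlus a b => lin_coef a i + lin_coef b i
  | LOpp a => - lin_coef a i
  | LScal r a => r * lin_coef a i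
  end.

Lemma lin_evalE xs e :
  lin_eval xs e = \big[plus/zero]_(i < size xs)
                    scal (lin_coef e i) (nth zero xs i).
Proof.
elim: e => [j||a IHa b IHb|a IHa|r a IHa] /=; rewrite ?IHa ?IHb.
- case: (ltnP j (size xs)) => [ltj|gej].
    rewrite (bigD1 (Ordinal ltj)) //= PeanoNat.Nat.eqb_refl big1.
      by rewrite plus_zero_r (scal_one (K := R_Ring)).
    move=> i /eqP ni; case: PeanoNat.Nat.eqb_spec => [ij|_].
      by case: ni; apply: val_inj.
    exact: (scal_zero_l (K := R_Ring)).
  rewrite nth_default // big1 // => i _.
  case: PeanoNat.Nat.eqb_spec => [ij|_]; last exact: (scal_zero_l (K := R_Ring)).
  by move: (ltn_ord i); rewrite ij ltnNge gej.
- by rewrite big1 // => i _; exact: (scal_zero_l (K := R_Ring)).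
- by rewrite -big_split; apply: eq_bigr => i _; exact: (esym (scal_distr_r (K := R_Ring) _ _ _)).
- rewrite (big_morph _ (@opp_plus _) (@opp_zero _)).
  by apply: eq_bigr => i _; exact: (esym (scal_opp_l (K := R_Ring) _ _)).
- rewrite (big_morph _ (@scal_distr_l _ _ r) (@scal_zero_r _ _ r)).
  by apply: eq_bigr => i _; exact: (scal_assoc (K := R_Ring)).
Qed.

Lemma lin_eval_eq xs e1 e2 :
  foldr (fun i P => lin_coef e1 i = lin_coef e2 i /\ P) True
    (seq.iota 0 (size xs)) ->
  lin_eval xs e1 = lin_eval xs e2.
Proof.
move=> h; rewrite !lin_evalE; apply: eq_bigr => i _; congr scal.
have : nat_of_ord i \in seq.iota 0 (size xs) by rewrite mem_iota add0n ltn_ord.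
elim: (seq.iota _ _) h => // j s IH /= [e h]; rewrite inE => /orP[/eqP ->|] //.
exact: IH.
Qed.

End LinExpr.

Ltac lin_find x xs :=
  lazymatch xs with
  | x :: _ => constr:(0%N)
  | _ :: ?t => let n := lin_find x t in constr:(S n)
  end.
Ltac lin_mem x xs :=
  lazymatch xs with
  | x :: _ => constr:(true)
  | _ :: ?t => lin_mem x t
  | _ => constr:(false)
  end.
Ltac lin_atoms X t xs :=
  lazymatch t with
  | plus ?a ?b => let ys := lin_atoms X a xs in lin_atoms X b ys
  | minus ?a ?b => let ys := lin_atoms X a xs in lin_atoms X b ys
  | opp ?a => lin_atoms X a xs
  | scal _ ?a => lin_atoms X a xs
  | zero => xs
  | _ => lazymatch lin_mem t xs with
         | true => xs
         | false => constr:(@cons X t xs)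
         end
  end.
Ltac lin_reify t xs :=
  lazymatch t with
  | plus ?a ?b => let u := lin_reify a xs in let v := lin_reify b xs in
                  constr:(LPlus u v)
  | minus ?a ?b => let u := lin_reify a xs in let v := lin_reify b xs in
                   constr:(LPlus u (LOpp v))
  | opp ?a => let u := lin_reify a xs in constr:(LOpp u)
  | scal ?r ?a => let u := lin_reify a xs in constr:(LScal r u)
  | zero => constr:(LZero)
  | _ => let n := lin_find t xs in constr:(LVar n)
  end.
Ltac lin_eq_prepare :=
  lazymatch goal with
  | |- @eq ?X ?a ?b =>
    let xs := lin_atoms X a (@nil X) in
    let xs := lin_atoms X b xs in
    let e1 := lin_reify a xs in
    let e2 := lin_reify b xs in
    let h := fresh in
    assert (h := @lin_eval_eq _ xs e1 e2);
    refine (h _); clear h; cbn -[Rplus Rmult Ropp Rminus Rinv Rdiv pow IZR]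
  end.
Ltac lin_eq :=
  lin_eq_prepare;
  rewrite /mult /plus /opp /one /zero /=; repeat split; try ring; try lra.

(** * Subdivision of rectangles *)

Lemma vec_eq0_of_small (X : NormedModule R_AbsRing) (x : X) :
  (forall eps, 0 < eps -> norm x <= eps) -> x = zero.
Proof.
move=> h; apply: norm_eq_zero; apply: Rle_antisym; last exact: norm_ge_0.
by apply: Rle_plus_epsilon => eps e0; rewrite Rplus_0_l; exact: h.
Qed.

Lemma pos_below (xs : seq R) : foldr (fun x Q => 0 < x /\ Q) True xs ->
  exists e, 0 < e /\ foldr (fun x Q => e < x /\ Q) True xs.
Proof.
elim: xs => [|x xs IH] /=; first by exists 1; split => //; lra.
move=> [x0 /IH [e [e0 he]]]; have m0 : 0 < Rmin x e by exact: Rmin_pos.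
have m1 := Rmin_l x e; have m2 := Rmin_r x e.
exists (Rmin x e / 2); split; first lra; split; first lra.
by elim: (xs) he => //= y ys IHy [h1 h2]; split; [lra|exact: IHy].
Qed.

Lemma nested_intervals (u v : nat -> R) :
  (forall n, u n <= u n.+1) -> (forall n, v n.+1 <= v n) ->
  (forall n, u n <= v n) ->
  exists p, forall n, u n <= p <= v n.
Proof.
move=> uS vS uv.
have uM n k : u n <= u (n + k)%N.
  elim: k => [|k IH]; first by rewrite addn0; exact: Rle_refl.
  by rewrite addnS; exact: Rle_trans IH (uS _).
have vM n k : v (n + k)%N <= v n.
  elim: k => [|k IH]; first by rewrite addn0; exact: Rle_refl.
  by rewrite addnS; exact: Rle_trans (vS _) IH.
have ub n m : u m <= v n.
  apply: Rle_trans (uM m n) _; apply: Rle_trans (uv _) _.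
  by rewrite addnC.
have [|| p [pub plub]] := completeness (fun x => exists n, x = u n).
- by exists (v 0%N) => x [n ->].
- by exists (u 0%N), 0%N.
exists p => n; split; first by apply: pub; exists n.
by apply: plub => x [m ->].
Qed.

(** Bisection in both directions: a rectangle without the property has a
    quarter without it, and so on; the quarters shrink to a point, near which
    the property holds. *)
Lemma rect_bisection (P : R -> R -> R -> R -> Prop) a b c d :
  a <= b -> c <= d ->
  (forall x1 x2 y1 y2, a <= x1 -> x1 <= x2 -> x2 <= b ->
     c <= y1 -> y1 <= y2 -> y2 <= d ->
     let x := (x1 + x2) / 2 in let y := (y1 + y2) / 2 in
     P x1 x y1 y -> P x x2 y1 y -> P x1 x y y2 -> P x x2 y y2 ->
     P x1 x2 y1 y2) ->
  (forall p q, a <= p <= b -> c <= q <= d ->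
     exists2 delta, 0 < delta & forall x1 x2 y1 y2,
       a <= x1 -> x1 <= p <= x2 -> x2 <= b ->
       c <= y1 -> y1 <= q <= y2 -> y2 <= d ->
       x2 - x1 < delta -> y2 - y1 < delta -> P x1 x2 y1 y2) ->
  P a b c d.
Proof.
move=> ab cd Pquarter Ploc; apply: NNPP => nP.
pose Q (r : (R * R) * (R * R)) := P r.1.1 r.1.2 r.2.1 r.2.2.
pose good (r : (R * R) * (R * R)) := a <= r.1.1 /\ r.1.1 <= r.1.2 /\
  r.1.2 <= b /\ c <= r.2.1 /\ r.2.1 <= r.2.2 /\ r.2.2 <= d /\ ~ Q r.
pose quarter (r s : (R * R) * (R * R)) :=
  ((s.1 = (r.1.1, (r.1.1 + r.1.2) / 2) \/ s.1 = ((r.1.1 + r.1.2) / 2, r.1.2)) /\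
   (s.2 = (r.2.1, (r.2.1 + r.2.2) / 2) \/ s.2 = ((r.2.1 + r.2.2) / 2, r.2.2))).
have step r : exists s, good r -> good s /\ quarter r s.
  case: (classic (exists s, quarter r s /\ ~ Q s)) => [[s [qs nQ]]|no].
    exists s => -[h1 [h2 [h3 [h4 [h5 [h6 _]]]]]]; split => //.
    case: (qs); rewrite /good.
    by case=> -> [->|->] /=; repeat split => //; lra.
  exists r => -[h1 [h2 [h3 [h4 [h5 [h6 nQ]]]]]]; case: nQ.
  have hq s t u v : quarter r ((s, t), (u, v)) -> P s t u v.
    by move=> qs; apply: NNPP => nP'; apply: no; exists ((s, t), (u, v)).
  apply: Pquarter => //.
  - by apply: hq; split; left.
  - by apply: hq; split; [right|left].
  - by apply: hq; split; [left|right].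
  - by apply: hq; split; right.
pose next r := proj1_sig (constructive_indefinite_description _ (step r)).
pose r n := iter n next ((a, b), (c, d)).
have gr n : good (r n).
  elim: n => [|n IH]; first by rewrite /good /=; do ?[split; first lra].
  by rewrite /r iterS; apply: (proj1 (proj2_sig
       (constructive_indefinite_description _ (step (r n))) IH)).
have qr n : quarter (r n) (r n.+1).
  by apply: (proj2 (proj2_sig
       (constructive_indefinite_description _ (step (r n))) (gr n))).
have lenx n : (r n).1.2 - (r n).1.1 = (b - a) * (/ 2) ^ n.
  elim: n => [|n IH] /=; first ring.
  by case: (qr n) => -[-> | ->] _ /=; rewrite -/(r n); move: IH; nra.
have leny n : (r n).2.2 - (r n).2.1 = (d - c) * (/ 2) ^ n.
  elim: n => [|n IH] /=; first ring.
  by case: (qr n) => _ [-> | ->] /=; rewrite -/(r n); move: IH; nra.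
have [||| p hp] := @nested_intervals (fun n => (r n).1.1) (fun n => (r n).1.2).
- by move=> n; have := gr n; case: (qr n) => -[-> | ->] _ /=; rewrite /good; lra.
- by move=> n; have := gr n; case: (qr n) => -[-> | ->] _ /=; rewrite /good; lra.
- by move=> n; have := gr n; rewrite /good; lra.
have [||| q hq] := @nested_intervals (fun n => (r n).2.1) (fun n => (r n).2.2).
- by move=> n; have := gr n; case: (qr n) => _ [-> | ->] /=; rewrite /good; lra.
- by move=> n; have := gr n; case: (qr n) => _ [-> | ->] /=; rewrite /good; lra.
- by move=> n; have := gr n; rewrite /good; lra.
have [||delta dpos Pd] := Ploc p q.
- by have := hp 0%N.
- by have := hq 0%N.
have [n small] : exists n, (b - a) * (/ 2) ^ n < delta /\
                           (d - c) * (/ 2) ^ n < delta.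
  have [||n hn] := pow_lt_1_zero (/ 2) _ (delta / (1 + (b - a) + (d - c))).
  - by rewrite Rabs_pos_eq; lra.
  - by apply: Rdiv_lt_0_compat; lra.
  have := hn n (le_n _); rewrite Rabs_pos_eq; last by apply: pow_le; lra.
  have pw : 0 < (/ 2) ^ n by apply: pow_lt; lra.
  move=> /(Rmult_lt_compat_r (1 + (b - a) + (d - c))) => h.
  have {}h : (/ 2) ^ n * (1 + (b - a) + (d - c)) < delta.
    have -> : delta = delta / (1 + (b - a) + (d - c)) * (1 + (b - a) + (d - c)).
      by field; lra.
    by apply: h; lra.
  by exists n; split; nra.
have [g1 [g2 [g3 [g4 [g5 [g6 nQ]]]]]] := gr n; apply: nQ.
apply: (Pd _ _ _ _ g1 (hp n) g3 g4 (hq n) g6).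
- by rewrite lenx; lra.
- by rewrite leny; lra.
Qed.

(** Both Cauchy's theorem and the exchange of two integrals are instances: the
    defect in the identity is additive under subdivision, and near each point
    it is small compared with the area. *)
Lemma additive_on_rect_eq0 (X : NormedModule R_AbsRing)
    (m : R -> R -> R -> R -> X) a b c d :
  a <= b -> c <= d ->
  (forall x1 x2 y1 y2, a <= x1 -> x1 <= x2 -> x2 <= b ->
     c <= y1 -> y1 <= y2 -> y2 <= d ->
     let x := (x1 + x2) / 2 in let y := (y1 + y2) / 2 in
     m x1 x2 y1 y2
     = ((m x1 x y1 y + m x x2 y1 y) + (m x1 x y y2 + m x x2 y y2))%alg) ->
  (forall p q eps, a <= p <= b -> c <= q <= d -> 0 < eps ->
     exists2 delta, 0 < delta & forall x1 x2 y1 y2,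
       a <= x1 -> x1 <= p <= x2 -> x2 <= b ->
       c <= y1 -> y1 <= q <= y2 -> y2 <= d ->
       x2 - x1 < delta -> y2 - y1 < delta ->
       norm (m x1 x2 y1 y2) <= eps * (x2 - x1 + (y2 - y1)) ^ 2) ->
  m a b c d = zero.
Proof.
move=> ab cd madd mloc.
have le_eps eps : 0 < eps -> norm (m a b c d) <= eps * (b - a + (d - c)) ^ 2.
  move=> e0; apply: (rect_bisection (P := fun x1 x2 y1 y2 =>
    norm (m x1 x2 y1 y2) <= eps * (x2 - x1 + (y2 - y1)) ^ 2)) => //.
    move=> x1 x2 y1 y2 h1 h2 h3 h4 h5 h6 x y m1 m2 m3 m4.
    rewrite (madd x1 x2 y1 y2) //; apply: Rle_trans (norm_triangle _ _) _.
    apply: Rle_trans (Rplus_le_compat _ _ _ _ (norm_triangle _ _)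
                        (norm_triangle _ _)) _.
    apply: Rle_trans (Rplus_le_compat _ _ _ _ (Rplus_le_compat _ _ _ _ m1 m2)
                        (Rplus_le_compat _ _ _ _ m3 m4)) _.
    by rewrite /x /y; apply: Req_le; field.
  by move=> p q hp hq; exact: mloc.
apply: vec_eq0_of_small => eps e0; set S := b - a + (d - c) in le_eps.
have S0 : 0 < 1 + S ^ 2 by have := pow2_ge_0 S; lra.
have e1 : 0 < eps / (1 + S ^ 2) by exact: Rdiv_lt_0_compat.
apply: Rle_trans (le_eps _ e1) _.
have -> : eps / (1 + S ^ 2) * S ^ 2 = eps - eps / (1 + S ^ 2) by field; lra.
lra.
Qed.

(** * Integrals depending on a parameter *)

Lemma continuous_norm (U : UniformSpace) (X : NormedModule R_AbsRing)
    (f : U -> X) x eps :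
  continuous f x -> 0 < eps ->
  locally x (fun y => norm (minus (f y) (f x)) < eps).
Proof.
move=> cf e0; apply: (cf (fun z => norm (minus z (f x)) < eps)).
by apply: (locally_le_locally_norm (f x)); exists (mkposreal _ e0).
Qed.

Lemma norm_continuous (U : UniformSpace) (X : NormedModule R_AbsRing)
    (f : U -> X) x :
  (forall eps, 0 < eps -> locally x (fun y => norm (minus (f y) (f x)) < eps)) ->
  continuous f x.
Proof.
move=> h; apply/filterlim_locally => eps.
by apply: filter_imp (h _ (cond_pos eps)) => y; exact: norm_compat1.
Qed.

Lemma locally_box (x y : R) (P : R * R -> Prop) :
  locally (x, y) P ->
  exists2 delta, 0 < delta & forall x' y', Rabs (x' - x) < delta ->
    Rabs (y' - y) < delta -> P (x', y').
Proof. by case=> d hd; exists d; [exact: cond_pos|move=> x' y' hx hy; exact: hd]. Qed.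

Lemma box_locally (x y : R) (P : R * R -> Prop) delta :
  0 < delta -> (forall x' y', Rabs (x' - x) < delta ->
    Rabs (y' - y) < delta -> P (x', y')) -> locally (x, y) P.
Proof. by move=> d0 hd; exists (mkposreal _ d0) => -[x' y'] [hx hy]; exact: hd. Qed.

Lemma locally_interval (x : R) (P : R -> Prop) :
  locally x P ->
  exists2 delta, 0 < delta & forall x', Rabs (x' - x) < delta -> P x'.
Proof. by case=> d hd; exists d; [exact: cond_pos|move=> x' hx; exact: hd]. Qed.

Lemma ex_RInt_continuous_le (X : CompleteNormedModule R_AbsRing) (f : R -> X) a b :
  a <= b -> (forall t, a <= t <= b -> continuous f t) -> ex_RInt f a b.
Proof.
move=> ab cf; apply: ex_RInt_continuous.
by rewrite Rmin_left // Rmax_right.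
Qed.

Lemma norm_RInt_le_const' (X : CompleteNormedModule R_AbsRing) (f : R -> X) a b M :
  a <= b -> ex_RInt f a b -> (forall t, a <= t <= b -> norm (f t) <= M) ->
  norm (RInt f a b) <= (b - a) * M.
Proof.
by move=> ab ef fM; apply: (norm_RInt_le_const f a b _ M ab fM); exact: RInt_correct.
Qed.

Lemma RInt_eq_le (X : CompleteNormedModule R_AbsRing) (f g : R -> X) a b :
  a <= b -> (forall t, a <= t <= b -> f t = g t) -> RInt f a b = RInt g a b.
Proof.
move=> ab fg; apply: RInt_ext => t.
by rewrite Rmin_left // Rmax_right // => ht; apply: fg; lra.
Qed.

Lemma RInt_near_const (X : CompleteNormedModule R_AbsRing) (f : R -> X) a b v eps :
  a <= b -> ex_RInt f a b ->
  (forall t, a <= t <= b -> norm (minus (f t) v) <= eps) ->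
  norm (minus (RInt f a b) (scal (b - a) v)) <= (b - a) * eps.
Proof.
move=> ab ef hf; have ev := ex_RInt_const a b v.
rewrite -(RInt_const a b v) -RInt_minus //.
by apply: norm_RInt_le_const' => //; exact: ex_RInt_minus.
Qed.

(** The tube lemma.  Bisection replaces compactness; the rectangle that is
    divided has a degenerate first side. *)
Lemma uniform_on_interval (U : UniformSpace) (P : U -> R -> Prop) u c d :
  c <= d ->
  (forall y, c <= y <= d -> locally (u, y) (fun p : U * R => P p.1 p.2)) ->
  locally u (fun v => forall y, c <= y <= d -> P v y).
Proof.
move=> cd h.
apply: (rect_bisection (P := fun _ _ y1 y2 =>
  locally u (fun v => forall y, y1 <= y <= y2 -> P v y)) (Rle_refl 0) cd).
  move=> _ _ y1 y2 _ _ _ _ _ _ /= h1 _ h2 _.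
  apply: filter_imp (filter_and _ _ h1 h2) => v [{}h1 {}h2] y hy.
  by case: (Rle_dec y ((y1 + y2) / 2)) => ?; [apply: h1|apply: h2]; lra.
move=> p q _ /h [delta hd]; exists (delta); first exact: cond_pos.
move=> x1 x2 y1 y2 _ _ _ _ hq _ _ small; exists delta => v hv y hy.
apply: (hd (v, y)); split => //=.
by rewrite /ball /= /AbsRing_ball /= /abs /minus /plus /opp /=; apply: Rabs_def1; lra.
Qed.

Lemma continuous_RInt_param (U : UniformSpace) (X : CompleteNormedModule R_AbsRing)
    (phi : U -> R -> X) u c d :
  c <= d -> locally u (fun v => ex_RInt (phi v) c d) ->
  (forall y, c <= y <= d ->
     continuous (fun p : U * R => phi p.1 p.2) (u, y)) ->
  continuous (fun v => RInt (phi v) c d) u.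
Proof.
move=> cd exI cphi; apply: norm_continuous => eps e0.
have e1 : 0 < eps / (2 * (1 + (d - c))) by apply: Rdiv_lt_0_compat; lra.
have unif : locally u (fun v => forall y, c <= y <= d ->
    norm (minus (phi v y) (phi u y)) < eps / (1 + (d - c))).
  apply: (uniform_on_interval (P := fun v y =>
    norm (minus (phi v y) (phi u y)) < eps / (1 + (d - c)))) => // y hy.
  have h := continuous_norm (cphi y hy) e1.
  have h' : locally (u, y) (fun p : U * R =>
      norm (minus (phi u p.2) (phi u y)) < eps / (2 * (1 + (d - c)))).
    case: h => delta h; exists delta => -[v w] [_ hw] /=.
    by apply: (h (u, w)); split => //; exact: ball_center.
  apply: filter_imp (filter_and _ _ h h') => -[v w] [/= h1 h2].
  rewrite (minus_trans (phi u y)) -(opp_minus (phi u w) (phi u y)).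
  apply: Rle_lt_trans (norm_triangle _ _) _; rewrite norm_opp.
  have -> : eps / (1 + (d - c)) = eps / (2 * (1 + (d - c))) + eps / (2 * (1 + (d - c))).
    by field; lra.
  exact: Rplus_lt_compat.
apply: filter_imp (filter_and _ _ exI unif) => v [ev hv].
have eu := locally_singleton _ _ exI.
rewrite -RInt_minus //.
apply: Rle_lt_trans (norm_RInt_le_const' (M := eps / (1 + (d - c))) cd _ _) _.
- exact: ex_RInt_minus.
- by move=> y hy; left; exact: hv.
- apply: (Rmult_lt_reg_r (1 + (d - c))); first lra.
  by field_simplify; [nra|lra].
Qed.

Definition clamp a b x := Rmax a (Rmin b x).

Lemma clamp_in a b x : a <= b -> a <= clamp a b x <= b.
Proof.
by move=> ab; rewrite /clamp /Rmax /Rmin; do 2 destruct Rle_dec; lra.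
Qed.

Lemma clamp_id a b x : a <= x <= b -> clamp a b x = x.
Proof. by move=> h; rewrite /clamp Rmin_right ?Rmax_right; lra. Qed.

Lemma continuous_clamp a b x : continuous (clamp a b) x.
Proof.
apply: norm_continuous => eps e0; exists (mkposreal _ e0) => y.
rewrite /ball /= /AbsRing_ball /= /norm /= /abs /minus /plus /opp /=.
apply: Rle_lt_trans; rewrite /clamp /Rmax /Rmin.
by repeat destruct Rle_dec; rewrite /Rabs; repeat destruct Rcase_abs; lra.
Qed.

Lemma continuous_row (Y : NormedModule R_AbsRing) (P : C -> Y) x y :
  continuous P (x, y) -> continuous (fun t => P (t, y)) x.
Proof.
move=> cP; apply: (continuous_comp_2 id (fun _ => y) (fun a b => P (a, b))).
- exact: continuous_id.
- exact: continuous_const.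
- by apply: continuous_ext cP => -[].
Qed.

Lemma continuous_col (Y : NormedModule R_AbsRing) (P : C -> Y) x y :
  continuous P (x, y) -> continuous (fun t => P (x, t)) y.
Proof.
move=> cP; apply: (continuous_comp_2 (fun _ => x) id (fun a b => P (a, b))).
- exact: continuous_const.
- exact: continuous_id.
- by apply: continuous_ext cP => -[].
Qed.

(** The difference of the two iterated integrals is additive in the rectangle,
    and on a small rectangle both are close to the area times the value of phi
    at a point. *)
Lemma RInt_swap_continuous (X : CompleteNormedModule R_AbsRing)
    (phi : R -> R -> X) a b c d :
  (forall p, continuous (fun p : R * R => phi p.1 p.2) p) ->
  a <= b -> c <= d ->
  RInt (fun x => RInt (phi x) c d) a b
  = RInt (fun y => RInt (fun x => phi x y) a b) c d.
Proof.
move=> cphi ab cd.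
have cx x y : continuous (phi x) y := continuous_col (cphi (x, y)).
have cy x y : continuous (fun x => phi x y) x := continuous_row (cphi (x, y)).
have ex x y1 y2 : ex_RInt (phi x) y1 y2 by apply: ex_RInt_continuous.
have ey y x1 x2 : ex_RInt (fun x => phi x y) x1 x2 by apply: ex_RInt_continuous.
have cIx x y1 y2 : y1 <= y2 -> continuous (fun x => RInt (phi x) y1 y2) x.
  move=> le; apply: continuous_RInt_param => //; first exact: filter_forall.
have cIy y x1 x2 : x1 <= x2 -> continuous (fun y => RInt (fun x => phi x y) x1 x2) y.
  move=> le; apply: (continuous_RInt_param (phi := fun y x => phi x y)) => //.
    exact: filter_forall.
  move=> x _ /=; apply: (continuous_comp_2 snd fst phi (y, x)) (cphi (x, y)).
    exact: continuous_snd.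
  exact: continuous_fst.
have eIx x1 x2 y1 y2 : y1 <= y2 -> ex_RInt (fun x => RInt (phi x) y1 y2) x1 x2.
  by move=> le; apply: ex_RInt_continuous => z _; exact: cIx.
have eIy x1 x2 y1 y2 : x1 <= x2 -> ex_RInt (fun y => RInt (fun x => phi x y) x1 x2) y1 y2.
  by move=> le; apply: ex_RInt_continuous => z _; exact: cIy.
pose m x1 x2 y1 y2 := minus (RInt (fun x => RInt (phi x) y1 y2) x1 x2)
  (RInt (fun y => RInt (fun x => phi x y) x1 x2) y1 y2).
suff m0 : m a b c d = zero.
  apply: (plus_reg_r (opp (RInt (fun y => RInt (fun x => phi x y) a b) c d))).
  by rewrite plus_opp_r.
apply: (additive_on_rect_eq0 (m := m)) => //.
- move=> x1 x2 y1 y2 _ hx _ _ hy _ x y.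
  have [hx1 hx2] : x1 <= x /\ x <= x2 by rewrite /x; lra.
  have [hy1 hy2] : y1 <= y /\ y <= y2 by rewrite /y; lra.
  rewrite /m -(RInt_Chasles _ x1 x x2); try exact: eIx.
  rewrite -(RInt_Chasles _ y1 y y2 (eIy _ _ _ _ hx) (eIy _ _ _ _ hx)).
  have Dx u v : u <= v -> RInt (fun x => RInt (phi x) y1 y2) u v
    = plus (RInt (fun x => RInt (phi x) y1 y) u v)
           (RInt (fun x => RInt (phi x) y y2) u v).
    move=> uv; rewrite -RInt_plus; try exact: eIx.
    by apply: RInt_ext => t _; rewrite RInt_Chasles.
  have Dy u v : u <= v -> RInt (fun y => RInt (fun x => phi x y) x1 x2) u v
    = plus (RInt (fun y => RInt (fun x => phi x y) x1 x) u v)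
           (RInt (fun y => RInt (fun x => phi x y) x x2) u v).
    move=> uv; rewrite -RInt_plus; try exact: eIy.
    by apply: RInt_ext => t _; rewrite (RInt_Chasles (fun x => phi x t)).
  by rewrite !Dx // !Dy //; lin_eq.
- move=> p q eps hp hq e0.
  have [|delta d0 hd] := locally_box (continuous_norm (cphi (p, q)) (eps := eps) _) => //.
  exists delta => // x1 x2 y1 y2 _ px _ _ qy _ dx dy.
  have le1 : x1 <= x2 by lra.
  have le2 : y1 <= y2 by lra.
  have bnd x y : x1 <= x <= x2 -> y1 <= y <= y2 ->
      norm (minus (phi x y) (phi p q)) <= eps.
    by move=> hx hy; left; apply: (hd x y); apply: Rabs_def1; lra.
  set v := phi p q.
  have h1 : norm (minus (RInt (fun x => RInt (phi x) y1 y2) x1 x2)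
                  (scal (x2 - x1) (scal (y2 - y1) v))) <= (x2 - x1) * ((y2 - y1) * eps).
    apply: RInt_near_const => // [|t ht]; first exact: eIx.
    by apply: RInt_near_const => // y hy; exact: bnd.
  have h2 : norm (minus (RInt (fun y => RInt (fun x => phi x y) x1 x2) y1 y2)
                  (scal (y2 - y1) (scal (x2 - x1) v))) <= (y2 - y1) * ((x2 - x1) * eps).
    apply: RInt_near_const => // [|t ht]; first exact: eIy.
    by apply: RInt_near_const => // x hx; exact: bnd.
  rewrite /m.
  set A := RInt _ _ _ in h1 *; set B := RInt _ _ _ in h2 *.
  have -> : minus A B = minus (minus A (scal (x2 - x1) (scal (y2 - y1) v)))
                              (minus B (scal (y2 - y1) (scal (x2 - x1) v))).
    by lin_eq.
  apply: Rle_trans (norm_triangle _ _) _; rewrite norm_opp.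
  apply: Rle_trans (Rplus_le_compat _ _ _ _ h1 h2) _.
  have : 0 <= (x2 - x1) * (y2 - y1) by apply: Rmult_le_pos; lra.
  have : 0 <= eps * ((x2 - x1) ^ 2 + (y2 - y1) ^ 2) by apply: Rmult_le_pos; nra.
  nra.
Qed.

(** Truncation of the coordinates reduces to functions continuous on the whole
    plane, so that nothing has to be said about the edge of the rectangle. *)
Lemma continuous_truncated (X : NormedModule R_AbsRing) (phi : R -> R -> X) a b c d :
  a <= b -> c <= d ->
  (forall x y, a <= x <= b -> c <= y <= d ->
     continuous (fun p : R * R => phi p.1 p.2) (x, y)) ->
  forall p, continuous (fun p : R * R => phi (clamp a b p.1) (clamp c d p.2)) p.
Proof.
move=> ab cd cphi [x y].
apply: (continuous_comp_2 (fun p => clamp a b p.1) (fun p => clamp c d p.2) phi).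
- by apply: continuous_comp; [exact: continuous_fst|exact: continuous_clamp].
- by apply: continuous_comp; [exact: continuous_snd|exact: continuous_clamp].
- by apply: cphi; exact: clamp_in.
Qed.

Lemma RInt_swap (X : CompleteNormedModule R_AbsRing) (phi : R -> R -> X) a b c d :
  a <= b -> c <= d ->
  (forall x y, a <= x <= b -> c <= y <= d ->
     continuous (fun p : R * R => phi p.1 p.2) (x, y)) ->
  [/\ ex_RInt (fun x => RInt (phi x) c d) a b,
      ex_RInt (fun y => RInt (fun x => phi x y) a b) c d
    & RInt (fun x => RInt (phi x) c d) a b
      = RInt (fun y => RInt (fun x => phi x y) a b) c d].
Proof.
move=> ab cd cphi; have cpsi := continuous_truncated ab cd cphi.
pose psi x y := phi (clamp a b x) (clamp c d y).
have psiE x y : a <= x <= b -> c <= y <= d -> phi x y = psi x y.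
  by move=> hx hy; rewrite /psi !clamp_id.
have ex1 x : a <= x <= b -> RInt (phi x) c d = RInt (psi x) c d.
  by move=> hx; apply: RInt_eq_le => // y hy; exact: psiE.
have ex2 y : c <= y <= d -> RInt (fun x => phi x y) a b = RInt (fun x => psi x y) a b.
  by move=> hy; apply: RInt_eq_le => // x hx; exact: psiE.
have cx x y : continuous (psi x) y := continuous_col (cpsi (x, y)).
have cy x y : continuous (fun x => psi x y) x := continuous_row (cpsi (x, y)).
split.
- apply: (ex_RInt_ext (fun x => RInt (psi x) c d)).
    by rewrite Rmin_left // Rmax_right // => x hx; rewrite ex1 //; lra.
  apply: ex_RInt_continuous => x _; apply: continuous_RInt_param => //.
  by apply: filter_forall => v; apply: ex_RInt_continuous.
- apply: (ex_RInt_ext (fun y => RInt (fun x => psi x y) a b)).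
    by rewrite Rmin_left // Rmax_right // => y hy; rewrite ex2 //; lra.
  apply: ex_RInt_continuous => y _.
  apply: (continuous_RInt_param (phi := fun y x => psi x y)) => //.
    by apply: filter_forall => v; apply: ex_RInt_continuous.
  move=> x _ /=; apply: (continuous_comp_2 snd fst psi (y, x)) (cpsi (x, y)).
    exact: continuous_snd.
  exact: continuous_fst.
- rewrite (RInt_eq_le ab ex1) (RInt_eq_le cd ex2).
  exact: RInt_swap_continuous.
Qed.

(** * Differentiable functions of two real variables *)

(** Differentiability at p with partial derivatives a and b, for functions on
    the plane C = R * R; the sum of the moduli of the coordinates is
    the norm that makes the estimates below shortest. *)
Definition has_diff (X : NormedModule R_AbsRing) (f : C -> X) (p : C) (a b : X) :=
  forall eps, 0 < eps -> locally p (fun q =>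
    norm (minus (minus (f q) (f p))
                (plus (scal (q.1 - p.1) a) (scal (q.2 - p.2) b)))
    <= eps * (Rabs (q.1 - p.1) + Rabs (q.2 - p.2))).

Definition bilinear (X Y Z : NormedModule R_AbsRing) (B : X -> Y -> Z) :=
  [/\ forall x x' y, B (plus x x') y = plus (B x y) (B x' y),
      forall x y y', B x (plus y y') = plus (B x y) (B x y'),
      forall k x y, B (scal k x) y = scal k (B x y),
      forall k x y, B x (scal k y) = scal k (B x y)
    & exists2 M, 0 < M & forall x y, norm (B x y) <= M * norm x * norm y].

Lemma norm_scal_le (X : NormedModule R_AbsRing) (k : R) (x : X) :
  norm (scal k x) <= Rabs k * norm x.
Proof. exact: norm_scal. Qed.

Lemma norm_plus_le (X : NormedModule R_AbsRing) (x y : X) (a b : R) :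
  norm x <= a -> norm y <= b -> norm (plus x y) <= a + b.
Proof.
by move=> xa yb; apply: Rle_trans (norm_triangle _ _) _; exact: Rplus_le_compat.
Qed.

Lemma norm_minus_le (X : NormedModule R_AbsRing) (x y : X) (a b : R) :
  norm x <= a -> norm y <= b -> norm (minus x y) <= a + b.
Proof. by move=> xa yb; apply: norm_plus_le => //; rewrite norm_opp. Qed.

Section HasDiff.

Variable X : NormedModule R_AbsRing.

Lemma has_diff_lipschitz (f : C -> X) p a b : has_diff f p a b ->
  locally p (fun q => norm (minus (f q) (f p))
     <= (norm a + norm b + 1) * (Rabs (q.1 - p.1) + Rabs (q.2 - p.2))).
Proof.
move=> /(_ 1 Rlt_0_1); apply: filter_imp => q h.
set d := minus (f q) (f p) in h *.
set l := plus _ _ in h.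
have -> : d = plus (minus d l) l by lin_eq.
apply: Rle_trans (norm_triangle _ _) _.
have nl : norm l <= Rabs (q.1 - p.1) * norm a + Rabs (q.2 - p.2) * norm b.
  by apply: Rle_trans (norm_triangle _ _) _; apply: Rplus_le_compat; exact: norm_scal_le.
apply: Rle_trans (Rplus_le_compat _ _ _ _ h nl) _.
have := Rmult_le_pos _ _ (Rabs_pos (q.1 - p.1)) (norm_ge_0 b).
have := Rmult_le_pos _ _ (Rabs_pos (q.2 - p.2)) (norm_ge_0 a).
by lra.
Qed.

Lemma locally_near (p : C) eps : 0 < eps ->
  locally p (fun q : C => Rabs (q.1 - p.1) + Rabs (q.2 - p.2) < eps).
Proof.
move=> e0; case: p => x y; apply: (box_locally (delta := eps / 2)); first lra.
by move=> x' y' /= ? ?; lra.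
Qed.

Lemma has_diff_continuous (f : C -> X) p a b : has_diff f p a b -> continuous f p.
Proof.
move=> df; apply: norm_continuous => eps e0.
set M := norm a + norm b + 1.
have M0 : 0 < M by rewrite /M; have := norm_ge_0 a; have := norm_ge_0 b; lra.
have near := @locally_near p (eps / M) (Rdiv_lt_0_compat _ _ e0 M0).
apply: filter_imp (filter_and _ _ (has_diff_lipschitz df) near) => q [h1 h2].
apply: Rle_lt_trans h1 _; rewrite -/M.
have -> : eps = M * (eps / M) by field; lra.
exact: Rmult_lt_compat_l.
Qed.

Lemma has_diff_ext (f g : C -> X) p a b :
  locally p (fun q => f q = g q) -> has_diff f p a b -> has_diff g p a b.
Proof.
move=> fg df eps e0; have fgp : f p = g p := locally_singleton _ _ fg.
by apply: filter_imp (filter_and _ _ fg (df _ e0)) => q [-> ]; rewrite fgp.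
Qed.

Lemma has_diff_const (x : X) p : has_diff (fun _ => x) p zero zero.
Proof.
move=> eps e0; apply: filter_forall => q.
have -> : minus (minus x x) (plus (scal (q.1 - p.1) zero) (scal (q.2 - p.2) zero)) = zero.
  by lin_eq.
rewrite norm_zero; apply: Rmult_le_pos; first lra.
by apply: Rplus_le_le_0_compat; exact: Rabs_pos.
Qed.

Lemma has_diff_plus (f g : C -> X) p a b a' b' :
  has_diff f p a b -> has_diff g p a' b' ->
  has_diff (fun q => plus (f q) (g q)) p (plus a a') (plus b b').
Proof.
move=> df dg eps e0; have e2 : 0 < eps / 2 by lra.
apply: filter_imp (filter_and _ _ (df _ e2) (dg _ e2)) => q [h1 h2].
set u := minus (minus _ _) _ in h1; set v := minus (minus _ _) _ in h2.
have -> : minus (minus (plus (f q) (g q)) (plus (f p) (g p)))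
  (plus (scal (q.1 - p.1) (plus a a')) (scal (q.2 - p.2) (plus b b'))) = plus u v.
  by rewrite /u /v; lin_eq.
by apply: Rle_trans (norm_triangle _ _) _; lra.
Qed.

Lemma has_diff_eq (f : C -> X) p a b a' b' :
  has_diff f p a b -> a = a' -> b = b' -> has_diff f p a' b'.
Proof. by move=> df <- <-. Qed.

End HasDiff.

Lemma has_diff_linear (X Y : NormedModule R_AbsRing) (l : X -> Y) (f : C -> X) p a b :
  is_linear l -> has_diff f p a b -> has_diff (fun q => l (f q)) p (l a) (l b).
Proof.
move=> [lD lS [M [M0 lM]]] df eps e0.
have := df (eps / M) (Rdiv_lt_0_compat _ _ e0 M0).
apply: filter_imp => q h.
have lN x : l (opp x) = opp (l x).
  by rewrite -(scal_opp_one (K := R_Ring) x) lS; exact: (scal_opp_one (K := R_Ring)).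
rewrite /minus -!lN -!lS -!lD -lN -lD; apply: Rle_trans (lM _) _.
apply: Rle_trans (Rmult_le_compat_l M _ _ (Rlt_le _ _ M0) h) _.
by apply: Req_le; field; lra.
Qed.

Section HasDiffBilinear.

Variables (X Y Z : NormedModule R_AbsRing).

Lemma bilinearN (B : X -> Y -> Z) : bilinear B ->
  (forall x y, B (opp x) y = opp (B x y)) /\ (forall x y, B x (opp y) = opp (B x y)).
Proof.
move=> [_ _ lS rS _]; split=> x y.
  rewrite -(scal_opp_one (K := R_Ring) x) lS; exact: (scal_opp_one (K := R_Ring)).
rewrite -(scal_opp_one (K := R_Ring) y) rS; exact: (scal_opp_one (K := R_Ring)).
Qed.

Lemma continuous_bilinear (U : UniformSpace) (B : X -> Y -> Z)
    (f : U -> X) (g : U -> Y) u :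
  bilinear B -> continuous f u -> continuous g u ->
  continuous (fun v => B (f v) (g v)) u.
Proof.
move=> Bb cf cg; have [BNl BNr] := bilinearN Bb.
case: Bb => BDl BDr _ _ [M M0 BM].
apply: norm_continuous => eps e0.
set A := M * (1 + norm (f u) + norm (g u)).
have A0 : 0 < A.
  by apply: Rmult_lt_0_compat => //; have := norm_ge_0 (f u); have := norm_ge_0 (g u); lra.
pose eta := Rmin 1 (eps / (2 * A)).
have eta1 : eta <= 1 by exact: Rmin_l.
have eta0 : 0 < eta by apply: Rmin_pos; [lra|apply: Rdiv_lt_0_compat; lra].
have Aeta : A * eta < eps.
  have h : eta <= eps / (2 * A) by exact: Rmin_r.
  apply: Rle_lt_trans (Rmult_le_compat_l A _ _ _ h) _; first lra.
  by have -> : A * (eps / (2 * A)) = eps / 2; [field|]; lra.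
apply: filter_imp (filter_and _ _ (continuous_norm cf eta0) (continuous_norm cg eta0)).
move=> v [hf hg].
set df := minus (f v) (f u) in hf; set dg := minus (g v) (g u) in hg.
have -> : minus (B (f v) (g v)) (B (f u) (g u))
  = plus (B df dg) (plus (B df (g u)) (B (f u) dg)).
  by rewrite /df /dg /minus !BDl !BDr !BNl !BNr; lin_eq.
apply: Rle_lt_trans (norm_triangle _ _) _.
apply: Rle_lt_trans (Rplus_le_compat_l _ _ _ (norm_triangle _ _)) _.
have hmul (x x' y y' : R) : 0 <= x -> 0 <= y -> x <= x' -> y <= y' ->
    M * x * y <= M * x' * y'.
  move=> hx hy hx' hy'; apply: Rmult_le_compat => //; first by apply: Rmult_le_pos; lra.
  by apply: Rmult_le_compat_l; lra.
have n1 := norm_ge_0 df; have n2 := norm_ge_0 dg.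
have n3 := norm_ge_0 (f u); have n4 := norm_ge_0 (g u).
have b1 : norm (B df dg) <= M * eta * 1.
  by apply: Rle_trans (BM _ _) _; apply: hmul; lra.
have b2 : norm (B df (g u)) <= M * eta * norm (g u).
  by apply: Rle_trans (BM _ _) _; apply: hmul; lra.
have b3 : norm (B (f u) dg) <= M * norm (f u) * eta.
  by apply: Rle_trans (BM _ _) _; apply: hmul; lra.
apply: Rle_lt_trans Aeta; apply: Rle_trans (Rplus_le_compat _ _ _ _ b1 (Rplus_le_compat _ _ _ _ b2 b3)) _.
by rewrite /A; apply: Req_le; ring.
Qed.

(** A factor that vanishes at the point needs only to be multiplied by a
    continuous function: the product rule and the derivative of an inverse both
    reduce to this case. *)
Lemma has_diff_bilinear0 (B : X -> Y -> Z) (f : C -> X) (g : C -> Y) p a b :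
  bilinear B -> continuous f p -> g p = zero -> has_diff g p a b ->
  has_diff (fun q => B (f q) (g q)) p (B (f p) a) (B (f p) b).
Proof.
move=> Bb cf g0 dg eps e0; have [BNl BNr] := bilinearN Bb.
case: Bb => BDl BDr _ BSr [M M0 BM].
set Cg := norm a + norm b + 1.
have Cg0 : 0 < Cg by rewrite /Cg; have := norm_ge_0 a; have := norm_ge_0 b; lra.
have nf0 := norm_ge_0 (f p).
have MC0 : 0 < 2 * M * Cg by repeat apply: Rmult_lt_0_compat; lra.
have Mf0 : 0 < 2 * M * (1 + norm (f p)) by repeat apply: Rmult_lt_0_compat; lra.
have e1 := Rdiv_lt_0_compat _ _ e0 MC0; have e2 := Rdiv_lt_0_compat _ _ e0 Mf0.
have hf := continuous_norm cf e1.
apply: filter_imp (filter_and _ _ hf (filter_and _ _ (has_diff_lipschitz dg) (dg _ e2))).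
move=> q [{}hf [lg {}dg]]; rewrite g0 minus_zero_r -/Cg in lg dg.
set r := Rabs _ + Rabs _ in lg dg *.
have r0 : 0 <= r by apply: Rplus_le_le_0_compat; exact: Rabs_pos.
set l := plus _ _ in dg; set df := minus _ _ in hf.
have -> : minus (minus (B (f q) (g q)) (B (f p) (g p)))
    (plus (scal (q.1 - p.1) (B (f p) a)) (scal (q.2 - p.2) (B (f p) b)))
  = plus (B df (g q)) (B (f p) (minus (g q) l)).
  have B0 x : B x zero = zero by exact: (additive0 (BDr x)).
  by rewrite g0 B0 /df /l /minus !BDl !BDr !BNl !BNr !BDr !BSr; lin_eq.
apply: Rle_trans (norm_triangle _ _) _.
have h1 : norm (B df (g q)) <= M * (eps / (2 * M * Cg)) * (Cg * r).
  apply: Rle_trans (BM _ _) _; apply: Rmult_le_compat => //; try exact: norm_ge_0.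
    by apply: Rmult_le_pos; [lra|exact: norm_ge_0].
  by apply: Rmult_le_compat_l; lra.
have h2 : norm (B (f p) (minus (g q) l))
    <= M * (1 + norm (f p)) * (eps / (2 * M * (1 + norm (f p))) * r).
  apply: Rle_trans (BM _ _) _; apply: Rmult_le_compat => //; try exact: norm_ge_0.
    by apply: Rmult_le_pos; lra.
  by apply: Rmult_le_compat_l; lra.
apply: Rle_trans (Rplus_le_compat _ _ _ _ h1 h2) _.
by apply: Req_le; field; lra.
Qed.

Lemma is_linear_bilinear_l (B : X -> Y -> Z) y : bilinear B -> is_linear (B^~ y).
Proof.
case=> BDl _ BSl _ [M M0 BM]; split => //.
exists (M * (1 + norm y)); have n0 := norm_ge_0 y.
split=> [|x]; first by apply: Rmult_lt_0_compat; lra.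
apply: Rle_trans (BM _ _) _.
have := Rmult_le_pos _ _ (Rlt_le _ _ M0) (norm_ge_0 x); lra.
Qed.

Lemma is_linear_bilinear_r (B : X -> Y -> Z) x : bilinear B -> is_linear (B x).
Proof.
case=> _ BDr _ BSr [M M0 BM]; split => //.
exists (M * (1 + norm x)); have n0 := norm_ge_0 x.
split=> [|y]; first by apply: Rmult_lt_0_compat; lra.
apply: Rle_trans (BM _ _) _; apply: Rmult_le_compat_r; first exact: norm_ge_0.
by apply: Rmult_le_compat_l; lra.
Qed.

Lemma has_diff_bilinear (B : X -> Y -> Z) (f : C -> X) (g : C -> Y) p a b a' b' :
  bilinear B -> has_diff f p a b -> has_diff g p a' b' ->
  has_diff (fun q => B (f q) (g q)) p
    (plus (B a (g p)) (B (f p) a')) (plus (B b (g p)) (B (f p) b')).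
Proof.
move=> Bb df dg; have cf := has_diff_continuous df.
pose g0 q := minus (g q) (g p).
have dg0 : has_diff g0 p a' b'.
  apply: (has_diff_eq (has_diff_plus dg (has_diff_const (opp (g p)) p)));
    exact: plus_zero_r.
have g00 : g0 p = zero by exact: plus_opp_r.
have d1 := has_diff_bilinear0 Bb cf g00 dg0.
have d2 := has_diff_linear (is_linear_bilinear_l (g p) Bb) df.
apply: has_diff_ext (has_diff_plus d2 d1); apply: filter_forall => q.
have [_ BNr] := bilinearN Bb; case: Bb => _ BDr _ _ _.
by rewrite /g0 /minus BDr BNr; lin_eq.
Qed.

End HasDiffBilinear.

Lemma is_linear_opp' (X : NormedModule R_AbsRing) : is_linear (@opp X).
Proof. exact: is_linear_opp. Qed.

(** The identity assumed for y is the resolvent identity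
    y(w) - y(p) = - y(w) (q(w) - q(p)) y(p) of the inverses of q(w) and q(p).
    It also gives the continuity of y: first a bound 2 |y(p)| for |y(w)| near p,
    then the convergence of y(w) to y(p). *)
Lemma has_diff_inverse (X : NormedModule R_AbsRing) (B : X -> X -> X)
    (q y : C -> X) p a b :
  bilinear B -> has_diff q p a b ->
  locally p (fun w => minus (y w) (y p)
                      = opp (B (B (y w) (minus (q w) (q p))) (y p))) ->
  has_diff y p (opp (B (B (y p) a) (y p))) (opp (B (B (y p) b) (y p))).
Proof.
move=> Bb dq resolv.
pose q0 w := minus (q w) (q p).
have dq0 : has_diff q0 p a b.
  apply: (has_diff_eq (has_diff_plus dq (has_diff_const (opp (q p)) p)));
    exact: plus_zero_r.
have q00 : q0 p = zero by exact: plus_opp_r.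
have [M M0 BM] : exists2 M, 0 < M & forall x y, norm (B x y) <= M * norm x * norm y.
  by case: Bb.
have ny0 := norm_ge_0 (y p).
have small eta : 0 < eta -> locally p (fun w => M * M * norm (q0 w) * norm (y p) < eta).
  move=> eta0; have D0 : 0 < M * M * (1 + norm (y p)).
    by repeat apply: Rmult_lt_0_compat; lra.
  have := continuous_norm (has_diff_continuous dq0) (Rdiv_lt_0_compat _ _ eta0 D0).
  apply: filter_imp => w; rewrite q00 minus_zero_r => h.
  have {}h := Rmult_lt_compat_l _ _ _ D0 h.
  have e : M * M * (1 + norm (y p)) * (eta / (M * M * (1 + norm (y p)))) = eta.
    by field; lra.
  rewrite e in h; apply: Rle_lt_trans h.
  have : 0 <= M * M * norm (q0 w).
    by apply: Rmult_le_pos; [apply: Rmult_le_pos; lra|exact: norm_ge_0].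
  lra.
have diffle : locally p (fun w => norm (minus (y w) (y p))
    <= (M * M * norm (q0 w) * norm (y p)) * norm (y w)).
  apply: filter_imp resolv => w ->; rewrite norm_opp.
  apply: Rle_trans (BM _ _) _.
  have -> : M * M * norm (q0 w) * norm (y p) * norm (y w)
    = M * (M * norm (y w) * norm (q0 w)) * norm (y p) by ring.
  by apply: Rmult_le_compat_r => //; apply: Rmult_le_compat_l; [lra|exact: BM].
have half : 0 < / 2 by lra.
have bound : locally p (fun w => norm (y w) <= 2 * norm (y p)).
  apply: filter_imp (filter_and _ _ diffle (small _ half)) => w [h1 h2].
  have h3 : norm (y w) <= norm (y p) + norm (minus (y w) (y p)).
    have -> : y w = plus (y p) (minus (y w) (y p)) by lin_eq.
    by apply: Rle_trans (norm_triangle _ _) _; apply: Req_le; congr (_ + norm _); lin_eq.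
  have := Rmult_le_compat_r _ _ _ (norm_ge_0 (y w)) (Rlt_le _ _ h2); lra.
have cy : continuous y p.
  apply: norm_continuous => eps e0.
  have e1 : 0 < eps / (1 + 2 * norm (y p)) by apply: Rdiv_lt_0_compat; lra.
  apply: filter_imp (filter_and _ _ (filter_and _ _ diffle bound) (small _ e1)).
  move=> w [[h1 h2] h3].
  apply: Rle_lt_trans h1 _.
  set u := M * M * _ * _ in h3 *.
  have u0 : 0 <= u by repeat apply: Rmult_le_pos; try exact: norm_ge_0; lra.
  have h4 : u * norm (y w) <= u * (1 + 2 * norm (y p)) by apply: Rmult_le_compat_l; lra.
  have h5 : u * (1 + 2 * norm (y p)) < eps.
    have -> : eps = eps / (1 + 2 * norm (y p)) * (1 + 2 * norm (y p)) by field; lra.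
    by apply: Rmult_lt_compat_r; lra.
  lra.
have d1 := has_diff_bilinear0 Bb cy q00 dq0.
have d2 := has_diff_linear (is_linear_bilinear_l (y p) Bb) d1.
have d3 := has_diff_plus (has_diff_linear (is_linear_opp' X) d2) (has_diff_const (y p) p).
apply: has_diff_ext (has_diff_eq d3 (plus_zero_r _) (plus_zero_r _)).
apply: filter_imp resolv => w e.
by rewrite -[opp _]e; lin_eq.
Qed.
(** * Holomorphic pairs and Cauchy's theorem on rectangles *)

Lemma is_RInt_linear (X Y : NormedModule R_AbsRing) (l : X -> Y) (f : R -> X)
    a b I :
  is_linear l -> is_RInt f a b I -> is_RInt (fun t => l (f t)) a b (l I).
Proof.
move=> ll fI.
have l0 : l zero = zero by exact: (additive0 (linear_plus _ ll)).
have lsum s : l (Riemann_sum f s) = Riemann_sum (fun t => l (f t)) s.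
  apply: (SF_cons_ind (fun s => l (Riemann_sum f s) = Riemann_sum (fun t => l (f t)) s)).
    by move=> x; rewrite /Riemann_sum /=.
  by move=> h s' IH; rewrite !Riemann_sum_cons (linear_plus _ ll) (linear_scal _ ll) IH.
apply: filterlim_ext (filterlim_comp _ _ _ _ l _ _ _ fI (linear_cont l I ll)) => s.
by rewrite /= (linear_scal _ ll) lsum.
Qed.

(** The value on the complex number c of the real linear map h from the plane
    to X with h(1) = h.1 and h(i) = h.2.  For h = (F G, F J G) it is F c G,
    where c = c.1 + J c.2 stands between two factors which do not commute with
    J; this replaces the complexification of X. *)
Definition pairing (X : NormedModule R_AbsRing) (h : X * X) (c : C) : X :=
  plus (scal c.1 h.1) (scal c.2 h.2).

(** Multiplication by i on the argument: pairing (rot h) c = pairing h (i c) *)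
Definition rot (X : NormedModule R_AbsRing) (h : X * X) : X * X := (h.2, opp h.1).

Lemma pairing_rot (X : NormedModule R_AbsRing) (h : X * X) c :
  pairing (rot h) c = pairing h (Ci * c)%C.
Proof. by rewrite /pairing /rot /=; lin_eq. Qed.

Lemma norm_C_R (c : C) : norm (c : C_R_NormedModule) = Cmod c.
Proof.
by rewrite /Cmod -(pow2_abs c.1) -(pow2_abs c.2).
Qed.

Lemma norm_pair_le (X : NormedModule R_AbsRing) (h : X * X) :
  norm h.1 <= norm h /\ norm h.2 <= norm h.
Proof.
case: h => u v; have [h _] := norm_prod u v; rewrite /=.
by split; apply: Rle_trans h; [exact: Rmax_l|exact: Rmax_r].
Qed.

Lemma norm_pairing_le (X : NormedModule R_AbsRing) (h : X * X) c :
  norm (pairing h c) <= 2 * norm h * Cmod c.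
Proof.
have [h1 h2] := norm_pair_le h; have c0 := Rmax_Cmod c.
have c1 := Rle_trans _ _ _ (Rmax_l _ _) c0; have c2 := Rle_trans _ _ _ (Rmax_r _ _) c0.
apply: Rle_trans (norm_triangle _ _) _.
apply: Rle_trans (Rplus_le_compat _ _ _ _ (norm_scal_le _ _) (norm_scal_le _ _)) _.
have := Rmult_le_compat _ _ _ _ (Rabs_pos c.1) (norm_ge_0 h.1) c1 h1.
have := Rmult_le_compat _ _ _ _ (Rabs_pos c.2) (norm_ge_0 h.2) c2 h2.
lra.
Qed.

Lemma bilinear_pairing (X : NormedModule R_AbsRing) :
  bilinear (@pairing X : _ -> C_R_NormedModule -> X).
Proof.
split; rewrite /pairing.
- by move=> [x1 x2] [y1 y2] [c1 c2] /=; lin_eq.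
- by move=> [x1 x2] [y1 y2] [c1 c2] /=; lin_eq.
- by move=> k [x1 x2] [c1 c2] /=; lin_eq.
- by move=> k [x1 x2] [c1 c2] /=; lin_eq.
- by exists 2; [lra|move=> h c; rewrite norm_C_R; exact: norm_pairing_le].
Qed.

Ltac complex_ring :=
  apply: injective_projections;
  rewrite /= ?/minus ?/plus ?/opp ?/scal /= ?/mult /= ?/zero ?/one /=;
  lazymatch goal with |- @eq _ ?a ?b => change (@eq R a b); ring end.

Lemma bilinear_Cmult :
  bilinear (Cmult : C_R_NormedModule -> C_R_NormedModule -> C_R_NormedModule).
Proof.
split.
- by move=> [x1 x2] [y1 y2] [c1 c2]; complex_ring.
- by move=> [x1 x2] [y1 y2] [c1 c2]; complex_ring.
- by move=> k [x1 x2] [c1 c2]; complex_ring.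
- by move=> k [x1 x2] [c1 c2]; complex_ring.
- exists 1; first lra.
  by move=> x y; rewrite !norm_C_R Cmod_mult Rmult_1_l; exact: Rle_refl.
Qed.

(** Complex differentiability: the Cauchy-Riemann equation h_v = rot h_u *)
Definition holo (X : NormedModule R_AbsRing) (h : C -> X * X) (p : C) :=
  exists d, has_diff h p d (rot d).

(** The same for complex functions, seen as functions into a real space *)
Definition holoC (k : C -> C) (p : C) :=
  exists d : C, has_diff (k : C -> C_R_NormedModule) p d (Ci * d)%C.

Lemma holo_continuous (X : NormedModule R_AbsRing) (h : C -> X * X) p :
  holo h p -> continuous h p.
Proof. by case=> d; exact: has_diff_continuous. Qed.

Section RectInt.

Variable X : CompleteNormedModule R_AbsRing.
Implicit Types P Q : C -> X.

(** The integral of the form P dx + Q dy along the boundary of the rectangle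
    [x1, x2] x [y1, y2] *)
Definition rect_int P Q x1 x2 y1 y2 : X :=
  plus (minus (RInt (fun x => P (x, y1)) x1 x2) (RInt (fun x => P (x, y2)) x1 x2))
       (minus (RInt (fun y => Q (x2, y)) y1 y2) (RInt (fun y => Q (x1, y)) y1 y2)).

Lemma ex_RInt_row P x1 x2 y : x1 <= x2 ->
  (forall x, x1 <= x <= x2 -> continuous P (x, y)) ->
  ex_RInt (fun x => P (x, y)) x1 x2.
Proof.
by move=> le cP; apply: ex_RInt_continuous_le => // x /cP; exact: continuous_row.
Qed.

Lemma ex_RInt_col P x y1 y2 : y1 <= y2 ->
  (forall y, y1 <= y <= y2 -> continuous P (x, y)) ->
  ex_RInt (fun y => P (x, y)) y1 y2.
Proof.
by move=> le cP; apply: ex_RInt_continuous_le => // y /cP; exact: continuous_col.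
Qed.

Lemma rect_int_splitx P Q x1 x x2 y1 y2 : x1 <= x <= x2 ->
  (forall t, x1 <= t <= x2 -> continuous P (t, y1)) ->
  (forall t, x1 <= t <= x2 -> continuous P (t, y2)) ->
  rect_int P Q x1 x2 y1 y2 = plus (rect_int P Q x1 x y1 y2) (rect_int P Q x x2 y1 y2).
Proof.
move=> hx c1 c2; rewrite /rect_int.
rewrite -(RInt_Chasles (fun t => P (t, y1)) x1 x x2); first last.
- by apply: ex_RInt_row => [|t ht]; [|apply: c1]; lra.
- by apply: ex_RInt_row => [|t ht]; [|apply: c1]; lra.
rewrite -(RInt_Chasles (fun t => P (t, y2)) x1 x x2); first last.
- by apply: ex_RInt_row => [|t ht]; [|apply: c2]; lra.
- by apply: ex_RInt_row => [|t ht]; [|apply: c2]; lra.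
by lin_eq.
Qed.

Lemma rect_int_splity P Q x1 x2 y1 y y2 : y1 <= y <= y2 ->
  (forall t, y1 <= t <= y2 -> continuous Q (x1, t)) ->
  (forall t, y1 <= t <= y2 -> continuous Q (x2, t)) ->
  rect_int P Q x1 x2 y1 y2 = plus (rect_int P Q x1 x2 y1 y) (rect_int P Q x1 x2 y y2).
Proof.
move=> hx c1 c2; rewrite /rect_int.
rewrite -(RInt_Chasles (fun t => Q (x1, t)) y1 y y2); first last.
- by apply: ex_RInt_col => [|t ht]; [|apply: c1]; lra.
- by apply: ex_RInt_col => [|t ht]; [|apply: c1]; lra.
rewrite -(RInt_Chasles (fun t => Q (x2, t)) y1 y y2); first last.
- by apply: ex_RInt_col => [|t ht]; [|apply: c2]; lra.
- by apply: ex_RInt_col => [|t ht]; [|apply: c2]; lra.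
by lin_eq.
Qed.

(** Goursat: continuity of the partial derivatives is not assumed.  Near p the
    linear parts of P and Q contribute P_v and Q_u times the area, with
    opposite signs. *)
Lemma rect_int_closed_form P Q a b c d : a <= b -> c <= d ->
  (forall x y, a <= x <= b -> c <= y <= d -> exists Pu e Qv,
     has_diff P (x, y) Pu e /\ has_diff Q (x, y) e Qv) ->
  rect_int P Q a b c d = zero.
Proof.
move=> ab cd dPQ.
have cP x y : a <= x <= b -> c <= y <= d -> continuous P (x, y).
  by move=> hx hy; have [? [? [? [h _]]]] := dPQ x y hx hy; exact: has_diff_continuous h.
have cQ x y : a <= x <= b -> c <= y <= d -> continuous Q (x, y).
  by move=> hx hy; have [? [? [? [_ h]]]] := dPQ x y hx hy; exact: has_diff_continuous h.
apply: (additive_on_rect_eq0 (m := rect_int P Q)) => //.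
- move=> x1 x2 y1 y2 h1 h2 h3 h4 h5 h6 x y.
  have [hx1 hx2] : x1 <= x /\ x <= x2 by rewrite /x; lra.
  have [hy1 hy2] : y1 <= y /\ y <= y2 by rewrite /y; lra.
  rewrite (@rect_int_splity _ _ x1 x2 y1 y y2) //; try by (move=> t ht; apply: cQ; lra).
  rewrite (@rect_int_splitx _ _ x1 x x2 y1 y) //; try by (move=> t ht; apply: cP; lra).
  by rewrite (@rect_int_splitx _ _ x1 x x2 y y2) //; try by (move=> t ht; apply: cP; lra).
- move=> p q eps hp hq e0.
  have [Pu [e [Qv [dP dQ]]]] := dPQ p q hp hq.
  have e2 : 0 < eps / 2 by lra.
  have [delta d0 hd] := locally_box (filter_and _ _ (dP _ e2) (dQ _ e2)).
  exists delta => // x1 x2 y1 y2 ax1 px bx2 cy1 qy dy2 dx dy.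
  have le1 : x1 <= x2 by lra.
  have le2 : y1 <= y2 by lra.
  set s := x2 - x1 + (y2 - y1).
  have near x y : x1 <= x <= x2 -> y1 <= y <= y2 ->
      norm (minus (minus (P (x, y)) (P (p, q))) (plus (scal (x - p) Pu) (scal (y - q) e)))
        <= eps / 2 * s /\
      norm (minus (minus (Q (x, y)) (Q (p, q))) (plus (scal (x - p) e) (scal (y - q) Qv)))
        <= eps / 2 * s.
    move=> hx hy; have [||/= h1 h2] := hd x y; try by apply: Rabs_def1; lra.
    have rs : Rabs (x - p) + Rabs (y - q) <= s.
      by rewrite /s; apply: Rplus_le_compat; apply: Rabs_le; lra.
    have rs' := Rmult_le_compat_l _ _ _ (Rlt_le _ _ e2) rs.
    by split; [exact: Rle_trans h1 rs'|exact: Rle_trans h2 rs'].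
  have hP : norm (minus (minus (RInt (fun x => P (x, y1)) x1 x2)
                               (RInt (fun x => P (x, y2)) x1 x2))
                        (scal (x2 - x1) (scal (y1 - y2) e))) <= (x2 - x1) * (eps * s).
    have i1 : ex_RInt (fun x => P (x, y1)) x1 x2.
      by apply: ex_RInt_row => // t ht; apply: cP; lra.
    have i2 : ex_RInt (fun x => P (x, y2)) x1 x2.
      by apply: ex_RInt_row => // t ht; apply: cP; lra.
    rewrite -RInt_minus //; apply: RInt_near_const => // [|x hx]; first exact: ex_RInt_minus.
    have [|n1 _] := near x y1 hx _; first lra.
    have [|n2 _] := near x y2 hx _; first lra.
    have -> : eps * s = eps / 2 * s + eps / 2 * s by field.
    apply: Rle_trans (norm_minus_le n1 n2); apply: Req_le; congr norm.
    by lin_eq.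
  have hQ : norm (minus (minus (RInt (fun y => Q (x2, y)) y1 y2)
                               (RInt (fun y => Q (x1, y)) y1 y2))
                        (scal (y2 - y1) (scal (x2 - x1) e))) <= (y2 - y1) * (eps * s).
    have i1 : ex_RInt (fun y => Q (x1, y)) y1 y2.
      by apply: ex_RInt_col => // t ht; apply: cQ; lra.
    have i2 : ex_RInt (fun y => Q (x2, y)) y1 y2.
      by apply: ex_RInt_col => // t ht; apply: cQ; lra.
    rewrite -RInt_minus //; apply: RInt_near_const => // [|y hy]; first exact: ex_RInt_minus.
    have [|_ n1] := near x1 y _ hy; first lra.
    have [|_ n2] := near x2 y _ hy; first lra.
    have -> : eps * s = eps / 2 * s + eps / 2 * s by field.
    apply: Rle_trans (norm_minus_le n2 n1); apply: Req_le; congr norm.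
    by lin_eq.
  have -> : rect_int P Q x1 x2 y1 y2 = plus
     (minus (minus (RInt (fun x => P (x, y1)) x1 x2) (RInt (fun x => P (x, y2)) x1 x2))
            (scal (x2 - x1) (scal (y1 - y2) e)))
     (minus (minus (RInt (fun y => Q (x2, y)) y1 y2) (RInt (fun y => Q (x1, y)) y1 y2))
            (scal (y2 - y1) (scal (x2 - x1) e))).
    by rewrite /rect_int; lin_eq.
  by apply: Rle_trans (norm_plus_le hP hQ) _; rewrite -/s /s; apply: Req_le; ring.
Qed.

End RectInt.
(** * Cauchy's integral formula on rectangles *)

Lemma locally_neq (p z : C) : p <> z -> locally p (fun w : C => w <> z).
Proof.
move=> npz; have pos : 0 < Rabs (z.1 - p.1) + Rabs (z.2 - p.2).
  have := Rabs_pos (z.1 - p.1); have := Rabs_pos (z.2 - p.2).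
  case: (Req_dec (z.1 - p.1) 0) => [e1|n1]; last by have := Rabs_pos_lt _ n1; lra.
  case: (Req_dec (z.2 - p.2) 0) => [e2|n2]; last by have := Rabs_pos_lt _ n2; lra.
  by case: npz; apply: injective_projections; lra.
apply: filter_imp (locally_near p pos) => w h wz.
by move: h; rewrite wz; lra.
Qed.

Lemma Cminus_neq0 (w z : C) : w <> z -> (w - z)%C <> RtoC 0.
Proof.
move=> nwz e; apply: nwz; apply: injective_projections.
  by move: (f_equal fst e) => /=; lra.
by move: (f_equal snd e) => /=; lra.
Qed.

Lemma holoC_kernel c z p : p <> z -> holoC (fun w => c / (w - z))%C p.
Proof.
move=> npz; pose y w : C_R_NormedModule := (/ (w - z))%C.
pose q w : C_R_NormedModule := (w - z)%C.
have dq : has_diff q p (RtoC 1 : C_R_NormedModule) (Ci : C_R_NormedModule).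
  move=> eps e0; apply: filter_forall => w.
  have -> : minus (minus (q w) (q p))
     (plus (scal (w.1 - p.1) (RtoC 1 : C_R_NormedModule))
           (scal (w.2 - p.2) (Ci : C_R_NormedModule))) = zero.
    by rewrite /q; complex_ring.
  rewrite norm_zero; apply: Rmult_le_pos; first lra.
  by apply: Rplus_le_le_0_compat; exact: Rabs_pos.
have dy := has_diff_inverse (y := y) bilinear_Cmult dq.
have {}dy := has_diff_linear (is_linear_bilinear_l (c : C_R_NormedModule) bilinear_Cmult) (dy _).
exists (opp (y p * RtoC 1 * y p) * c)%C.
apply: has_diff_ext (has_diff_eq (dy _) _ _).
- by apply: filter_forall => w; rewrite /y /Cdiv Cmult_comm.
- apply: filter_imp (locally_neq npz) => w nwz; rewrite /y /q.
  have := Cminus_neq0 nwz; have := Cminus_neq0 npz.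
  rewrite -[minus _ _]/(_ - _)%C -[minus _ _]/(_ - _)%C -[opp _]/(- _)%C => h1 h2.
  by lazymatch goal with |- @eq _ ?a ?b => change (@eq C a b) end; field.
- by [].
- by complex_ring.
Qed.

Lemma eq_minus_r (G : AbelianGroup) (x y : G) : minus x y = zero -> x = y.
Proof. by move=> e; apply: (plus_reg_r (opp y)); rewrite plus_opp_r. Qed.

Section CauchyFormula.

Variables (X : CompleteNormedModule R_AbsRing) (h : C -> X * X).

Lemma has_diff_pairing (k : C -> C) p d (e : C) :
  has_diff h p d (rot d) -> has_diff (k : C -> C_R_NormedModule) p e (Ci * e)%C ->
  has_diff (fun w => pairing (h w) (k w)) p
    (plus (pairing d (k p)) (pairing (h p) e))
    (plus (pairing d (Ci * k p)%C) (pairing (h p) (Ci * e)%C)).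
Proof.
move=> dh dk.
apply: (has_diff_eq (has_diff_bilinear (bilinear_pairing X) dh dk)) => //.
by rewrite pairing_rot.
Qed.

(** The form h(w) [k(w) dw] is closed: both of its mixed derivatives are
    d [i k] + h [i k'], if d and k' are the complex derivatives. *)
Lemma rect_int_holo (k : C -> C) a b c d : a <= b -> c <= d ->
  (forall x y, a <= x <= b -> c <= y <= d -> holo h (x, y) /\ holoC k (x, y)) ->
  rect_int (fun w => pairing (h w) (k w)) (fun w => pairing (h w) (Ci * k w)%C)
    a b c d = zero.
Proof.
move=> ab cd hk; apply: rect_int_closed_form => // x y hx hy.
have [[d1 dh] [e dk]] := hk x y hx hy.
have dik : has_diff ((fun w => Ci * k w)%C : C -> C_R_NormedModule) (x, y)
    (Ci * e)%C (Ci * (Ci * e))%C.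
  apply: (has_diff_eq (has_diff_bilinear bilinear_Cmult
            (has_diff_const (Ci : C_R_NormedModule) (x, y)) dk));
  by complex_ring.
exists (plus (pairing d1 (k (x, y))) (pairing (h (x, y)) e)).
exists (plus (pairing d1 (Ci * k (x, y))%C) (pairing (h (x, y)) (Ci * e)%C)).
exists (plus (pairing d1 (Ci * (Ci * k (x, y)))%C) (pairing (h (x, y)) (Ci * (Ci * e))%C)).
by split; [exact: has_diff_pairing|exact: has_diff_pairing].
Qed.

(** The form h(w) [c dw / (w - z)] *)
Definition cauchyP (z c w : C) : X := pairing (h w) (c / (w - z))%C.
Definition cauchyQ (z c w : C) : X := pairing (h w) (Ci * (c / (w - z)))%C.

Lemma continuous_pairing (k : C -> C) p : holo h p -> holoC k p ->
  continuous (fun w => pairing (h w) (k w)) p.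
Proof.
move=> [d dh] [e dk]; exact: has_diff_continuous (has_diff_pairing dh dk).
Qed.

Lemma holoC_mulCi (k : C -> C) p : holoC k p -> holoC (fun w => Ci * k w)%C p.
Proof.
move=> [e dk]; exists (Ci * e)%C.
apply: (has_diff_eq (has_diff_bilinear bilinear_Cmult
          (has_diff_const (Ci : C_R_NormedModule) p) dk));
by complex_ring.
Qed.

Lemma cauchyP_continuous z c p : holo h p -> p <> z -> continuous (cauchyP z c) p.
Proof. by move=> hp npz; apply: continuous_pairing => //; exact: holoC_kernel. Qed.

Lemma cauchyQ_continuous z c p : holo h p -> p <> z -> continuous (cauchyQ z c) p.
Proof.
by move=> hp npz; apply: continuous_pairing => //; apply: holoC_mulCi; exact: holoC_kernel.
Qed.

Lemma cauchy_rect_outside z c x1 x2 y1 y2 : x1 <= x2 -> y1 <= y2 ->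
  (forall x y, x1 <= x <= x2 -> y1 <= y <= y2 -> holo h (x, y) /\ (x, y) <> z) ->
  rect_int (cauchyP z c) (cauchyQ z c) x1 x2 y1 y2 = zero.
Proof.
move=> hx hy hol; apply: rect_int_holo => // x y rx ry.
by have [? ?] := hol x y rx ry; split=> //; exact: holoC_kernel.
Qed.

Lemma RInt_arctan eps a (v : X) : 0 < eps ->
  is_RInt (fun x => scal (2 * eps / ((x - a) ^ 2 + eps ^ 2)) v)
    (a - eps) (a + eps) (scal PI v).
Proof.
move=> e0.
apply: (is_RInt_linear (l := fun r : R => scal r v)).
  by apply: is_linear_scal_l.
have pos x : 0 < (x - a) ^ 2 + eps ^ 2.
  by have := pow2_ge_0 (x - a); have := pow_lt eps 2 e0; lra.
pose F x := 2 * atan ((x - a) / eps).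
have -> : PI = minus (F (a + eps)) (F (a - eps)).
  have e1 : (a + eps - a) / eps = 1 by field; lra.
  have e2 : (a - eps - a) / eps = Ropp 1 by field; lra.
  by rewrite /F e1 e2 atan_opp atan_1 /minus /plus /opp /=; field.
apply: is_RInt_derive => x _; have := pos x => px.
  rewrite /F; auto_derive => //.
  have -> : 1 + (x + - a) * / eps * ((x + - a) * / eps * 1)
    = ((x - a) ^ 2 + eps ^ 2) / eps ^ 2 by field; lra.
  by field; lra.
apply: (ex_derive_continuous (V := R_NormedModule)); auto_derive; lra.
Qed.

(** Two opposite sides of the square of half-side eps about z.  The kernels on
    the two sides differ by a real multiple of e = i c with integral pi e; so
    no logarithm is needed.  Replacing h by h(z) costs the last bound. *)
Lemma opposite_sides eps a (z e : C) delta m (w1 w2 k1 k2 : R -> C) :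
  0 < eps ->
  (forall t, a - eps <= t <= a + eps ->
     [/\ (k1 t - k2 t = RtoC (2 * eps / ((t - a) ^ 2 + eps ^ 2)) * e)%C,
         Cmod (k1 t) <= m /\ Cmod (k2 t) <= m,
         norm (minus (h (w1 t)) (h z)) <= delta
       & norm (minus (h (w2 t)) (h z)) <= delta]) ->
  ex_RInt (fun t => pairing (h (w1 t)) (k1 t)) (a - eps) (a + eps) ->
  ex_RInt (fun t => pairing (h (w2 t)) (k2 t)) (a - eps) (a + eps) ->
  norm (minus (minus (RInt (fun t => pairing (h (w1 t)) (k1 t)) (a - eps) (a + eps))
                     (RInt (fun t => pairing (h (w2 t)) (k2 t)) (a - eps) (a + eps)))
              (scal PI (pairing (h z) e))) <= 8 * delta * m * eps.
Proof.
move=> e0 hk i1 i2.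
have hpi := @RInt_arctan eps a (pairing (h z) e) e0.
rewrite -(is_RInt_unique _ _ _ _ hpi) -RInt_minus // -RInt_minus //; first last.
- by eexists; exact: hpi.
- exact: ex_RInt_minus.
apply: Rle_trans (norm_RInt_le_const' (M := 4 * delta * m) _ _ _) _; first lra.
- by apply: ex_RInt_minus; [exact: ex_RInt_minus|eexists; exact: hpi].
- move=> t ht; have [ek [m1 m2] d1 d2] := hk t ht.
  have -> : scal (2 * eps / ((t - a) ^ 2 + eps ^ 2)) (pairing (h z) e)
      = minus (pairing (h z) (k1 t)) (pairing (h z) (k2 t)).
    have [_ BDr _ _ _] := bilinear_pairing X.
    have [_ BNr] := bilinearN (bilinear_pairing X).
    rewrite /minus -BNr -BDr -[plus _ _]/(k1 t - k2 t)%C ek /pairing /=.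
    by lin_eq.
  have -> : minus (minus (pairing (h (w1 t)) (k1 t)) (pairing (h (w2 t)) (k2 t)))
                  (minus (pairing (h z) (k1 t)) (pairing (h z) (k2 t)))
    = minus (pairing (minus (h (w1 t)) (h z)) (k1 t))
            (pairing (minus (h (w2 t)) (h z)) (k2 t)).
    by rewrite /pairing /=; lin_eq.
  apply: Rle_trans (norm_triangle _ _) _; rewrite norm_opp.
  apply: Rle_trans (Rplus_le_compat _ _ _ _ (norm_pairing_le _ _) (norm_pairing_le _ _)) _.
  have := Rmult_le_compat _ _ _ _ (norm_ge_0 _) (Cmod_ge_0 _) d1 m1.
  have := Rmult_le_compat _ _ _ _ (norm_ge_0 _) (Cmod_ge_0 _) d2 m2.
  lra.
- by apply: Req_le; ring.
Qed.

(** The strips cut off around the square do not contain z. *)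
Lemma cauchy_rect_shrink a b c eps x1 x2 y1 y2 : let z : C := (a, b) in
  0 < eps -> x1 < a - eps -> a + eps < x2 -> y1 < b - eps -> b + eps < y2 ->
  (forall x y, x1 <= x <= x2 -> y1 <= y <= y2 -> holo h (x, y)) ->
  rect_int (cauchyP z c) (cauchyQ z c) x1 x2 y1 y2
  = rect_int (cauchyP z c) (cauchyQ z c) (a - eps) (a + eps) (b - eps) (b + eps).
Proof.
move=> z e0 h1 h2 h3 h4 hol.
have nz x y : (x <> a \/ y <> b) -> (x, y) <> z by move=> n [ex ey]; case: n.
have cP x y : x1 <= x <= x2 -> y1 <= y <= y2 -> (x <> a \/ y <> b) ->
    continuous (cauchyP z c) (x, y).
  by move=> hx hy /nz n; apply: cauchyP_continuous => //; exact: hol.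
have cQ x y : x1 <= x <= x2 -> y1 <= y <= y2 -> (x <> a \/ y <> b) ->
    continuous (cauchyQ z c) (x, y).
  by move=> hx hy /nz n; apply: cauchyQ_continuous => //; exact: hol.
have out u1 u2 v1 v2 : x1 <= u1 -> u1 <= u2 -> u2 <= x2 ->
    y1 <= v1 -> v1 <= v2 -> v2 <= y2 -> (u2 < a \/ a < u1 \/ v2 < b \/ b < v1) ->
    rect_int (cauchyP z c) (cauchyQ z c) u1 u2 v1 v2 = zero.
  move=> ? ? ? ? ? ? away; apply: cauchy_rect_outside => // x y rx ry.
  by split; [apply: hol; lra|case=> ex ey; lra].
rewrite (@rect_int_splitx _ _ _ x1 (a - eps) x2); try (by move=> t ht; apply: cP; lra); last lra.
rewrite (@rect_int_splitx _ _ _ (a - eps) (a + eps) x2); try (by move=> t ht; apply: cP; lra); last lra.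
rewrite (@rect_int_splity _ _ _ (a - eps) (a + eps) y1 (b - eps) y2); try (by move=> t ht; apply: cQ; lra); last lra.
rewrite (@rect_int_splity _ _ _ (a - eps) (a + eps) (b - eps) (b + eps) y2); try (by move=> t ht; apply: cQ; lra); last lra.
rewrite (out x1 (a - eps)); try lra; rewrite (out (a + eps) x2); try lra.
rewrite (out _ _ y1); try lra; rewrite (out _ _ (b + eps)); try lra.
by lin_eq.
Qed.

Lemma cauchy_rect z c x1 x2 y1 y2 :
  x1 < z.1 < x2 -> y1 < z.2 < y2 ->
  (forall x y, x1 <= x <= x2 -> y1 <= y <= y2 -> holo h (x, y)) ->
  rect_int (cauchyP z c) (cauchyQ z c) x1 x2 y1 y2
  = scal (2 * PI) (pairing (h z) (Ci * c)%C).
Proof.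
case: z => a b /= ha hb hol; pose z : C := (a, b); set v := pairing _ _.
apply: eq_minus_r; apply: vec_eq0_of_small => eta eta0.
have mc0 := Cmod_ge_0 c.
have delta0 : 0 < eta / (16 * (1 + Cmod c)) by apply: Rdiv_lt_0_compat; lra.
set delta := _ / _ in delta0.
have ch : continuous h z by apply: holo_continuous; apply: hol; lra.
have [r r0 hr] := locally_box (continuous_norm ch delta0).
have [|eps [e0 [er [s1 [s2 [s3 [s4 _]]]]]]] :=
    @pos_below [:: r; a - x1; x2 - a; b - y1; y2 - b].
  by repeat split; lra.
rewrite (cauchy_rect_shrink c e0 _ _ _ _ hol); try lra.
have near x y : a - eps <= x <= a + eps -> b - eps <= y <= b + eps ->
    norm (minus (h (x, y)) (h z)) <= delta.
  by move=> hx hy; left; apply: (hr x y); apply: Rabs_def1; lra.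
have Pi t : (t = b - eps \/ t = b + eps) ->
    ex_RInt (fun x => cauchyP z c (x, t)) (a - eps) (a + eps).
  move=> ht; apply: ex_RInt_row => [|x hx]; first lra.
  by apply: cauchyP_continuous; [apply: hol; case: ht; lra|case=> _; case: ht; lra].
have Qi t : (t = a - eps \/ t = a + eps) ->
    ex_RInt (fun y => cauchyQ z c (t, y)) (b - eps) (b + eps).
  move=> ht; apply: ex_RInt_col => [|y hy]; first lra.
  by apply: cauchyQ_continuous; [apply: hol; case: ht; lra|case=> + _; case: ht; lra].
have kernel_le u w : eps <= Rabs u \/ eps <= Rabs w ->
    Cmod (Cdiv c (u, w)) <= Cmod c / eps.
  move=> huw; have le : eps <= Cmod (u, w).
    apply: Rle_trans (Rmax_Cmod _).
    by case: huw => le; apply: Rle_trans le _; [exact: Rmax_l|exact: Rmax_r].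
  rewrite Cmod_div; last by move=> e; move: le; rewrite e Cmod_0; lra.
  by apply: Rmult_le_compat_l => //; apply: Rinv_le_contravar.
have CmodCi u : Cmod (Ci * u)%C = Cmod u.
  rewrite Cmod_mult; have -> : Cmod Ci = 1; last by rewrite Rmult_1_l.
  by rewrite /Cmod; have -> : Ci.1 ^ 2 + Ci.2 ^ 2 = 1 by [rewrite /=; ring]; exact: sqrt_1.
have absm : Rabs (- eps) = eps by rewrite Rabs_Ropp Rabs_pos_eq; lra.
have absp : Rabs eps = eps by rewrite Rabs_pos_eq; lra.
have sq t u : 0 < (t - u) ^ 2 + eps ^ 2.
  by have := pow2_ge_0 (t - u); have := pow_lt eps 2 e0; lra.
have hor : norm (minus (minus (RInt (fun x => cauchyP z c (x, b - eps)) (a - eps) (a + eps))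
                     (RInt (fun x => cauchyP z c (x, b + eps)) (a - eps) (a + eps)))
              (scal PI v)) <= 8 * delta * (Cmod c / eps) * eps.
  apply: opposite_sides => //; try by apply: Pi; auto.
  move=> t ht; have st := sq t a.
  have e1 : Cminus (t, b - eps) z = (t - a, - eps).
    by rewrite /z /Cminus /Cplus /=; congr pair; ring.
  have e2 : Cminus (t, b + eps) z = (t - a, eps).
    by rewrite /z /Cminus /Cplus /=; congr pair; ring.
  rewrite e1 e2; split.
  - apply: injective_projections; rewrite /=; field; nra.
  - by split; apply: kernel_le; right; lra.
  - by apply: near; lra.
  - by apply: near; lra.
have ver : norm (minus (minus (RInt (fun y => cauchyQ z c (a + eps, y)) (b - eps) (b + eps))
                     (RInt (fun y => cauchyQ z c (a - eps, y)) (b - eps) (b + eps)))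
              (scal PI v)) <= 8 * delta * (Cmod c / eps) * eps.
  apply: opposite_sides => //; try by apply: Qi; auto.
  move=> t ht; have st := sq t b.
  have e1 : Cminus (a - eps, t) z = (- eps, t - b).
    by rewrite /z /Cminus /Cplus /=; congr pair; ring.
  have e2 : Cminus (a + eps, t) z = (eps, t - b).
    by rewrite /z /Cminus /Cplus /=; congr pair; ring.
  rewrite e1 e2 !CmodCi; split.
  - apply: injective_projections; rewrite /=; field; nra.
  - by split; apply: kernel_le; left; lra.
  - by apply: near; lra.
  - by apply: near; lra.
rewrite /rect_int.
set A := minus (RInt _ _ _) _ in hor *; set B := minus (RInt _ _ _) _ in ver *.
have -> : minus (plus A B) (scal (2 * PI) v)
  = plus (minus A (scal PI v)) (minus B (scal PI v)) by lin_eq.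
apply: Rle_trans (norm_triangle _ _) _.
apply: Rle_trans (Rplus_le_compat _ _ _ _ hor ver) _.
have -> : 8 * delta * (Cmod c / eps) * eps + 8 * delta * (Cmod c / eps) * eps
  = eta * (Cmod c / (1 + Cmod c)) by rewrite /delta; field; lra.
rewrite -[X in _ <= X]Rmult_1_r; apply: Rmult_le_compat_l; first lra.
by apply: (Rmult_le_reg_r (1 + Cmod c)); [lra|field_simplify; lra].
Qed.

End CauchyFormula.
(** * The homological form of Cauchy's theorem *)

Lemma continuous_Cdiv (U : UniformSpace) (f g : U -> C) u :
  continuous f u -> continuous g u -> g u <> RtoC 0 ->
  continuous (fun v => (f v / g v)%C) u.
Proof.
move=> cf cg nz.
have cinv : continuous (fun v => (/ g v)%C) u.
  apply: (continuous_comp g (fun w => (/ w)%C)) => //.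
  have [d dk] := @holoC_kernel (RtoC 1) (RtoC 0) _ nz.
  apply: continuous_ext (has_diff_continuous dk) => w.
  by rewrite /Cdiv Cmult_1_l; congr Cinv; rewrite /Cminus; complex_ring.
exact: (continuous_bilinear bilinear_Cmult cf cinv).
Qed.

Lemma continuous_Cminus (U : UniformSpace) (f g : U -> C) u :
  continuous f u -> continuous g u -> continuous (fun v => (f v - g v)%C) u.
Proof. exact: (continuous_minus (V := C_R_NormedModule)). Qed.

Lemma ex_RInt_scal' (X : NormedModule R_AbsRing) (f : R -> X) a b k :
  ex_RInt f a b -> ex_RInt (fun t => scal k (f t)) a b.
Proof. by case=> l fl; exists (scal k l); exact: is_RInt_scal. Qed.

(** A parametrized arc.  The density vel plays the role of the derivative of
    pos, but no relation between the two is assumed: the theorem below only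
    depends on the integrals of vel / (pos - w).  So an arc can be traversed
    backwards by changing the sign of vel. *)
Record arc := Arc { lo : R; hi : R; pos : R -> C; vel : R -> C }.

Definition continuous_arc (A : arc) := lo A <= hi A /\
  forall t, lo A <= t <= hi A -> continuous (pos A) t /\ continuous (vel A) t.

Lemma ex_RInt_winding A w : continuous_arc A ->
  (forall t, lo A <= t <= hi A -> pos A t <> w) ->
  ex_RInt (V := C_R_CompleteNormedModule)
    (fun t => vel A t / (pos A t - w))%C (lo A) (hi A).
Proof.
move=> [le cA] neq; apply: ex_RInt_continuous_le => // t ht; have [cp cv] := cA t ht.
apply: continuous_Cdiv => //; last by apply: Cminus_neq0; exact: neq.
by apply: continuous_Cminus => //; exact: continuous_const.
Qed.

Definition chain_int (X : CompleteNormedModule R_AbsRing) (L : seq arc)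
    (Phi : C -> C -> X) : X :=
  \big[plus/zero]_(A <- L) RInt (fun t => Phi (pos A t) (vel A t)) (lo A) (hi A).

(** 2 pi i times the winding number *)
Definition winding_int (L : seq arc) (w : C) : C :=
  chain_int (X := C_R_CompleteNormedModule) L (fun z c => c / (z - w))%C.

Section ChainInt.

Variables (X : CompleteNormedModule R_AbsRing) (L : seq arc).

Definition chain_integrable (Phi : C -> C -> X) :=
  forall A, List.In A L -> ex_RInt (fun t => Phi (pos A t) (vel A t)) (lo A) (hi A).

Lemma eq_big_In (f g : arc -> X) (K : seq arc) :
  (forall A, List.In A K -> f A = g A) ->
  \big[plus/zero]_(A <- K) f A = \big[plus/zero]_(A <- K) g A.
Proof.
elim: K => [|A K IH] fg; first by rewrite !big_nil.
by rewrite !big_cons fg /=; [rewrite IH // => B hB; apply: fg; right|left].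
Qed.

Lemma chain_int_plus Phi Psi : chain_integrable Phi -> chain_integrable Psi ->
  chain_int L (fun z c => plus (Phi z c) (Psi z c))
  = plus (chain_int L Phi) (chain_int L Psi).
Proof.
move=> iPhi iPsi; rewrite /chain_int -big_split /=; apply: eq_big_In => A hA.
by rewrite RInt_plus //; [exact: iPhi|exact: iPsi].
Qed.

Lemma chain_int_scal k Phi : chain_integrable Phi ->
  chain_int L (fun z c => scal k (Phi z c)) = scal k (chain_int L Phi).
Proof.
move=> iPhi; rewrite /chain_int (big_morph _ (@scal_distr_l _ _ k) (@scal_zero_r _ _ k)).
by apply: eq_big_In => A hA; rewrite RInt_scal //; exact: iPhi.
Qed.

Lemma eq_chain_int (E : C -> Prop) Phi Psi :
  (forall A, List.In A L -> continuous_arc A) ->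
  (forall A, List.In A L -> forall t, lo A <= t <= hi A -> E (pos A t)) ->
  (forall z c, E z -> Phi z c = Psi z c) -> chain_int L Phi = chain_int (X := X) L Psi.
Proof.
move=> cL LE e; apply: eq_big_In => A hA; have [le _] := cL A hA.
by apply: RInt_eq_le => // t ht; apply: e; exact: LE ht.
Qed.

End ChainInt.

Lemma RInt_big_In (X : CompleteNormedModule R_AbsRing) (K : seq arc)
    (f : arc -> R -> X) a b :
  (forall A, List.In A K -> ex_RInt (f A) a b) ->
  ex_RInt (fun t => \big[plus/zero]_(A <- K) f A t) a b /\
  RInt (fun t => \big[plus/zero]_(A <- K) f A t) a b
  = \big[plus/zero]_(A <- K) RInt (f A) a b.
Proof.
elim: K => [|A K IH] ef.
  have e0 (g : R -> X) : g =1 (fun _ => zero) -> ex_RInt g a b /\ RInt g a b = zero.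
    move=> g0; have i0 : is_RInt g a b zero.
      apply: (is_RInt_ext (fun _ => zero)) => [t _|]; first by rewrite g0.
      by have := is_RInt_const a b (zero : X); rewrite (scal_zero_r (K := R_Ring)).
    by split; [exists zero|exact: is_RInt_unique].
  by rewrite big_nil; apply: e0 => t; rewrite big_nil.
have [|eK iK] := IH; first by move=> B hB; apply: ef; right.
have eA : ex_RInt (f A) a b by apply: ef; left.
rewrite big_cons -iK -RInt_plus //; split.
  apply: ex_RInt_ext (ex_RInt_plus _ _ _ _ eA eK) => t _.
  by rewrite big_cons.
by apply: RInt_ext => t _; rewrite big_cons.
Qed.

Lemma Abel_sum (X : NormedModule R_AbsRing) (s : nat -> R) (a : nat -> X) n :
  \big[plus/zero]_(j < n) scal (s j) (minus (a j) (a j.+1))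
  = plus (minus (scal (s 0%N) (a 0%N)) (scal (s n) (a n)))
         (\big[plus/zero]_(j < n) scal (s j.+1 - s j) (a j.+1)).
Proof.
elim: n => [|n IH]; first by rewrite !big_ord0; lin_eq.
rewrite !big_ord_recr IH /=.
set S := \big[plus/zero]_(j < n) scal (s j.+1 - s j) (a j.+1).
by lin_eq.
Qed.

Section Homology.

Variables (X : CompleteNormedModule R_AbsRing) (h : C -> X * X).
Variables (E : C -> Prop) (L : seq arc).

Hypothesis E_closed : forall z, ~ E z -> locally z (fun w => ~ E w).
Hypothesis E_holo : forall z, E z -> locally z (holo h).
Hypothesis L_continuous : forall A, List.In A L -> continuous_arc A.
Hypothesis L_in_E : forall A, List.In A L -> forall t, lo A <= t <= hi A -> E (pos A t).
Hypothesis L_winding : forall w, ~ E w -> winding_int L w = RtoC 0.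

(** Phi z c is to be thought of as the value at z, in the direction c, of a
    form; continuity on E allows to pass to the limit in z. *)
Definition negligible (Phi : C -> C -> X) :=
  [/\ chain_integrable L Phi, chain_int L Phi = zero
    & forall z c, E z -> continuous (Phi^~ c) z].

Lemma negligible_plus Phi Psi : negligible Phi -> negligible Psi ->
  negligible (fun z c => plus (Phi z c) (Psi z c)).
Proof.
move=> [i1 e1 c1] [i2 e2 c2]; split.
- by move=> A hA; apply: ex_RInt_plus; [exact: i1|exact: i2].
- by rewrite chain_int_plus // e1 e2 plus_zero_l.
- by move=> z c Ez; apply: continuous_plus; [exact: c1|exact: c2].
Qed.

Lemma negligible_scal k Phi : negligible Phi -> negligible (fun z c => scal k (Phi z c)).
Proof.
move=> [i1 e1 c1]; split.
- by move=> A hA; apply: ex_RInt_scal'; exact: i1.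
- by rewrite chain_int_scal // e1 (scal_zero_r (K := R_Ring)).
- by move=> z c Ez; apply: continuous_scal_r; exact: c1.
Qed.

Lemma negligible0 : negligible (fun _ _ => zero).
Proof.
have i0 a b : is_RInt (fun _ => zero : X) a b zero.
  by have := is_RInt_const a b (zero : X); rewrite (scal_zero_r (K := R_Ring)).
split.
- by move=> A hA; exists zero.
- by rewrite /chain_int big1 // => A _; apply: is_RInt_unique.
- by move=> z c Ez; exact: continuous_const.
Qed.

Lemma negligible_ext Phi Psi : (forall z c, Phi z c = Psi z c) ->
  negligible Phi -> negligible Psi.
Proof.
move=> e; have -> // : Psi = Phi.
by apply: functional_extensionality => z; apply: functional_extensionality => c.
Qed.

Lemma negligible_sum (I : finType) (Phi : I -> C -> C -> X) :
  (forall i, negligible (Phi i)) ->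
  negligible (fun z c => \big[plus/zero]_(i : I) Phi i z c).
Proof.
move=> nPhi; have ind (s : seq I) : negligible (fun z c => \big[plus/zero]_(i <- s) Phi i z c).
  elim: s => [|i s IH].
    by apply: negligible_ext negligible0 => z c; rewrite big_nil.
  by apply: negligible_ext (negligible_plus (nPhi i) IH) => z c; rewrite big_cons.
exact: ind.
Qed.

(** Cauchy's kernel integrated over an arc outside E: the two integrations can
    be exchanged, and the inner one is then a winding number. *)
Lemma negligible_kernel (e : R -> C) (k : C) a b : a <= b ->
  (forall s, a <= s <= b -> [/\ continuous e s, ~ E (e s) & holo h (e s)]) ->
  negligible (fun z c => RInt (fun s => pairing (h (e s)) (k * (c / (e s - z)))%C) a b).
Proof.
move=> ab he.
have cont (U : UniformSpace) (f : U -> R) (p v : U -> C) u :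
    a <= f u <= b -> e (f u) <> p u ->
    continuous f u -> continuous p u -> continuous v u ->
    continuous (fun u => pairing (h (e (f u))) (k * (v u / (e (f u) - p u)))%C) u.
  move=> hf nep cf cp cv; have [ce nE hol] := he _ hf.
  have cef : continuous (fun u => e (f u)) u by apply: continuous_comp.
  apply: (continuous_bilinear (bilinear_pairing X)).
    by apply: (continuous_comp (fun u => e (f u)) h) => //; exact: holo_continuous.
  apply: (continuous_bilinear bilinear_Cmult (f := fun _ => k)).
    exact: continuous_const.
  by apply: continuous_Cdiv => //; [exact: continuous_Cminus|exact: Cminus_neq0].
have nez s z : a <= s <= b -> E z -> e s <> z.
  by move=> /he[_ nE _] Ez ez; apply: nE; rewrite ez.
have cphi A : List.In A L -> forall t s, lo A <= t <= hi A -> a <= s <= b ->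
    continuous (fun p : R * R =>
      pairing (h (e p.2)) (k * (vel A p.1 / (e p.2 - pos A p.1)))%C) (t, s).
  move=> hA t s ht hs; have [_ /(_ t ht) [cp cv]] := L_continuous hA.
  apply: (cont _ snd (fun p => pos A p.1) (fun p => vel A p.1)) => //.
  - by apply: nez => //; exact: L_in_E ht.
  - exact: continuous_snd.
  - by apply: continuous_comp => //; exact: continuous_fst.
  - by apply: continuous_comp => //; exact: continuous_fst.
have swap A (hA : List.In A L) := RInt_swap
  (phi := fun t s => pairing (h (e s)) (k * (vel A t / (e s - pos A t)))%C)
  (proj1 (L_continuous hA)) ab (cphi A hA).
split.
- by move=> A hA; case: (swap A hA).
- rewrite /chain_int.
  pose J A s := RInt (fun t => pairing (h (e s)) (k * (vel A t / (e s - pos A t)))%C) (lo A) (hi A).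
  rewrite (eq_big_In (g := fun A => RInt (J A) a b)); last first.
    by move=> A hA; case: (swap A hA).
  have [_ <-] := RInt_big_In (K := L) (f := J) (a := a) (b := b)
    (fun A hA => let: And3 _ i _ := swap A hA in i).
  rewrite (RInt_eq_le (g := fun _ => zero)) //.
    by rewrite RInt_const (scal_zero_r (K := R_Ring)).
  move=> s hs; have [ce nE hol] := he s hs.
  pose l (w : C_R_NormedModule) := pairing (h (e s)) (- k * w)%C.
  have ll : is_linear l.
    exact: (is_linear_comp _ _ (is_linear_bilinear_r ((- k)%C : C_R_NormedModule) bilinear_Cmult)
              (is_linear_bilinear_r (h (e s)) (bilinear_pairing X))).
  have JE A : List.In A L -> J A s = l (RInt (V := C_R_CompleteNormedModule)
      (fun t => vel A t / (pos A t - e s))%C (lo A) (hi A)).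
    move=> hA; have [le cA] := L_continuous hA.
    have neq t : lo A <= t <= hi A -> pos A t <> e s.
      by move=> ht; apply: not_eq_sym; apply: nez => //; exact: L_in_E ht.
    have ex := ex_RInt_winding (L_continuous hA) neq.
    rewrite -(is_RInt_unique _ _ _ _ (is_RInt_linear ll (RInt_correct _ _ _ ex))).
    apply: RInt_eq_le => // t ht; rewrite /l; congr pairing.
    have n1 := Cminus_neq0 (neq t ht).
    have n2 := Cminus_neq0 (not_eq_sym (neq t ht)).
    by field.
  rewrite (eq_big_In JE).
  have l0 : l zero = zero by exact: (additive0 (linear_plus _ ll)).
  rewrite -(big_morph l (linear_plus _ ll) l0).
  by rewrite [X in l X](L_winding nE) -[RHS]l0.
- move=> z c Ez.
  apply: (continuous_RInt_param (phi := fun z s =>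
      pairing (h (e s)) (k * (c / (e s - z)))%C)) => //.
    have near : locally z (fun z' => forall s, a <= s <= b -> e s <> z').
      apply: (uniform_on_interval (P := fun z' s => e s <> z')) => // s hs.
      have [ce _ _] := he s hs; have nz := nez s z hs Ez.
      have cd : continuous (fun p : C * R => (e p.2 - p.1)%C) (z, s).
        apply: continuous_Cminus; last exact: continuous_fst.
        by apply: continuous_comp => //; exact: continuous_snd.
      have near : locally (z, s) (fun p : C * R => (e p.2 - p.1)%C <> RtoC 0).
        exact: cd (fun u => u <> RtoC 0) (locally_neq (Cminus_neq0 nz)).
      apply: filter_imp near => -[z' s'] /= neq ez.
      by apply: neq; rewrite ez; exact: Cplus_opp_r.
    apply: filter_imp near => z' hz'; apply: ex_RInt_continuous_le => // s hs.
    apply: (cont R_UniformSpace (fun s => s) (fun _ => z') (fun _ => c)) => //.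
    - exact: hz'.
    - exact: continuous_const.
    - exact: continuous_const.
  move=> s hs; apply: (cont _ snd fst (fun _ => c)) => //.
  - exact: nez.
  - exact: continuous_snd.
  - exact: continuous_fst.
  - exact: continuous_const.
Qed.

Variable M : R.
Hypothesis E_bounded : forall z, E z -> - M < z.1 < M /\ - M < z.2 < M.

(** The Lebesgue number of the cover of E by the sets where h is holomorphic *)
Lemma holo_near_E : exists2 d, 0 < d & forall z w, E z ->
  Rabs (w.1 - z.1) < d -> Rabs (w.2 - z.2) < d -> holo h w.
Proof.
case: (classic (exists z, E z)) => [[z0 Ez0]|noE]; last first.
  by exists 1; [lra|move=> z w Ez; case: noE; exists z].
have M0 : - M <= M by have [? _] := E_bounded Ez0; lra.
have [d d0 hd] : exists2 d, 0 < d & forall z w, E z ->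
    - M <= z.1 <= M /\ - M <= z.2 <= M ->
    Rabs (w.1 - z.1) < d -> Rabs (w.2 - z.2) < d -> holo h w.
  apply: (rect_bisection (P := fun x1 x2 y1 y2 => exists2 d, 0 < d & forall z w, E z ->
    x1 <= z.1 <= x2 /\ y1 <= z.2 <= y2 ->
    Rabs (w.1 - z.1) < d -> Rabs (w.2 - z.2) < d -> holo h w)) => //.
    move=> x1 x2 y1 y2 _ hx _ _ hy _ x y [d1 p1 h1] [d2 p2 h2] [d3 p3 h3] [d4 p4 h4].
    have [//|d [d0 [n1 [n2 [n3 [n4 _]]]]]] := @pos_below [:: d1; d2; d3; d4].
    exists d => //.
    move=> z w Ez [zx zy] w1 w2.
    case: (Rle_dec z.1 x) => zx'; case: (Rle_dec z.2 y) => zy'.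
    - by apply: (h1 z w) => //; lra.
    - by apply: (h3 z w) => //; lra.
    - by apply: (h2 z w) => //; lra.
    - by apply: (h4 z w) => //; lra.
  move=> p q _ _; case: (classic (E (p, q))) => [Epq|nEpq].
    have [r r0 hr] := locally_box (E_holo Epq).
    exists (r / 2); first lra.
    move=> x1 x2 y1 y2 _ px _ _ qy _ sx sy; exists (r / 2); first lra.
    move=> z [w1 w2] _ [zx zy] /= /Rabs_def2 ? /Rabs_def2 ?.
    by apply: hr; apply: Rabs_def1; lra.
  have [r r0 hr] := locally_box (E_closed nEpq).
  exists r => // x1 x2 y1 y2 _ px _ _ qy _ sx sy; exists 1; first lra.
  move=> [z1 z2] w Ez [/= zx zy].
  by case: (hr z1 z2 _ _ Ez); apply: Rabs_def1; lra.
by exists d => // z w Ez; apply: hd => //; have [? ?] := E_bounded Ez; lra.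
Qed.

Section Grid.

Variables (n : nat) (x : nat -> R) (s : R).
Hypothesis s_pos : 0 < s.
Hypothesis xS : forall i, x i.+1 = x i + s.
Hypothesis x1 : x 1%N <= - M.
Hypothesis xn : M <= x n.
Hypothesis mesh : forall z w, E z ->
  Rabs (w.1 - z.1) <= s -> Rabs (w.2 - z.2) <= s -> holo h w.

Definition cell_meets_E i j :=
  exists z, E z /\ x i <= z.1 <= x i.+1 /\ x j <= z.2 <= x j.+1.

Definition weight i j : R := if excluded_middle_informative (cell_meets_E i j) then 1 else 0.

Definition hor i j (z c : C) := RInt (fun t => cauchyP h z c (t, x j)) (x i) (x i.+1).
Definition ver i j (z c : C) := RInt (fun t => cauchyQ h z c (x i, t)) (x j) (x j.+1).

(** The sum of the Cauchy integrals over the cells that meet E, after summation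
    by parts: the coefficient of an edge is the difference of the weights of
    the two cells that share it. *)
Definition grid_form (z c : C) : X :=
  minus (\big[plus/zero]_(i < n) \big[plus/zero]_(j < n)
           scal (weight i j.+1 - weight i j) (hor i j.+1 z c))
        (\big[plus/zero]_(j < n) \big[plus/zero]_(i < n)
           scal (weight i.+1 j - weight i j) (ver i.+1 j z c)).

Lemma weight1 i j : cell_meets_E i j -> weight i j = 1.
Proof. by rewrite /weight; case: excluded_middle_informative. Qed.

Lemma weight0 i j : ~ cell_meets_E i j -> weight i j = 0.
Proof. by rewrite /weight; case: excluded_middle_informative. Qed.

Lemma x_mono i j : (i <= j)%N -> x i <= x j.
Proof.
move=> /subnK <-; elim: (j - i)%N => [|k IH]; first exact: Rle_refl.
by rewrite addSn xS; lra.
Qed.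

Lemma weight_boundary i : [/\ weight i 0 = 0, weight i n = 0, weight 0 i = 0 & weight n i = 0].
Proof.
have xn1 := xS n; have x01 := xS 0.
split; apply: weight0 => -[z [/E_bounded [? ?] [? ?]]]; lra.
Qed.

Lemma cell_holo i j u v : cell_meets_E i j ->
  x i <= u <= x i.+1 -> x j <= v <= x j.+1 -> holo h (u, v).
Proof.
move=> [z [Ez [hz1 hz2]]] hu hv; have := xS i; have := xS j => ? ?.
by apply: (mesh Ez) => /=; apply: Rabs_le; lra.
Qed.

(** An edge that meets E lies between two cells of weight 1, so only edges
    outside E carry a nonzero coefficient. *)
Lemma negligible_grid_form : negligible grid_form.
Proof.
have neg Phi : negligible Phi -> negligible (fun z c => opp (Phi z c)).
  move=> nPhi; apply: negligible_ext (negligible_scal (Ropp 1) nPhi) => z c.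
  exact: (scal_opp_one (K := R_Ring)).
apply: negligible_plus; last apply: neg.
- apply: negligible_sum => i; apply: negligible_sum => j.
  case: (Req_dec (weight i j.+1 - weight i j) 0) => [->|nw].
    by apply: negligible_ext negligible0 => z c; rewrite (scal_zero_l (K := R_Ring)).
  apply: negligible_scal.
  have le : x i <= x i.+1 by rewrite xS; lra.
  apply: (negligible_ext (Phi := fun z c => RInt (fun t =>
      pairing (h (t, x j.+1)) (RtoC 1 * (c / ((t, x j.+1) - z)))%C) (x i) (x i.+1))).
    by move=> z c; apply: RInt_ext => t _; rewrite /cauchyP Cmult_1_l.
  apply: (negligible_kernel (e := fun t => (t, x j.+1))) => // t ht; split.
  - by apply: (continuous_row (P := id)); exact: continuous_id.
  - move=> Et; apply: nw; rewrite !weight1 ?Rminus_diag //; exists (t, x j.+1);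
      by have := xS j; have := xS j.+1; repeat split; rewrite //=; lra.
  - case: (classic (cell_meets_E i j)) => [m|nm]; first by apply: (cell_holo m) => //; rewrite xS; lra.
    case: (classic (cell_meets_E i j.+1)) => [m|nm']; last by case: nw; rewrite !weight0 //; ring.
    by apply: (cell_holo m) => //; rewrite (xS j.+1); lra.
- apply: negligible_sum => j; apply: negligible_sum => i.
  case: (Req_dec (weight i.+1 j - weight i j) 0) => [->|nw].
    by apply: negligible_ext negligible0 => z c; rewrite (scal_zero_l (K := R_Ring)).
  apply: negligible_scal.
  have le : x j <= x j.+1 by rewrite xS; lra.
  apply: (negligible_kernel (e := fun t => (x i.+1, t))) => // t ht; split.
  - by apply: (continuous_col (P := id)); exact: continuous_id.
  - move=> Et; apply: nw; rewrite !weight1 ?Rminus_diag //; exists (x i.+1, t);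
      by have := xS i; have := xS i.+1; repeat split; rewrite //=; lra.
  - case: (classic (cell_meets_E i j)) => [m|nm]; first by apply: (cell_holo m) => //; rewrite xS; lra.
    case: (classic (cell_meets_E i.+1 j)) => [m|nm']; last by case: nw; rewrite !weight0 //; ring.
    by apply: (cell_holo m) => //; rewrite (xS i.+1); lra.
Qed.

Lemma grid_formE z c : grid_form z c =
  \big[plus/zero]_(i < n) \big[plus/zero]_(j < n)
    scal (weight i j) (rect_int (cauchyP h z c) (cauchyQ h z c) (x i) (x i.+1) (x j) (x j.+1)).
Proof.
have horE i : \big[plus/zero]_(j < n) scal (weight i j) (minus (hor i j z c) (hor i j.+1 z c))
    = \big[plus/zero]_(j < n) scal (weight i j.+1 - weight i j) (hor i j.+1 z c).
  rewrite (Abel_sum (fun j => weight i j) (fun j => hor i j z c)).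
  have [-> -> _ _] := weight_boundary i; set S := \big[plus/zero]_(j < n) _.
  by lin_eq.
have verE j : \big[plus/zero]_(i < n) scal (weight i j) (minus (ver i j z c) (ver i.+1 j z c))
    = \big[plus/zero]_(i < n) scal (weight i.+1 j - weight i j) (ver i.+1 j z c).
  rewrite (Abel_sum (fun i => weight i j) (fun i => ver i j z c)).
  have [_ _ -> ->] := weight_boundary j; set S := \big[plus/zero]_(i < n) _.
  by lin_eq.
rewrite /grid_form -(eq_bigr _ (fun (i : 'I_n) _ => horE i)) -(eq_bigr _ (fun (j : 'I_n) _ => verE j)).
rewrite [X in minus _ X]exchange_big /=.
rewrite /minus (big_morph _ (@opp_plus _) (@opp_zero _)) -big_split; apply: eq_bigr => i _ /=.
rewrite (big_morph _ (@opp_plus _) (@opp_zero _)) -big_split; apply: eq_bigr => j _ /=.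
rewrite /rect_int -/(hor i j z c) -/(hor i j.+1 z c) -/(ver i j z c) -/(ver i.+1 j z c).
by lin_eq.
Qed.

Lemma grid_form_interior i j z c : (i < n)%N -> (j < n)%N -> cell_meets_E i j ->
  x i < z.1 < x i.+1 -> x j < z.2 < x j.+1 ->
  grid_form z c = scal (2 * PI) (pairing (h z) (Ci * c)%C).
Proof.
move=> ltin ltjn mE hz1 hz2.
have other (k l : nat) u v : (k <> i \/ l <> j) ->
    x k <= u <= x k.+1 -> x l <= v <= x l.+1 -> (u, v) <> z.
  move=> kl hu hv ez.
  have lt_eq (m p : nat) t : x m <= t <= x m.+1 -> x p < t < x p.+1 -> m = p.
    move=> h1 h2; case: (ltngtP m p) => // hmp.
      by have := x_mono hmp; lra.
    by have := x_mono hmp; lra.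
  move: hz1 hz2; rewrite -ez /= => hz1 hz2.
  by case: kl; case; [exact: (lt_eq _ _ u)|exact: (lt_eq _ _ v)].
have cell0 (k l : nat) : (k <> i \/ l <> j) ->
    scal (weight k l) (rect_int (cauchyP h z c) (cauchyQ h z c) (x k) (x k.+1) (x l) (x l.+1)) = zero.
  move=> kl; case: (classic (cell_meets_E k l)) => [m|nm]; last first.
    by rewrite weight0 // (scal_zero_l (K := R_Ring)).
  rewrite cauchy_rect_outside ?(scal_zero_r (K := R_Ring)) //; try by rewrite xS; lra.
  by move=> u v hu hv; split; [exact: cell_holo m hu hv|exact: (other k l)].
rewrite grid_formE (bigD1 (Ordinal ltin)) //= (bigD1 (Ordinal ltjn)) //=.
rewrite weight1 // (scal_one (K := R_Ring)) cauchy_rect //; last first.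
  by move=> u v hu hv; exact: cell_holo mE hu hv.
rewrite big1; last first.
  by move=> l /eqP nl; apply: cell0; right=> el; apply: nl; apply: val_inj.
rewrite big1 ?plus_zero_r // => k /eqP nk; apply: big1 => l _; apply: cell0.
by left=> ek; apply: nk; apply: val_inj.
Qed.

Lemma grid_cell m t : x 0%N <= t < x m -> exists2 i, (i < m)%N & x i <= t < x i.+1.
Proof.
elim: m => [|m IH] ht; first lra.
case: (Rle_dec (x m) t) => hm; first by exists m => //; lra.
by have [|i lti hi] := IH; [lra|exists i => //; exact: ltn_trans lti _].
Qed.

(** A point of E may lie on the grid; the formula extends to it from the
    points of its cell, by continuity. *)
Lemma grid_form_on_E z c : E z ->
  grid_form z c = scal (2 * PI) (pairing (h z) (Ci * c)%C).
Proof.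
move=> Ez; have [bx bz] := E_bounded Ez.
have x0 : x 0%N <= - M by have := xS 0; lra.
have [|i ltin hi] := @grid_cell n z.1; first lra.
have [|j ltjn hj] := @grid_cell n z.2; first lra.
have mE : cell_meets_E i j by exists z; split => //; lra.
have cz : continuous (fun t : R => (z.1 + t, z.2 + t) : C) 0.
  apply: norm_continuous => eps e0; exists (mkposreal (eps / 2) (ltac:(lra))) => t ht.
  change (Rabs (t - 0) < eps / 2) in ht.
  change (norm (Cminus (z.1 + t, z.2 + t) (z.1 + 0, z.2 + 0) : C_R_NormedModule) < eps).
  have -> : Cminus (z.1 + t, z.2 + t) (z.1 + 0, z.2 + 0) = Cmult (RtoC t) (1, 1).
    by complex_ring.
  have Cmod11 : Cmod (1, 1) <= 2.
    rewrite /Cmod /=; apply: Rsqr_incr_0_var; last lra.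
    by rewrite Rsqr_sqrt /Rsqr; lra.
  rewrite norm_C_R Cmod_mult Cmod_R.
  have := Rmult_le_compat_l _ _ _ (Rabs_pos t) Cmod11.
  by rewrite Rminus_0_r in ht; lra.
have z0 : (z.1 + 0, z.2 + 0) = z by case: (z) => u v /=; rewrite !Rplus_0_r.
have [_ _ cG] := negligible_grid_form.
pose f t := minus (grid_form (z.1 + t, z.2 + t) c)
                  (scal (2 * PI) (pairing (h (z.1 + t, z.2 + t)) (Ci * c)%C)).
have cf : continuous f 0.
  apply: continuous_minus.
    apply: (continuous_comp (fun t : R => (z.1 + t, z.2 + t) : C) (fun z => grid_form z c)) => //.
    by rewrite z0; exact: cG.
  apply: continuous_scal_r.
  apply: (continuous_bilinear (bilinear_pairing X)
    (f := fun t => h (z.1 + t, z.2 + t)) (g := fun _ => (Ci * c)%C)); last exact: continuous_const.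
  apply: (continuous_comp (fun t : R => (z.1 + t, z.2 + t) : C) h) => //.
  by rewrite z0; apply: holo_continuous; exact: locally_singleton _ _ (E_holo Ez).
suff f0 : f 0 = zero by move: f0; rewrite /f z0; exact: eq_minus_r.
have fpos t : 0 < t -> t < x i.+1 - z.1 -> t < x j.+1 - z.2 -> f t = zero.
  move=> t0 t1 t2; rewrite /f (grid_form_interior c ltin ltjn mE) ?minus_eq_zero //=; lra.
apply: vec_eq0_of_small => eps e0.
have [delta d0 hd] := locally_interval (continuous_norm cf e0).
have [|t [t0 [t1 [t2 [t3 _]]]]] := @pos_below [:: delta; x i.+1 - z.1; x j.+1 - z.2].
  by repeat split; lra.
have := hd t; rewrite fpos; try lra.
rewrite /minus plus_zero_l norm_opp Rminus_0_r Rabs_pos_eq; last lra.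
by move=> h1; left; apply: h1; lra.
Qed.

Lemma chain_int_grid : chain_int L (fun z c => pairing (h z) (Ci * c)%C) = zero.
Proof.
have pi0 := PI_RGT_0; have [i0 e0 _] := negligible_grid_form.
rewrite -[RHS](scal_zero_r (K := R_Ring) (/ (2 * PI))) -e0 -chain_int_scal //.
apply: (eq_chain_int (E := E)) => // z c Ez.
by rewrite grid_form_on_E //; lin_eq; field; lra.
Qed.

End Grid.
End Homology.

(** Cauchy's theorem.  By Cauchy's formula on the cells of a fine grid that
    meet E, the values of h on E are given by integrals over edges which do not
    meet E.  Each of these has integral zero along the chain, because the chain
    does not wind around the points of the edge. *)
Theorem cauchy_homology (X : CompleteNormedModule R_AbsRing) (h : C -> X * X)
    (E : C -> Prop) (L : seq arc) (M : R) :
  (forall z, ~ E z -> locally z (fun w => ~ E w)) ->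
  (forall z, E z -> locally z (holo h)) ->
  (forall z, E z -> - M < z.1 < M /\ - M < z.2 < M) ->
  (forall A, List.In A L -> continuous_arc A) ->
  (forall A, List.In A L -> forall t, lo A <= t <= hi A -> E (pos A t)) ->
  (forall w, ~ E w -> winding_int L w = RtoC 0) ->
  chain_int L (fun z c => pairing (h z) (Ci * c)%C) = zero.
Proof.
move=> Ecl Eho Ebd Lc LE LW.
have [d d0 hd] := holo_near_E Ecl Eho Ebd.
pose s := d / 2; have s0 : 0 < s by rewrite /s; lra.
have [n hn] := INR_unbounded ((2 * M + s) / s).
apply: (chain_int_grid Eho Lc LE LW Ebd (n := n) (x := fun i => - (M + s) + INR i * s) s0).
- by move=> i; rewrite S_INR; ring.
- by rewrite /=; lra.
- have := Rmult_lt_compat_r _ _ _ s0 hn.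
  have -> : (2 * M + s) / s * s = 2 * M + s by field; lra.
  lra.
- by move=> z w Ez h1 h2; apply: (hd z w Ez); rewrite /s in h1 h2; lra.
Qed.
(** * The Banach algebra of Clifford operators *)

Section CompleteOfLimits.

Variable X : NormedModule R_AbsRing.
Hypothesis X_limits : forall F : (X -> Prop) -> Prop, ProperFilter F -> cauchy F ->
  exists x, forall eps : posreal, F (ball x eps).

(** The structure of complete space asks for a limit of every family of sets,
    depending only on its extension; the choice operator provides it. *)
Definition chosen_limit (F : (X -> Prop) -> Prop) : X :=
  epsilon (inhabits zero) (fun x : X => forall eps : posreal, F (ball x eps)).

Lemma chosen_limitP F : ProperFilter F -> cauchy F ->
  forall eps : posreal, F (ball (chosen_limit F) eps).
Proof. by move=> pF cF; exact: (@epsilon_spec _ _ _ (X_limits pF cF)). Qed.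

Lemma chosen_limit_close F1 F2 : filter_le F1 F2 -> filter_le F2 F1 ->
  close (chosen_limit F1) (chosen_limit F2).
Proof.
move=> le12 le21; have -> : F1 = F2; last exact: close_refl.
apply: functional_extensionality => P; apply: propositional_extensionality.
by split; [exact: le21|exact: le12].
Qed.

Definition limits_CompleteSpace_mixin :=
  CompleteSpace.Mixin X chosen_limit chosen_limitP chosen_limit_close.

End CompleteOfLimits.

Lemma lim_norm (X : CompleteNormedModule R_AbsRing) (F : (X -> Prop) -> Prop) eps :
  ProperFilter F -> cauchy F -> 0 < eps ->
  F (fun x => norm (minus x (lim F)) < eps).
Proof.
move=> pF cF e0; have nf : 0 < @norm_factor _ X by exact: norm_factor_gt_0.
have := complete_cauchy F pF cF (mkposreal _ (Rdiv_lt_0_compat _ _ e0 nf)).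
apply: filter_imp => x /norm_compat2 /=.
by have -> : @norm_factor _ X * (eps / @norm_factor _ X) = eps by field; lra.
Qed.

Lemma cauchy_norm (X : NormedModule R_AbsRing) (F : (X -> Prop) -> Prop) eps :
  cauchy F -> Filter F -> 0 < eps -> exists x, F (fun y => norm (minus y x) < eps).
Proof.
move=> cF fF e0; have nf : 0 < @norm_factor _ X by exact: norm_factor_gt_0.
have [x hx] := cF (mkposreal _ (Rdiv_lt_0_compat _ _ e0 nf)); exists x.
apply: filter_imp hx => y /norm_compat2 /=.
by have -> : @norm_factor _ X * (eps / @norm_factor _ X) = eps by field; lra.
Qed.

Lemma norm_cauchy (X : NormedModule R_AbsRing) (F : (X -> Prop) -> Prop) :
  Filter F ->
  (forall eps, 0 < eps -> exists x, F (fun y => norm (minus y x) < eps)) -> cauchy F.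
Proof.
move=> fF h eps; have [x hx] := h eps (cond_pos eps); exists x.
by apply: filter_imp hx => y; exact: norm_compat1.
Qed.

Lemma Rsum_le_const (I : finType) : exists2 K, 0 < K &
  forall (f : I -> R) d, 0 <= d -> (forall i, f i <= d) ->
    \big[Rplus/0]_i f i <= K * d.
Proof.
exists (1 + \big[Rplus/0]_(i : I) 1).
  have : 0 <= \big[Rplus/0]_(i : I) 1 by apply: (big_ind (Rle 0)) => *; lra.
  lra.
move=> f d d0 fd.
apply: Rle_trans (Rsum_le (H := fun _ => d) fd) _.
rewrite Rmult_plus_distr_r (big_morph (fun r => r * d) (fun x y => Rmult_plus_distr_r x y d) (Rmult_0_l d)).
under [in X in _ <= X]eq_bigr do rewrite Rmult_1_l.
lra.
Qed.

Lemma minus_component (G : AbelianGroup) (x y : clifford G) A :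
  (minus x y : clifford G) A = minus (x A) (y A).
Proof. by rewrite /minus ffunE; congr plus; rewrite ffunE. Qed.

Lemma plus_component (G : AbelianGroup) (x y : clifford G) A :
  (plus x y : clifford G) A = plus (x A) (y A).
Proof. by rewrite ffunE. Qed.

Lemma scal_component (X : NormedModule R_AbsRing) (k : R) (x : clifford X) A :
  (scal k x : clifford X) A = scal k (x A).
Proof. by rewrite ffunE. Qed.

Section CliffordComplete.

Variable X : CompleteNormedModule R_AbsRing.

Lemma norm_component (x : clifford X) A : norm (x A) <= norm x.
Proof.
rewrite -[norm x]/(\big[Rplus/0]_(B : cindex) norm (x B)) (bigD1 A) //=.
have nn : 0 <= \big[Rplus/0]_(B | B != A) norm (x B).
  by apply: (big_ind (Rle 0)) => [|u v|B _]; [lra|lra|exact: norm_ge_0].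
by rewrite -[X in X <= _]Rplus_0_r; exact: Rplus_le_compat_l.
Qed.

Lemma clifford_limits (F : (clifford X -> Prop) -> Prop) : ProperFilter F ->
  cauchy F -> exists x, forall eps : posreal, F (ball x eps).
Proof.
move=> pF cF; pose FA A := filtermap (fun x : clifford X => x A) F.
have cFA A : cauchy (FA A).
  apply: norm_cauchy => eps e0; have [x hx] := cauchy_norm cF _ e0; exists (x A).
  change (F (fun y => norm (minus (y A) (x A)) < eps)).
  apply: filter_imp hx => y; apply: Rle_lt_trans.
  by have := norm_component (minus y x) A; rewrite minus_component.
exists [ffun A => lim (FA A)] => eps.
have [K K0 hK] := Rsum_le_const cindex.
have d0 : 0 < eps / (2 * K) by apply: Rdiv_lt_0_compat; [exact: cond_pos|lra].
have hA A : F (fun x => norm (minus (x A) (lim (FA A))) < eps / (2 * K)).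
  exact: (lim_norm (F := FA A) _ (cFA A) d0).
have hall : F (fun x => forall A, norm (minus (x A) (lim (FA A))) < eps / (2 * K)).
  have {}hall (s : seq cindex) : F (fun x => forall A, A \in s ->
      norm (minus (x A) (lim (FA A))) < eps / (2 * K)).
    elim: s => [|A s IH]; first by apply: filter_forall.
    apply: filter_imp (filter_and _ _ (hA A) IH) => x [h1 h2] B.
    by rewrite inE => /orP[/eqP ->|]; [exact: h1|exact: h2].
  apply: filter_imp (hall (enum cindex)) => x hx A.
  by apply: hx; rewrite mem_enum.
apply: filter_imp hall => x hx; apply: norm_compat1.
apply: Rle_lt_trans (hK _ _ (Rlt_le _ _ d0) _) _.
  by move=> A; left; rewrite minus_component ffunE; exact: hx.
have -> : K * (eps / (2 * K)) = eps / 2 by field; lra.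
by have := cond_pos eps; lra.
Qed.

Canonical clifford_CompleteNormedModule :=
  CompleteNormedModule.Pack R_AbsRing (clifford X)
    (CompleteNormedModule.Class R_AbsRing _
      (NormedModule.class _ (clifford_NormedModule X))
      (limits_CompleteSpace_mixin clifford_limits)) (clifford X).

End CliffordComplete.

Section BopComplete.

Variable V : CompleteNormedModule R_AbsRing.

Lemma norm_bop (T : bop V) v : norm (T v) <= norm T * norm v.
Proof. exact: bop_normP. Qed.

Lemma norm_minus_lt (X : NormedModule R_AbsRing) (x y : X) d :
  norm (minus x y) < d -> norm (minus y x) < d.
Proof. by rewrite -(opp_minus x y) norm_opp. Qed.

(** The limit is taken at each vector; the bound for the limit operator comes
    from an operator at distance less than 1 from most of the family. *)
Lemma bop_limits (F : (bop V -> Prop) -> Prop) : ProperFilter F ->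
  cauchy F -> exists T, forall eps : posreal, F (ball T eps).
Proof.
move=> pF cF; pose Fv v := filtermap (fun S : bop V => S v) F.
have cFv v : cauchy (Fv v).
  apply: norm_cauchy => eps e0; have nv := norm_ge_0 v.
  have d0 : 0 < eps / (1 + norm v) by apply: Rdiv_lt_0_compat; lra.
  have [S0 h0] := cauchy_norm cF _ d0; exists (S0 v).
  change (F (fun S : bop V => norm (minus (S v) (S0 v)) < eps)).
  apply: filter_imp h0 => S hS; apply: Rle_lt_trans (norm_bop (minus S S0) v) _.
  apply: Rle_lt_trans (Rmult_le_compat_r _ _ _ nv (Rlt_le _ _ hS)) _.
  apply: (Rmult_lt_reg_r (1 + norm v)); first lra.
  by have -> : eps / (1 + norm v) * norm v * (1 + norm v) = eps * norm v; [field|]; lra.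
pose t v := lim (Fv v).
have tF v d : 0 < d -> F (fun S => norm (minus (S v) (t v)) < d).
  by move=> d0; exact: (lim_norm (F := Fv v) _ (cFv v) d0).
have lt : is_linear t.
  have plus_t u v : t (plus u v) = plus (t u) (t v).
    apply: eq_minus_r; apply: vec_eq0_of_small => eps e0; have e3 : 0 < eps / 3 by lra.
    have [S [[hu hv] huv]] := filter_ex _ (filter_and _ _ (filter_and _ _ (tF u _ e3) (tF v _ e3)) (tF (plus u v) _ e3)).
    have -> : minus (t (plus u v)) (plus (t u) (t v)) =
      plus (minus (t (plus u v)) (S (plus u v)))
           (plus (minus (S u) (t u)) (minus (S v) (t v))).
      by rewrite (linear_plus _ (bopP S)); lin_eq.
    apply: Rle_trans (norm_plus_le (Rlt_le _ _ (norm_minus_lt huv))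
      (norm_plus_le (Rlt_le _ _ hu) (Rlt_le _ _ hv))) _; lra.
  have scal_t (k : R) v : t (scal k v) = scal k (t v).
    apply: eq_minus_r; apply: vec_eq0_of_small => eps e0; have k0 := Rabs_pos k.
    have e3 : 0 < eps / (2 + Rabs k) by apply: Rdiv_lt_0_compat; lra.
    have [S [hv hkv]] := filter_ex _ (filter_and _ _ (tF v _ e3) (tF (scal k v) _ e3)).
    have -> : minus (t (scal k v)) (scal k (t v)) =
      plus (minus (t (scal k v)) (S (scal k v))) (scal k (minus (S v) (t v))).
      by rewrite (linear_scal _ (bopP S)); lin_eq.
    have h2 := Rmult_le_compat_l _ _ _ k0 (Rlt_le _ _ hv).
    have h3 := Rle_trans _ _ _ (norm_scal_le k (minus (S v) (t v))) h2.
    apply: Rle_trans (norm_plus_le (Rlt_le _ _ (norm_minus_lt hkv)) h3) _.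
    have e : eps = eps / (2 + Rabs k) * (2 + Rabs k) by field; lra.
    by lra.
  split=> //; have [S0 h0] := cauchy_norm cF _ Rlt_0_1.
  have n0 := norm_ge_0 S0; exists (norm S0 + 1); split; first lra.
  move=> v; apply: Rle_plus_epsilon => eps e0.
  have [S [hS hv]] := filter_ex _ (filter_and _ _ h0 (tF v _ e0)).
  have -> : t v = plus (minus (t v) (S v)) (plus (S0 v) ((minus S S0) v)).
    have -> : (minus S S0) v = minus (S v) (S0 v) by [].
    by lin_eq.
  have h3 := Rle_trans _ _ _ (norm_bop (minus S S0) v)
    (Rmult_le_compat_r _ _ _ (norm_ge_0 v) (Rlt_le _ _ hS)).
  apply: Rle_trans (norm_plus_le (Rlt_le _ _ (norm_minus_lt hv))
    (norm_plus_le (norm_bop S0 v) h3)) _.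
  lra.
exists (Bop lt) => eps; have e0 := cond_pos eps; have e3 : 0 < eps / 3 by lra.
have [S0 h0] := cauchy_norm cF _ e3.
have h0' := h0; apply: filter_imp h0 => S hS; apply: norm_compat1.
apply: (Rle_lt_trans _ (2 * (eps / 3))); last lra.
apply: bop_norm_le => v v1; apply: Rle_plus_epsilon => d d0.
have [S' [hS' hv]] := filter_ex _ (filter_and _ _ h0' (tF v _ d0)).
have -> : (minus S (Bop lt)) v =
    plus ((minus S S0) v) (plus (opp ((minus S' S0) v)) (minus (S' v) (t v))).
  have -> : (minus S (Bop lt)) v = minus (S v) (t v) by [].
  have -> : (minus S S0) v = minus (S v) (S0 v) by [].
  have -> : (minus S' S0) v = minus (S' v) (S0 v) by [].
  by lin_eq.
have small (U : bop V) : norm U < eps / 3 -> norm (U v) <= eps / 3.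
  move=> hU; apply: Rle_trans (norm_bop U v) _.
  have := Rmult_le_compat _ _ _ _ (norm_ge_0 U) (norm_ge_0 v) (Rlt_le _ _ hU) v1.
  by rewrite Rmult_1_r.
have small' : norm (opp ((minus S' S0) v)) <= eps / 3.
  by rewrite norm_opp; exact: small.
apply: Rle_trans (norm_plus_le (small _ hS) (norm_plus_le small' (Rlt_le _ _ hv))) _.
lra.
Qed.

Canonical bop_CompleteNormedModule :=
  CompleteNormedModule.Pack R_AbsRing (bop V)
    (CompleteNormedModule.Class R_AbsRing _
      (NormedModule.class _ (bop_NormedModule V))
      (limits_CompleteSpace_mixin bop_limits)) (bop V).

End BopComplete.

Section BanachAlgebra.

Variable V : CompleteNormedModule R_AbsRing.
Implicit Types x y z : BV5 V.

Lemma norm_signed (X : NormedModule R_AbsRing) b (x : X) : norm (signed b x) = norm x.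
Proof. by case: b => //=; exact: norm_opp. Qed.

Lemma norm_sum_le (X : NormedModule R_AbsRing) (I : finType) (f : I -> X) :
  norm (\big[plus/zero]_i f i) <= \big[Rplus/0]_i norm (f i).
Proof.
apply: (big_ind2 (fun (x : X) r => norm x <= r)) => [|x1 r1 x2 r2 h1 h2|i _].
- by rewrite norm_zero; lra.
- by apply: Rle_trans (norm_triangle _ _) _; lra.
- exact: Rle_refl.
Qed.

Lemma norm_bop_mult (S T : bop V) : norm (mult S T) <= norm S * norm T.
Proof.
apply: bop_norm_le => v v1; apply: Rle_trans (norm_bop S (T v)) _.
apply: Rmult_le_compat_l; first exact: norm_ge_0.
apply: Rle_trans (norm_bop T v) _.
have := norm_ge_0 T; nra.
Qed.

Lemma norm_clifford_mult x y : norm (mult x y) <= norm x * norm y.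
Proof.
rewrite -[norm (mult x y)]/(\big[Rplus/0]_(D : cindex) norm (cprod mult x y D)).
apply: (Rle_trans _ (\big[Rplus/0]_(D : cindex) \big[Rplus/0]_(A : cindex)
    (norm (x A) * norm (y (symdiff A D))))).
  apply: Rsum_le => D; rewrite cprodE; apply: Rle_trans (norm_sum_le _) _.
  by apply: Rsum_le => A; rewrite norm_signed; exact: norm_bop_mult.
rewrite exchange_big /= -[norm x]/(\big[Rplus/0]_(A : cindex) norm (x A)).
rewrite (big_morph (fun r => r * norm y)
  (fun u v => Rmult_plus_distr_r u v (norm y)) (Rmult_0_l (norm y))).
apply: Rsum_le => A.
rewrite -[norm y]/(\big[Rplus/0]_(A : cindex) norm (y A)).
rewrite (big_morph _ (Rmult_plus_distr_l (norm (x A))) (Rmult_0_r _)).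
rewrite [X in _ <= X](reindex_inj (h := symdiff A)) /=; first exact: Rle_refl.
move=> B B' /setP eqBB'; apply/setP => i.
by move: (eqBB' i); rewrite !in_symdiff; case: (_ \in A) => // /negb_inj.
Qed.

Lemma scal_signed (X : NormedModule R_AbsRing) (k : R) b (x : X) :
  scal k (signed b x) = signed b (scal k x).
Proof. by case: b => //=; exact: (scal_opp_r (K := R_Ring)). Qed.

Lemma bop_scal_multl (k : R) (S T : bop V) : mult (scal k S) T = scal k (mult S T).
Proof. exact: bop_ext. Qed.

Lemma bop_scal_multr (k : R) (S T : bop V) : mult S (scal k T) = scal k (mult S T).
Proof. by apply: bop_ext => v; exact: (linear_scal _ (bopP S)). Qed.

Lemma scal_multl (k : R) x y : mult (scal k x) y = scal k (mult x y).
Proof.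
apply/ffunP => D; rewrite [RHS]ffunE -![mult _ _]/(cprod mult _ _) !cprodE.
rewrite (big_morph _ (@scal_distr_l _ _ k) (@scal_zero_r _ _ k)).
by apply: eq_bigr => A _; rewrite scal_component bop_scal_multl scal_signed.
Qed.

Lemma scal_multr (k : R) x y : mult x (scal k y) = scal k (mult x y).
Proof.
apply/ffunP => D; rewrite [RHS]ffunE -![mult _ _]/(cprod mult _ _) !cprodE.
rewrite (big_morph _ (@scal_distr_l _ _ k) (@scal_zero_r _ _ k)).
apply: eq_bigr => A _.
by rewrite scal_component bop_scal_multr scal_signed.
Qed.

Lemma bilinear_mult : bilinear (@mult (clifford_Ring (bop_Ring V)) : BV5 V -> BV5 V -> BV5 V).
Proof.
split.
- by move=> x y z; exact: mult_distr_r.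
- by move=> x y z; exact: mult_distr_l.
- exact: scal_multl.
- exact: scal_multr.
- by exists 1; [lra|move=> x y; rewrite Rmult_1_l; exact: norm_clifford_mult].
Qed.

Lemma inverse_unique x y z : is_inverse x y -> is_inverse x z -> y = z.
Proof.
move=> [_ yx] [xz _]; rewrite -(mult_one_r y) -xz mult_assoc yx.
exact: mult_one_l.
Qed.

Lemma inverse_mult x y x' y' : is_inverse x x' -> is_inverse y y' ->
  is_inverse (mult x y) (mult y' x').
Proof.
move=> [h1 h2] [h3 h4]; split.
- by rewrite mult_assoc -(mult_assoc x) h3 mult_one_r.
- by rewrite mult_assoc -(mult_assoc y') h2 mult_one_r.
Qed.

(** The inverse of 1 - u is the sum of the powers of u. *)
Lemma neumann (u : BV5 V) : norm u <= / 2 -> exists y, is_inverse (minus one u) y.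
Proof.
move=> hu; have nu := norm_ge_0 u; have n1 := norm_ge_0 (one : BV5 V).
have bound k : norm (pow_n u k) <= norm (one : BV5 V) * (/ 2) ^ k.
  elim: k => [|k IH] /=; first by rewrite Rmult_1_r; exact: Rle_refl.
  apply: Rle_trans (norm_clifford_mult _ _) _.
  have := Rmult_le_compat _ _ _ _ nu (norm_ge_0 _) hu IH; lra.
have half : Rabs (/ 2) < 1 by rewrite Rabs_pos_eq; lra.
have geom : ex_series (fun k => norm (one : BV5 V) * (/ 2) ^ k).
  by apply: (ex_series_scal (norm (one : BV5 V))); exact: ex_series_geom.
have [y hy] := ex_series_le (V := clifford_CompleteNormedModule _) _ _ bound geom.
have bl := bilinear_mult; have [BNl BNr] := bilinearN bl.
have pow_comm k : mult u (pow_n u k) = mult (pow_n u k) u.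
  elim: k => [|k IH] /=; first by rewrite mult_one_l mult_one_r.
  by rewrite IH mult_assoc IH -!mult_assoc.
have tele1 k : mult (minus one u) (sum_n (pow_n u) k) = minus one (pow_n u k.+1).
  elim: k => [|k IH].
    by rewrite sum_O /= !mult_one_r.
  by rewrite sum_Sn mult_distr_l IH /minus mult_distr_r mult_one_l BNl /=; lin_eq.
have tele2 k : mult (sum_n (pow_n u) k) (minus one u) = minus one (pow_n u k.+1).
  elim: k => [|k IH].
    by rewrite sum_O /= mult_one_l mult_one_r.
  rewrite sum_Sn mult_distr_r IH /minus mult_distr_l mult_one_r BNr -[mult (pow_n u k.+1) u]pow_comm /=.
  by lin_eq.
have lim1 : filterlim (fun k => minus one (pow_n u k.+1)) eventually (locally (one : BV5 V)).
  apply/filterlim_locally => eps.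
  have c0 : 0 < eps / (1 + norm (one : BV5 V)) by apply: Rdiv_lt_0_compat; [exact: cond_pos|lra].
  have [N hN] := pow_lt_1_zero _ half _ c0.
  exists N => k hk; apply: norm_compat1.
  have -> : minus (minus one (pow_n u k.+1)) one = opp (pow_n u k.+1) by lin_eq.
  rewrite norm_opp; apply: Rle_lt_trans (bound _) _.
  have := hN k.+1 _; rewrite Rabs_pos_eq; last by apply: pow_le; lra.
  move=> h; have {}h : (/ 2) ^ k.+1 < eps / (1 + norm (one : BV5 V)) by apply: h; exact: (PeanoNat.Nat.le_trans _ _ _ hk (PeanoNat.Nat.le_succ_diag_r k)).
  have p0 : 0 <= (/ 2) ^ k.+1 by apply: pow_le; lra.
  have e : eps / (1 + norm (one : BV5 V)) * (1 + norm (one : BV5 V)) = eps by field; lra.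
  nra.
have mulC (f : BV5 V -> BV5 V) : is_linear f ->
    (forall k, f (sum_n (pow_n u) k) = minus one (pow_n u k.+1)) -> f y = one.
  move=> lf fE; apply: (filterlim_locally_unique (F := eventually) (fun k => minus one (pow_n u k.+1))) => //.
  apply: filterlim_ext (filterlim_comp _ _ _ _ f _ _ _ hy (linear_cont f y lf)) => k.
  exact: fE.
exists y; split.
- apply: (mulC (mult (minus one u))) => //.
  exact: is_linear_bilinear_r.
- by apply: (mulC (fun x => mult x (minus one u))) => //; exact: is_linear_bilinear_l.
Qed.

Lemma inverse_near x x0 y0 : is_inverse x0 y0 -> norm (minus x x0) * norm y0 <= / 2 ->
  exists y, is_inverse x y.
Proof.
move=> inv small; have [h1 h2] := inv.
have [|t ht] := @neumann (mult (minus x0 x) y0).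
  apply: Rle_trans (norm_clifford_mult _ _) _.
  by rewrite -(opp_minus x x0) norm_opp.
have [BNl BNr] := bilinearN bilinear_mult.
have -> : x = mult (minus one (mult (minus x0 x) y0)) x0.
  rewrite /minus mult_distr_r BNl -mult_assoc h2 mult_one_r mult_one_l.
  by lin_eq.
by exists (mult y0 t); exact: inverse_mult.
Qed.

Lemma locally_inverse (q : C -> BV5 V) (p : C) y : continuous q p -> is_inverse (q p) y ->
  locally p (fun w => exists y', is_inverse (q w) y').
Proof.
move=> cq inv; have n0 := norm_ge_0 y.
have e0 : 0 < / (2 * (1 + norm y)) by apply: Rinv_0_lt_compat; lra.
apply: filter_imp (continuous_norm cq e0) => w hw; apply: (inverse_near inv).
apply: Rle_trans (Rmult_le_compat_r _ _ _ n0 (Rlt_le _ _ hw)) _.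
apply: (Rmult_le_reg_r (2 * (1 + norm y))); first lra.
by rewrite Rmult_assoc (Rmult_comm (norm _)) -Rmult_assoc Rinv_l; lra.
Qed.

End BanachAlgebra.
(** * Operators with scalar coefficients and the imaginary units *)

Lemma sphere_sum J : sphere J -> \big[Rplus/0]_(i : 'I_5) (J i) ^ 2 = 1.
Proof.
rewrite /sphere /norm5 => h.
have p : 0 <= \big[Rplus/0]_(i : 'I_5) (J i) ^ 2.
  by apply: (big_ind (Rle 0)) => [|u v|i _]; [lra|lra|exact: pow2_ge_0].
by rewrite -[LHS](sqrt_sqrt _ p) h Rmult_1_l.
Qed.

Section CliffordOps.

Variable V : CompleteNormedModule R_AbsRing.
Implicit Types x y a b : BV5 V.

Definition commutes x y := mult x y = mult y x.

Lemma commutes_plus x y z : commutes x y -> commutes x z -> commutes x (plus y z).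
Proof. by rewrite /commutes mult_distr_l mult_distr_r => -> ->. Qed.

Lemma commutes_opp x y : commutes x y -> commutes x (opp y).
Proof. by rewrite /commutes -opp_mult_r -opp_mult_l => ->. Qed.

Lemma commutes_scal x y (k : R) : commutes x y -> commutes x (scal k y).
Proof. by rewrite /commutes scal_multr scal_multl => ->. Qed.

Lemma commutes_mult x y z : commutes x y -> commutes x z -> commutes x (mult y z).
Proof. by rewrite /commutes => xy xz; rewrite mult_assoc xy -mult_assoc xz mult_assoc. Qed.

Lemma commutes_one x : commutes x one.
Proof. by rewrite /commutes mult_one_l mult_one_r. Qed.

Lemma commutes_zero x : commutes x zero.
Proof. by rewrite /commutes mult_zero_l mult_zero_r. Qed.

Lemma commutes_refl x : commutes x x.
Proof. by []. Qed.

Lemma commutes_sym x y : commutes x y -> commutes y x.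
Proof. by []. Qed.

Lemma commutes_inverse x y z : is_inverse y z -> commutes x y -> commutes x z.
Proof.
move=> [yz zy] xy; rewrite /commutes -[X in mult X z = _]mult_one_l -zy.
by rewrite -(mult_assoc z) -xy -!mult_assoc yz mult_one_r.
Qed.

Lemma op_invP x : (exists y, is_inverse x y) -> is_inverse x (op_inv x).
Proof. by move=> ex; exact: (@epsilon_spec _ _ _ ex). Qed.

Lemma cmono_plus (G : AbelianGroup) A (s t : G) :
  cmono A (plus s t) = plus (cmono A s) (cmono A t).
Proof. by apply/ffunP => B; rewrite !ffunE; case: eqP; rewrite ?plus_zero_l. Qed.

Lemma cmono_opp (G : AbelianGroup) A (s : G) : cmono A (opp s) = opp (cmono A s).
Proof. by apply/ffunP => B; rewrite !ffunE; case: eqP; rewrite ?opp_zero. Qed.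

Lemma cmono_zero (G : AbelianGroup) A : cmono A (zero : G) = zero.
Proof. by apply/ffunP => B; rewrite !ffunE; case: eqP. Qed.

Lemma cmono_sum (G : AbelianGroup) (I : finType) A (f : I -> G) :
  cmono A (\big[plus/zero]_i f i) = \big[plus/zero]_i cmono A (f i).
Proof. exact: (big_morph (cmono A) (cmono_plus A) (@cmono_zero G A)). Qed.

Lemma cmono_scal (k : R) A (s : bop V) : cmono A (scal k s) = scal k (cmono A s).
Proof.
apply/ffunP => B; rewrite scal_component !ffunE; case: eqP => // _.
by rewrite (scal_zero_r (K := R_Ring)).
Qed.

(** The operators that act on the coefficients only.  They commute with all
    Clifford numbers. *)
Definition scalar_op x := x = cmono set0 (x set0).

Lemma scalar_cmono (s : bop V) : scalar_op (cmono set0 s).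
Proof. by rewrite /scalar_op [cmono set0 s set0]ffunE eqxx. Qed.

Lemma scalar_plus x y : scalar_op x -> scalar_op y -> scalar_op (plus x y).
Proof. by move=> -> ->; rewrite -cmono_plus; exact: scalar_cmono. Qed.

Lemma scalar_opp x : scalar_op x -> scalar_op (opp x).
Proof. by move=> ->; rewrite -cmono_opp; exact: scalar_cmono. Qed.

Lemma scalar_scal (k : R) x : scalar_op x -> scalar_op (scal k x).
Proof. by move=> ->; rewrite -cmono_scal; exact: scalar_cmono. Qed.

Lemma scalar_zero : scalar_op zero.
Proof. by rewrite -(@cmono_zero _ set0); exact: scalar_cmono. Qed.

Lemma scalar_one : scalar_op one.
Proof. exact: scalar_cmono. Qed.

Lemma cmono0_mult (s : bop V) y A : (mult (cmono set0 s) y) A = mult s (y A).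
Proof.
rewrite -[mult _ y]/(cprod mult _ _) cprodE (bigD1 set0) //= big1 => [|B nB].
  by rewrite csign0s /= symdiff0s ffunE eqxx plus_zero_r.
by rewrite ffunE (negbTE nB) mult_zero_l signed0.
Qed.

Lemma mult_cmono0 (s : bop V) y A : (mult y (cmono set0 s)) A = mult (y A) s.
Proof.
have AA : symdiff A A = set0 by apply/setP => i; rewrite in_symdiff inE addbb.
rewrite -[mult y _]/(cprod mult _ _) cprodE (bigD1 A) //= big1 => [|B nB].
  by rewrite AA csigns0 /= ffunE eqxx plus_zero_r.
rewrite ffunE ifF ?mult_zero_r ?signed0 //.
apply: contraNF nB => /eqP/setP eqAD; apply/eqP/setP => i.
by move: (eqAD i); rewrite in_symdiff inE; case: (_ \in A); case: (_ \in B).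
Qed.

Lemma scalar_mult x y : scalar_op x -> scalar_op y -> scalar_op (mult x y).
Proof.
move=> -> ->; have -> : mult (cmono set0 (x set0)) (cmono set0 (y set0)) =
    cmono set0 (mult (x set0) (y set0)) :> BV5 V.
  apply/ffunP => A; rewrite cmono0_mult !ffunE; case: eqP => // _.
  exact: mult_zero_r.
exact: scalar_cmono.
Qed.

Lemma scalar_inverse x y : scalar_op x -> is_inverse x y -> scalar_op y.
Proof.
move=> sx inv; suff inv' : is_inverse x (cmono set0 (y set0)).
  by rewrite (inverse_unique inv inv'); exact: scalar_cmono.
have [xy yx] := inv; split; apply/ffunP => A.
  rewrite sx cmono0_mult !ffunE; case: eqP => _; last exact: mult_zero_r.
  by rewrite -cmono0_mult -sx xy ffunE eqxx.
rewrite {1}sx mult_cmono0 !ffunE; case: eqP => _; last exact: mult_zero_l.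
by rewrite -mult_cmono0 -sx yx ffunE eqxx.
Qed.

Lemma bop_mult_idl (S : bop V) : mult (bop_id V) S = S.
Proof. exact: bop_ext. Qed.

Lemma bop_mult_idr (S : bop V) : mult S (bop_id V) = S.
Proof. exact: bop_ext. Qed.

Lemma cliff_op_plus (a b : R5) : cliff_op V (plus a b) = plus (cliff_op V a) (cliff_op V b).
Proof. by apply/ffunP => A; rewrite !ffunE; exact: (scal_distr_r (K := R_Ring)). Qed.

Lemma cliff_op_scal (k : R) (a : R5) : cliff_op V (scal k a) = scal k (cliff_op V a).
Proof. by apply/ffunP => A; rewrite !ffunE scal_assoc. Qed.

Lemma cliff_op_opp (a : R5) : cliff_op V (opp a) = opp (cliff_op V a).
Proof. by apply/ffunP => A; rewrite !ffunE; exact: (scal_opp_l (K := R_Ring)). Qed.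

Lemma cliff_op_mult (a b : R5) : cliff_op V (mult a b) = mult (cliff_op V a) (cliff_op V b).
Proof.
apply/ffunP => D; rewrite ffunE -![mult _ _]/(cprod mult _ _) !cprodE.
have hD (r s : R) : scal (plus r s) (bop_id V) = plus (scal r (bop_id V)) (scal s (bop_id V)).
  exact: (scal_distr_r (K := R_Ring)).
rewrite (additive_sum (h := fun r : R => scal r (bop_id V)) hD).
apply: eq_bigr => A _.
rewrite (additive_signed (h := fun r : R => scal r (bop_id V)) hD); congr signed.
by rewrite !ffunE bop_scal_multl bop_scal_multr scal_assoc bop_mult_idl.
Qed.

Lemma cliff_op_cmono A (r : R) : cliff_op V (cmono A r) = cmono A (scal r (bop_id V)).
Proof.
apply/ffunP => B; rewrite !ffunE; case: eqP => // _; exact: (scal_zero_l (K := R_Ring)).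
Qed.

Lemma is_linear_cliff_op : is_linear (cliff_op V : R5 -> BV5 V).
Proof.
split; [exact: cliff_op_plus|exact: cliff_op_scal|].
exists (1 + norm (bop_id V)); have n0 := norm_ge_0 (bop_id V).
split; [lra|move=> a].
rewrite -[norm a]/(\big[Rplus/0]_(A : cindex) norm (a A)).
rewrite (big_morph _ (Rmult_plus_distr_l (1 + norm (bop_id V))) (Rmult_0_r _)).
apply: Rsum_le => A; rewrite ffunE; apply: Rle_trans (norm_scal_le _ _) _.
have h : Rabs (a A) * norm (bop_id V) <= (1 + norm (bop_id V)) * Rabs (a A).
  by have := Rabs_pos (a A); lra.
exact: h.
Qed.

Lemma scalar_commutes x (a : R5) : scalar_op x -> commutes x (cliff_op V a).
Proof.
move=> ->; apply/ffunP => A; rewrite cmono0_mult mult_cmono0 ffunE.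
by rewrite bop_scal_multl bop_scal_multr bop_mult_idl bop_mult_idr.
Qed.

Lemma antisymmetric_sum (X : NormedModule R_AbsRing) (I : finType) (G : I -> I -> X) :
  (forall i k, i != k -> G i k = opp (G k i)) ->
  \big[plus/zero]_i \big[plus/zero]_k G i k = \big[plus/zero]_i G i i.
Proof.
move=> Ga; pose H i k := if k == i then zero else G i k.
have GH i : \big[plus/zero]_k G i k = plus (G i i) (\big[plus/zero]_k H i k).
  rewrite (bigD1 i) //=; congr plus; rewrite [RHS](bigD1 i) //= /H eqxx plus_zero_l.
  by apply: eq_bigr => k /negbTE ->.
rewrite (eq_bigr _ (fun i _ => GH i)) big_split /=.
set S := \big[plus/zero]_i \big[plus/zero]_k H i k.
suff S0 : S = zero by rewrite -/S S0; exact: plus_zero_r.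
have SN : S = opp S.
  rewrite {1}/S exchange_big /= /S (big_morph _ (@opp_plus _) (@opp_zero _)).
  apply: eq_bigr => k _; rewrite (big_morph _ (@opp_plus _) (@opp_zero _)).
  apply: eq_bigr => i _; rewrite /H eq_sym; case: (eqVneq i k) => [_|nik].
    by rewrite opp_zero.
  by rewrite Ga.
have S2 : scal 2 S = plus S S by lin_eq.
have SS : scal 2 S = zero by rewrite S2 {2}SN plus_opp_r.
have -> : S = scal (/ 2) (scal 2 S) by lin_eq.
rewrite SS; exact: (scal_zero_r (K := R_Ring)).
Qed.

Definition vec_op (t : 'I_5 -> bop V) : BV5 V := \big[plus/zero]_(i : 'I_5) cmono [set i] (t i).

(** The components commute and e_i e_j = - e_j e_i, so only the squares are
    left. *)
Lemma vec_op_sqr t : (forall i k, mult (t i) (t k) = mult (t k) (t i)) ->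
  mult (vec_op t) (vec_op t)
  = cmono set0 (opp (\big[plus/zero]_(i : 'I_5) mult (t i) (t i))).
Proof.
move=> tC; rewrite {1}/vec_op.
rewrite (big_morph (fun x => mult x (vec_op t))
  (fun x y => mult_distr_r x y (vec_op t)) (mult_zero_l (vec_op t))).
under eq_bigr => i _ do
  rewrite (big_morph _ (mult_distr_l (cmono [set i] (t i))) (mult_zero_r (cmono [set i] (t i)))).
rewrite antisymmetric_sum => [|i k nik]; last first.
  rewrite !cmono_mult !csign1 tC.
  have -> : symdiff [set k] [set i] = symdiff [set i] [set k].
    by apply/setP => l; rewrite !in_symdiff addbC.
  rewrite -cmono_opp; congr cmono.
  have -> : (i <= k)%N = ~~ (k <= i)%N.
    by rewrite -ltnNge ltn_neqAle [(i <= k)%N]leq_eqVlt (inj_eq val_inj) nik /=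
      (negbTE nik).
  by case: (k <= i)%N => //=; rewrite opp_opp.
rewrite cmono_opp cmono_sum (big_morph _ (@opp_plus _) (@opp_zero _)).
apply: eq_bigr => i _; rewrite cmono_mult csign1 leqnn /= -cmono_opp; congr cmono.
by apply/setP => l; rewrite in_symdiff addbb in_set0.
Qed.

Definition unit_op (J : 'I_5 -> R) : BV5 V := cliff_op V (imag J).

Lemma unit_opE J : unit_op J = vec_op (fun i => scal (J i) (bop_id V)).
Proof.
rewrite /unit_op /imag /para cmono_zero plus_zero_l.
rewrite (additive_sum (h := cliff_op V) cliff_op_plus).
by apply: eq_bigr => i _; exact: cliff_op_cmono.
Qed.

Lemma unit_op_sqr J : sphere J -> mult (unit_op J) (unit_op J) = opp one.
Proof.
move=> SJ; rewrite unit_opE vec_op_sqr => [|i k]; last first.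
  by rewrite !bop_scal_multl !bop_scal_multr !scal_assoc /mult /= Rmult_comm.
rewrite cmono_opp; congr opp; congr cmono.
have hD (r s : R) : scal (plus r s) (bop_id V) = plus (scal r (bop_id V)) (scal s (bop_id V)).
  exact: (scal_distr_r (K := R_Ring)).
rewrite (eq_bigr (fun i => scal ((J i) ^ 2) (bop_id V))); last first.
  move=> i _; rewrite bop_scal_multl bop_scal_multr scal_assoc bop_mult_idl.
  by congr (scal _ _); rewrite /mult /=; ring.
have e := additive_sum (h := fun r : R => scal r (bop_id V)) hD predT (fun i => (J i) ^ 2).
rewrite -[LHS]e.
have -> : \big[plus/zero]_(i : 'I_5) ((J i) ^ 2 : R) = 1 by exact: sphere_sum.
exact: (scal_one (K := R_Ring)).
Qed.

Lemma scalar_unit x J : scalar_op x -> commutes x (unit_op J).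
Proof. exact: scalar_commutes. Qed.

Definition opp_unit (J : 'I_5 -> R) : 'I_5 -> R := fun i => - J i.

Lemma sphere_opp J : sphere J -> sphere (opp_unit J).
Proof.
rewrite /sphere /norm5 => <-; congr sqrt; apply: eq_bigr => i _.
by rewrite /opp_unit; ring.
Qed.

Lemma unit_op_opp J : unit_op (opp_unit J) = opp (unit_op J).
Proof.
rewrite !unit_opE /vec_op (big_morph _ (@opp_plus _) (@opp_zero _)).
apply: eq_bigr => i _; rewrite -cmono_opp; congr cmono.
exact: (scal_opp_l (K := R_Ring)).
Qed.

Lemma slice_pt_opp J z : slice_pt (opp_unit J) (Cconj z) = slice_pt J z.
Proof.
rewrite /slice_pt /=; congr pair; apply: functional_extensionality => i.
by rewrite /opp_unit; ring.
Qed.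

Lemma para_op_slice J z :
  para_op V (slice_pt J z) = plus (scal z.1 (one : BV5 V)) (scal z.2 (unit_op J)).
Proof.
rewrite /para_op /cliff /para cliff_op_plus; congr plus.
  rewrite cliff_op_cmono -cmono_scal; congr cmono; congr scal.
rewrite unit_opE /vec_op (additive_sum (h := cliff_op V) cliff_op_plus).
rewrite (big_morph _ (@scal_distr_l _ _ z.2) (@scal_zero_r _ _ z.2)).
apply: eq_bigr => i _; rewrite cliff_op_cmono -cmono_scal; congr cmono.
by rewrite scal_assoc.
Qed.

(** The grade involution e_A |-> (-1)^|A| e_A is an automorphism; it fixes the
    scalar operators and changes the sign of the imaginary units. *)
Definition grade x : BV5 V := [ffun A : cindex => signed (odd #|A|) (x A)].

Lemma odd_symdiff (A B : cindex) : odd #|symdiff A B| = odd #|A| (+) odd #|B|.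
Proof.
rewrite /symdiff cardsU; have -> : (A :\: B) :&: (B :\: A) = set0.
  by apply/setP => i; rewrite !inE; case: (i \in A); case: (i \in B).
rewrite cards0 subn0 -(cardsID B A) -(cardsID A B) [B :&: A]setIC !oddD.
by move: (odd #|A :&: B|) (odd #|A :\: B|) (odd #|B :\: A|) => [] [] [].
Qed.

Lemma grade_mult x y : grade (mult x y) = mult (grade x) (grade y).
Proof.
apply/ffunP => D; rewrite ffunE -![mult _ _]/(cprod mult _ _) !cprodE signed_sum.
apply: eq_bigr => A _; rewrite !ffunE odd_symdiff.
have signedl (c : bool) (s t : bop V) : mult (signed c s) t = signed c (mult s t).
  by case: c => //=; rewrite -opp_mult_l.
have signedr (c : bool) (s t : bop V) : mult s (signed c t) = signed c (mult s t).
  by case: c => //=; rewrite -opp_mult_r.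
rewrite signedl signedr !signed_signed; congr signed.
by case: (odd #|A|); case: (odd #|D|); case: (csign _ _).
Qed.

Lemma grade_plus x y : grade (plus x y) = plus (grade x) (grade y).
Proof. by apply/ffunP => A; rewrite !ffunE signedD. Qed.

Lemma grade_scalar x : scalar_op x -> grade x = x.
Proof.
move=> ->; apply/ffunP => A; rewrite !ffunE.
by case: eqP => [->|_]; [rewrite cards0|exact: signed0].
Qed.

Lemma grade_unit J : grade (unit_op J) = opp (unit_op J).
Proof.
rewrite unit_opE /vec_op (additive_sum (h := grade) grade_plus).
rewrite (big_morph _ (@opp_plus _) (@opp_zero _)); apply: eq_bigr => i _.
apply/ffunP => A; rewrite !ffunE; case: eqP => [->|_]; first by rewrite cards1.
by rewrite signed0 opp_zero.
Qed.

(** If a + b J is invertible for one imaginary unit J then a^2 + b^2 is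
    invertible, being the product of a + b J and of its image under the grade
    involution; so a + b J' is invertible for every J', with an inverse whose
    coefficients do not depend on J'. *)
Lemma inverse_units a b J y : sphere J -> scalar_op a -> scalar_op b ->
  commutes a b -> is_inverse (plus a (mult b (unit_op J))) y ->
  exists p q, [/\ scalar_op p, scalar_op q & forall K, sphere K ->
    is_inverse (plus a (mult b (unit_op K))) (plus p (mult q (unit_op K)))].
Proof.
move=> SJ sa sb ab inv.
have inv' : is_inverse (plus a (opp (mult b (unit_op J)))) (grade y).
  have -> : plus a (opp (mult b (unit_op J))) = grade (plus a (mult b (unit_op J))).
    by rewrite grade_plus grade_mult grade_unit !grade_scalar // -opp_mult_r.
  have [h1 h2] := inv; split; rewrite -grade_mult ?h1 ?h2 grade_scalar //;
    exact: scalar_one.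
have prod K (SK : sphere K) : mult (plus a (mult b (unit_op K))) (plus a (opp (mult b (unit_op K))))
    = plus (mult a a) (mult b b).
  have aK := scalar_unit K sa; have bK := scalar_unit K sb.
  have sq : mult (mult b (unit_op K)) (mult b (unit_op K)) = opp (mult b b).
    rewrite mult_assoc -(mult_assoc b (unit_op K) b) -bK mult_assoc.
    by rewrite -(mult_assoc _ (unit_op K)) unit_op_sqr // -opp_mult_r mult_one_r.
  have c : mult (mult b (unit_op K)) a = mult a (mult b (unit_op K)).
    by apply: commutes_sym; apply: commutes_mult.
  rewrite mult_distr_r !mult_distr_l -!opp_mult_r sq c.
  by lin_eq.
have inv2 : is_inverse (plus (mult a a) (mult b b)) (mult (grade y) y).
  by rewrite -(prod J SJ); exact: inverse_mult.
have sn : scalar_op (plus (mult a a) (mult b b)) by apply: scalar_plus; exact: scalar_mult.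
have an : commutes a (plus (mult a a) (mult b b)) by apply: commutes_plus; exact: commutes_mult.
have bn : commutes b (plus (mult a a) (mult b b)).
  by apply: commutes_plus; apply: commutes_mult => //; exact: commutes_sym.
move: (plus (mult a a) (mult b b)) (mult (grade y) y) => n r in prod inv2 sn an bn *.
have sr : scalar_op r := scalar_inverse sn inv2.
have ar := commutes_inverse inv2 an; have br := commutes_inverse inv2 bn.
exists (mult a r), (opp (mult b r)).
split; [exact: scalar_mult|by apply: scalar_opp; exact: scalar_mult|move=> K SK].
have aK := scalar_unit K sa; have bK := scalar_unit K sb; have rK := scalar_unit K sr.
have -> : plus (mult a r) (mult (opp (mult b r)) (unit_op K)) =
    mult (plus a (opp (mult b (unit_op K)))) r.
  rewrite mult_distr_r -!opp_mult_l; congr plus; congr opp.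
  by rewrite -!mult_assoc rK.
have xr : commutes r (plus a (mult b (unit_op K))).
  by apply: commutes_plus => //; apply: commutes_mult.
have xr' : commutes r (plus a (opp (mult b (unit_op K)))).
  by apply: commutes_plus => //; apply: commutes_opp; apply: commutes_mult.
have [nr rn] := inv2.
have h1 : mult (plus a (mult b (unit_op K))) (mult (plus a (opp (mult b (unit_op K)))) r) = one.
  by rewrite mult_assoc prod.
have c1 : commutes (plus a (mult b (unit_op K))) (plus a (opp (mult b (unit_op K)))).
  have cba : commutes a (mult b (unit_op K)) by apply: commutes_mult.
  have c2 : commutes (plus a (mult b (unit_op K))) a.
    by apply: commutes_sym; apply: commutes_plus.
  have c3 : commutes (plus a (mult b (unit_op K))) (mult b (unit_op K)).
    by apply: commutes_sym; apply: commutes_plus => //; exact: commutes_sym.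
  by apply: commutes_plus => //; apply: commutes_opp.
split=> //; rewrite -[LHS](commutes_mult c1 (commutes_sym xr)).
exact: h1.
Qed.

End CliffordOps.
(** * Slice functions with values in the operators *)

Section SliceFunctions.

Variables (V : CompleteNormedModule R_AbsRing) (O : C -> Prop).
Implicit Types F G : ('I_5 -> R) -> C -> BV5 V.

Definition unit_mult (left : bool) (x y : BV5 V) := if left then mult y x else mult x y.

Lemma is_linear_unit_mult left y : is_linear (fun x => unit_mult left x y).
Proof.
case: left.
  exact: is_linear_bilinear_r (bilinear_mult V).
exact: is_linear_bilinear_l (bilinear_mult V).
Qed.

(** Slice hyperholomorphic functions of s = u + J v, in the coordinates (u, v):
    A + B J or A + J B, with Cauchy-Riemann equation F_v = F_u J or F_v = J F_u.
    The parity of A and B in v is not recorded: for a function of s it follows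
    from u + J v = u + (- J) (- v). *)
Definition slice_fun (left : bool) F :=
  (exists A B : C -> BV5 V, forall J z, sphere J -> O z ->
     F J z = plus (A z) (unit_mult left (B z) (unit_op V J))) /\
  (forall J z, sphere J -> O z ->
     exists d, has_diff (F J) z d (unit_mult left d (unit_op V J))).

Definition rslice := slice_fun false.
Definition lslice := slice_fun true.

(** The functions whose components act on the coefficients only; they can be
    multiplied with slice functions from the side of the imaginary unit. *)
Definition intrinsic F :=
  (exists a b : C -> BV5 V,
     (forall z, O z -> scalar_op (a z) /\ scalar_op (b z)) /\
     forall J z, sphere J -> O z -> F J z = plus (a z) (mult (b z) (unit_op V J))) /\
  (forall J z, sphere J -> O z ->
     exists d, has_diff (F J) z d (mult d (unit_op V J)) /\ commutes d (unit_op V J)).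

Lemma intrinsic_commutes F J z : intrinsic F -> sphere J -> O z ->
  commutes (F J z) (unit_op V J).
Proof.
move=> [[a [b [ab FE]]] _] SJ Oz; have [sa sb] := ab z Oz; rewrite FE //.
apply: commutes_sym; apply: commutes_plus; first exact: commutes_sym (scalar_unit J sa).
apply: commutes_mult; first exact: commutes_sym (scalar_unit J sb).
exact: commutes_refl.
Qed.

Lemma intrinsic_slice left F : intrinsic F -> slice_fun left F.
Proof.
move=> [[a [b [ab FE]]] dF]; split.
  exists a, b => J z SJ Oz; rewrite FE //; congr plus.
  by case: left => //=; exact: (scalar_unit J (proj2 (ab z Oz))).
move=> J z SJ Oz; have [d [hd c]] := dF J z SJ Oz; exists d.
by case: left => //=; rewrite -c.
Qed.

Lemma product_rule F G J z d1 e1 d2 e2 :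
  has_diff (F J) z d1 e1 -> has_diff (G J) z d2 e2 ->
  has_diff (fun w => mult (F J w) (G J w)) z
    (plus (mult d1 (G J z)) (mult (F J z) d2))
    (plus (mult e1 (G J z)) (mult (F J z) e2)).
Proof. exact: (has_diff_bilinear (bilinear_mult V)). Qed.

Lemma slice_product (A B a b : BV5 V) J : sphere J -> scalar_op a -> scalar_op b ->
  mult (plus A (mult B (unit_op V J))) (plus a (mult b (unit_op V J)))
  = plus (minus (mult A a) (mult B b))
         (mult (plus (mult A b) (mult B a)) (unit_op V J)).
Proof.
move=> SJ sa sb; have aJ := scalar_unit J sa; have bJ := scalar_unit J sb.
rewrite !mult_distr_l !mult_distr_r.
rewrite (mult_assoc (mult B _)) -(mult_assoc B _ b) -bJ.
rewrite (mult_assoc B) -(mult_assoc _ (unit_op V J) (unit_op V J)) unit_op_sqr //.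
rewrite -opp_mult_r mult_one_r -(mult_assoc B _ a) -aJ !mult_assoc.
by lin_eq.
Qed.

Lemma rslice_mult F G : rslice F -> intrinsic G ->
  rslice (fun J z => mult (F J z) (G J z)).
Proof.
move=> [[A [B FE]] dF] iG; have [[a [b [ab GE]]] dG] := iG; split.
  exists (fun z => minus (mult (A z) (a z)) (mult (B z) (b z))),
         (fun z => plus (mult (A z) (b z)) (mult (B z) (a z))) => J z SJ Oz.
  by have [sa sb] := ab z Oz; rewrite FE // GE //; exact: slice_product.
move=> J z SJ Oz; have [d1 h1] := dF J z SJ Oz; have [d2 [h2 c2]] := dG J z SJ Oz.
have cG := intrinsic_commutes iG SJ Oz.
exists (plus (mult d1 (G J z)) (mult (F J z) d2)).
apply: has_diff_eq (product_rule h1 h2) _ _ => //.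
by rewrite /= mult_distr_r -!mult_assoc cG.
Qed.

Lemma lslice_mult F G : intrinsic F -> lslice G ->
  lslice (fun J z => mult (F J z) (G J z)).
Proof.
move=> iF [[A [B GE]] dG]; have [[a [b [ab FE]]] dF] := iF; split.
  exists (fun z => minus (mult (a z) (A z)) (mult (b z) (B z))),
         (fun z => plus (mult (a z) (B z)) (mult (b z) (A z))) => J z SJ Oz.
  have [sa sb] := ab z Oz; have aJ := scalar_unit J sa; have bJ := scalar_unit J sb.
  rewrite GE // FE //= !mult_distr_l !mult_distr_r.
  rewrite (mult_assoc (mult (b z) _)) -(mult_assoc (b z) (unit_op V J) (unit_op V J)) unit_op_sqr //.
  rewrite -opp_mult_r mult_one_r -opp_mult_l !mult_assoc -aJ -bJ.
  by lin_eq.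
move=> J z SJ Oz; have [d1 [h1 c1]] := dF J z SJ Oz; have [d2 h2] := dG J z SJ Oz.
have cF := intrinsic_commutes iF SJ Oz.
exists (plus (mult d1 (G J z)) (mult (F J z) d2)).
apply: has_diff_eq (product_rule h1 h2) _ _ => //.
by rewrite /= mult_distr_l !mult_assoc cF c1.
Qed.

Lemma intrinsic_mult F G : intrinsic F -> intrinsic G ->
  intrinsic (fun J z => mult (F J z) (G J z)).
Proof.
move=> iF iG; have [[a [b [ab FE]]] dF] := iF; have [[a' [b' [ab' GE]]] dG] := iG; split.
  exists (fun z => minus (mult (a z) (a' z)) (mult (b z) (b' z))),
         (fun z => plus (mult (a z) (b' z)) (mult (b z) (a' z))); split.
    move=> z Oz; have [sa sb] := ab z Oz; have [sa' sb'] := ab' z Oz.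
    split; apply: scalar_plus; try apply: scalar_opp; exact: scalar_mult.
  move=> J z SJ Oz; have [sa sb] := ab' z Oz.
  by rewrite FE // GE //; exact: slice_product.
move=> J z SJ Oz; have [d1 [h1 c1]] := dF J z SJ Oz; have [d2 [h2 c2]] := dG J z SJ Oz.
have cF := intrinsic_commutes iF SJ Oz; have cG := intrinsic_commutes iG SJ Oz.
exists (plus (mult d1 (G J z)) (mult (F J z) d2)); split.
  apply: has_diff_eq (product_rule h1 h2) _ _ => //.
  by rewrite mult_distr_r -!mult_assoc cG c2.
by apply: commutes_sym; apply: commutes_plus; apply: commutes_mult; exact: commutes_sym.
Qed.

Lemma slice_plus left F G : slice_fun left F -> slice_fun left G ->
  slice_fun left (fun J z => plus (F J z) (G J z)).
Proof.
move=> [[A [B FE]] dF] [[A' [B' GE]] dG]; split.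
  exists (fun z => plus (A z) (A' z)), (fun z => plus (B z) (B' z)) => J z SJ Oz.
  by rewrite FE // GE // (linear_plus _ (is_linear_unit_mult left _)); lin_eq.
move=> J z SJ Oz; have [d1 h1] := dF J z SJ Oz; have [d2 h2] := dG J z SJ Oz.
exists (plus d1 d2); apply: has_diff_eq (has_diff_plus h1 h2) _ _ => //.
by rewrite (linear_plus _ (is_linear_unit_mult left _)).
Qed.

Lemma slice_scal left (k : R) F : slice_fun left F ->
  slice_fun left (fun J z => scal k (F J z)).
Proof.
move=> [[A [B FE]] dF]; split.
  exists (fun z => scal k (A z)), (fun z => scal k (B z)) => J z SJ Oz.
  by rewrite FE // (linear_scal _ (is_linear_unit_mult left _)) (scal_distr_l (K := R_Ring)).
move=> J z SJ Oz; have [d h] := dF J z SJ Oz; exists (scal k d).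
rewrite (linear_scal _ (is_linear_unit_mult left _)).
exact: has_diff_linear (is_linear_scal_r k Rmult_comm) h.
Qed.

Lemma intrinsic_plus F G : intrinsic F -> intrinsic G ->
  intrinsic (fun J z => plus (F J z) (G J z)).
Proof.
move=> [[a [b [ab FE]]] dF] [[a' [b' [ab' GE]]] dG]; split.
  exists (fun z => plus (a z) (a' z)), (fun z => plus (b z) (b' z)); split.
    move=> z Oz; have [? ?] := ab z Oz; have [? ?] := ab' z Oz.
    by split; exact: scalar_plus.
  by move=> J z SJ Oz; rewrite FE // GE // mult_distr_r; lin_eq.
move=> J z SJ Oz; have [d1 [h1 c1]] := dF J z SJ Oz; have [d2 [h2 c2]] := dG J z SJ Oz.
exists (plus d1 d2); split.
  by apply: has_diff_eq (has_diff_plus h1 h2) _ _ => //; rewrite mult_distr_r.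
by apply: commutes_sym; apply: commutes_plus; exact: commutes_sym.
Qed.

Lemma slice_const left (c : BV5 V) : slice_fun left (fun _ _ => c).
Proof.
have m0 J : unit_mult left zero (unit_op V J) = zero.
  exact: (additive0 (linear_plus _ (is_linear_unit_mult left _))).
split=> [|J z _ _].
  by exists (fun _ => c), (fun _ => zero) => J z _ _; rewrite m0 plus_zero_r.
by exists zero; rewrite m0; exact: has_diff_const.
Qed.

Lemma intrinsic_const (c : BV5 V) : scalar_op c -> intrinsic (fun _ _ => c).
Proof.
move=> sc; split=> [|J z _ _].
  exists (fun _ => c), (fun _ => zero); split=> [z _|J z _ _].
    by split=> //; exact: scalar_zero.
  by rewrite mult_zero_l plus_zero_r.
exists zero; rewrite mult_zero_l; split; first exact: has_diff_const.
by apply: commutes_sym; exact: commutes_zero.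
Qed.

Lemma intrinsic_pow F n : intrinsic F -> intrinsic (fun J z => pow_n (F J z) n).
Proof.
move=> iF; elim: n => [|n IH] /=; first by apply: intrinsic_const; exact: scalar_one.
exact: intrinsic_mult.
Qed.

Lemma has_diff_para J z :
  has_diff (fun w => para_op V (slice_pt J w)) z (one : BV5 V) (unit_op V J).
Proof.
move=> eps e0; apply: filter_forall => w; rewrite !para_op_slice.
have -> : minus (minus (plus (scal w.1 (one : BV5 V)) (scal w.2 (unit_op V J)))
                       (plus (scal z.1 (one : BV5 V)) (scal z.2 (unit_op V J))))
   (plus (scal (w.1 - z.1) (one : BV5 V)) (scal (w.2 - z.2) (unit_op V J))) = zero.
  by lin_eq.
rewrite norm_zero; apply: Rmult_le_pos; first lra.
by apply: Rplus_le_le_0_compat; exact: Rabs_pos.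
Qed.

Lemma intrinsic_para : intrinsic (fun J z => para_op V (slice_pt J z)).
Proof.
split=> [|J z SJ Oz].
  exists (fun z : C => scal z.1 (one : BV5 V)), (fun z : C => scal z.2 (one : BV5 V)); split=> [z _|J z _ _].
    by split; apply: scalar_scal; exact: scalar_one.
  by rewrite para_op_slice scal_multl mult_one_l.
exists one; rewrite mult_one_l; split; first exact: has_diff_para.
by apply: commutes_sym; exact: commutes_one.
Qed.

Lemma intrinsic_paraB (c : BV5 V) : scalar_op c ->
  intrinsic (fun J z => minus (para_op V (slice_pt J z)) c).
Proof.
by move=> sc; apply: (intrinsic_plus intrinsic_para); apply: intrinsic_const; exact: scalar_opp.
Qed.

Lemma slice_paraB left (c : BV5 V) :
  slice_fun left (fun J z => minus (para_op V (slice_pt J z)) c).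
Proof.
by apply: (slice_plus (intrinsic_slice left intrinsic_para)); exact: slice_const.
Qed.

End SliceFunctions.

Lemma slice_fun_sub (V : CompleteNormedModule R_AbsRing) (O O' : C -> Prop) left
    (F : ('I_5 -> R) -> C -> BV5 V) :
  (forall z, O' z -> O z) -> slice_fun O left F -> slice_fun O' left F.
Proof.
move=> OO [[A [B FE]] dF]; split.
  by exists A, B => J z SJ /OO; exact: FE.
by move=> J z SJ /OO; exact: dF.
Qed.

(** * The resolvent operators *)

Section Resolvent.

Variables (V : CompleteNormedModule R_AbsRing) (T : BV5 V).
Hypothesis hT : BC01 T.

Lemma para_set0 (t0 : bop V) t : (para t0 t) set0 = t0.
Proof.
rewrite /para plus_component ffunE eqxx.
have -> : (\big[plus/zero]_(i : 'I_5) cmono [set i] (t i)) set0 = zero; last exact: plus_zero_r.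
have := big_morph (fun x : clifford (bop V) => x set0)
  (fun x y => plus_component x y set0) (ffunE _ _).
move=> ->; apply: big1 => i _; rewrite ffunE; case: eqP => // /setP/(_ i).
by rewrite !inE eqxx.
Qed.

Lemma para_set1 (t0 : bop V) t k : (para t0 t) [set k] = t k.
Proof.
rewrite /para plus_component ffunE ifF ?plus_zero_l; last first.
  by apply/eqP => /setP/(_ k); rewrite !inE eqxx.
have := big_morph (fun x : clifford (bop V) => x [set k])
  (fun x y => plus_component x y [set k]) (ffunE _ _).
move=> ->; rewrite (bigD1 k) //= ffunE eqxx big1 ?plus_zero_r // => i nik.
by rewrite ffunE; case: eqP => // /set1_inj eik; rewrite eik eqxx in nik.
Qed.

Lemma scalar_T0 : scalar_op (op_T0 T).
Proof. exact: scalar_cmono. Qed.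

Lemma op_conj_sum : plus T (op_conj T) = scal 2 (op_T0 T).
Proof.
case: hT => t0 [t [-> _ _]]; rewrite /op_conj para_set0.
have -> : (fun k => opp (para t0 t [set k])) = (fun k => opp (t k)).
  by apply: functional_extensionality => k; rewrite para_set1.
rewrite /op_T0 para_set0 /para.
have -> : \big[plus/zero]_(i : 'I_5) cmono [set i] (opp (t i))
    = opp (\big[plus/zero]_(i : 'I_5) cmono [set i] (t i)) :> BV5 V.
  rewrite (big_morph _ (@opp_plus _) (@opp_zero _)).
  by apply: eq_bigr => i _; rewrite cmono_opp.
by lin_eq.
Qed.

(** T conj T = T_0^2 - v^2 for the vector part v of T, which commutes with
    T_0 and has a scalar square. *)
Lemma op_conj_prod : scalar_op (mult T (op_conj T)) /\
  commutes (op_T0 T) (mult T (op_conj T)).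
Proof.
case: hT => t0 [t [-> t0C tC]]; rewrite /op_conj para_set0.
have -> : (fun k => opp (para t0 t [set k])) = (fun k => opp (t k)).
  by apply: functional_extensionality => k; rewrite para_set1.
rewrite /op_T0 para_set0 /para.
have -> : \big[plus/zero]_(i : 'I_5) cmono [set i] (opp (t i)) = opp (vec_op t).
  rewrite /vec_op (big_morph _ (@opp_plus _) (@opp_zero _)).
  by apply: eq_bigr => i _; rewrite cmono_opp.
rewrite -/(vec_op t); set c := cmono set0 t0.
have cv : commutes c (vec_op t).
  apply/ffunP => A; rewrite cmono0_mult mult_cmono0 /vec_op.
  have comp := big_morph (fun x : clifford (bop V) => x A)
    (fun x y => plus_component x y A) (ffunE _ _).
  rewrite comp (big_morph _ (mult_distr_l t0) (mult_zero_r t0)).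
  rewrite (big_morph (fun s => mult s t0) (fun u v => mult_distr_r u v t0) (mult_zero_l t0)).
  apply: eq_bigr => i _; rewrite ffunE; case: eqP => _; first exact: t0C.
  by rewrite mult_zero_l mult_zero_r.
have -> : mult (plus c (vec_op t)) (plus c (opp (vec_op t)))
    = plus (mult c c) (opp (mult (vec_op t) (vec_op t))).
  rewrite mult_distr_r !mult_distr_l -!opp_mult_r cv; lin_eq.
split.
  rewrite vec_op_sqr //; apply: scalar_plus; first by apply: scalar_mult; exact: scalar_cmono.
  by apply: scalar_opp; exact: scalar_cmono.
apply: commutes_plus; first by apply: commutes_mult; exact: commutes_refl.
by apply: commutes_opp; apply: commutes_mult.
Qed.

Definition Qa (z : C) : BV5 V :=
  plus (scal (z.1 ^ 2 - z.2 ^ 2) (one : BV5 V))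
       (plus (scal (- 2 * z.1) (op_T0 T)) (mult T (op_conj T))).
Definition Qb (z : C) : BV5 V :=
  plus (scal (2 * z.1 * z.2) (one : BV5 V)) (scal (- 2 * z.2) (op_T0 T)).

Lemma Qcs_slice J z : sphere J ->
  Qcs (slice_pt J z) T = plus (Qa z) (mult (Qb z) (unit_op V J)).
Proof.
move=> SJ; rewrite /Qcs op_conj_sum para_op_slice /= mult_one_r.
have h := scalar_unit J scalar_T0; rewrite /commutes in h.
rewrite /Qa /Qb; move: (mult T (op_conj T)) => N.
rewrite !mult_distr_l !mult_distr_r !scal_multl !scal_multr ?scal_multl unit_op_sqr //.
rewrite !mult_one_l !mult_one_r -h.
by lin_eq.
Qed.

Lemma scalar_Qa z : scalar_op (Qa z).
Proof.
have s1 := scalar_one V; have sT := scalar_T0; have [sN _] := op_conj_prod.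
by apply: scalar_plus; [|apply: scalar_plus => //]; apply: scalar_scal.
Qed.

Lemma scalar_Qb z : scalar_op (Qb z).
Proof.
have s1 := scalar_one V; have sT := scalar_T0.
by apply: scalar_plus; apply: scalar_scal.
Qed.

Lemma commutes_Qab z : commutes (Qa z) (Qb z).
Proof.
have [_ cN] := op_conj_prod.
apply: commutes_plus; apply: commutes_scal; first exact: commutes_one.
apply: commutes_sym; apply: commutes_plus; first exact: commutes_scal (commutes_one _).
by apply: commutes_plus => //; apply: commutes_scal; exact: commutes_refl.
Qed.

(** The points z = (u, v) for which u + J v lies in the resolvent set; by
    inverse_units it is enough that this holds for one J. *)
Definition resolvent_region (z : C) :=
  forall J, sphere J -> exists Y, is_inverse (Qcs (slice_pt J z) T) Y.

Lemma resolvent_region_of J z : sphere J -> ~ S_spectrum T (slice_pt J z) ->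
  resolvent_region z.
Proof.
move=> SJ /NNPP [Y]; rewrite Qcs_slice // => inv.
have [p [q [_ _ hpq]]] := inverse_units SJ (scalar_Qa z) (scalar_Qb z) (commutes_Qab z) inv.
by move=> K SK; rewrite Qcs_slice //; eexists; exact: hpq.
Qed.

Definition Qinv J z : BV5 V := op_inv (Qcs (slice_pt J z) T).

Lemma has_diff_Qcs J z : sphere J -> exists d,
  has_diff (fun w => Qcs (slice_pt J w) T) z d (mult d (unit_op V J)) /\
  commutes d (unit_op V J).
Proof.
move=> SJ; pose x w := para_op V (slice_pt J w); set j := unit_op V J.
pose c := scal 2 (op_T0 T); have dx := @has_diff_para V J z.
have bl := bilinear_mult V.
have d := has_diff_plus (has_diff_plus (has_diff_bilinear bl dx dx)
  (has_diff_linear (is_linear_opp' _) (has_diff_bilinear bl dx (has_diff_const c z))))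
  (has_diff_const (mult T (op_conj T)) z).
have cj : mult c j = mult j c.
  by rewrite /c scal_multl scal_multr (scalar_unit J scalar_T0).
have xj : mult (x z) j = mult j (x z).
  by rewrite /x para_op_slice mult_distr_l mult_distr_r scal_multl scal_multr mult_one_l mult_one_r scal_multl scal_multr.
exists (minus (scal 2 (x z)) c); split.
  apply: has_diff_ext (has_diff_eq d _ _).
  - by apply: filter_forall => w; rewrite /Qcs op_conj_sum /= mult_one_r.
  - by rewrite mult_one_l mult_one_r mult_zero_r mult_one_l /x; lin_eq.
  - rewrite -/(x z) -/j /minus mult_distr_r scal_multl -opp_mult_l mult_zero_r -cj -xj.
    by lin_eq.
apply: commutes_sym; apply: commutes_plus; first by apply: commutes_scal; exact: esym.
by apply: commutes_opp; exact: esym.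
Qed.

(** The components of Q^-1 do not depend on J by inverse_units; the derivative
    is - Q^-1 Q' Q^-1 with Q' = 2 (s - T_0), which commutes with J. *)
Lemma intrinsic_Qinv : intrinsic resolvent_region Qinv.
Proof.
have pq z : exists pq : BV5 V * BV5 V, resolvent_region z ->
    [/\ scalar_op pq.1, scalar_op pq.2 & forall J, sphere J ->
        Qinv J z = plus pq.1 (mult pq.2 (unit_op V J))].
  case: (classic (resolvent_region z /\ exists J, sphere J)) => [[Oz [J SJ]]|no].
    have [Y] := Oz J SJ; rewrite Qcs_slice // => inv.
    have [p [q [sp sq hpq]]] :=
      inverse_units SJ (scalar_Qa z) (scalar_Qb z) (commutes_Qab z) inv.
    exists (p, q) => _; split=> // K SK.
    apply: (inverse_unique (op_invP (Oz K SK))).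
    by rewrite Qcs_slice //; exact: hpq.
  exists (zero, zero) => Oz; split; try exact: scalar_zero.
  by move=> J SJ; case: no; split=> //; exists J.
pose f z := proj1_sig (constructive_indefinite_description _ (pq z)).
have fP z := proj2_sig (constructive_indefinite_description _ (pq z)).
split.
  exists (fun z => (f z).1), (fun z => (f z).2); split=> [z Oz|J z SJ Oz].
    by have [] := fP z Oz.
  by have [_ _] := fP z Oz; apply.
move=> J z SJ Oz; have [d [hd cd]] := has_diff_Qcs z SJ.
have inv := op_invP (Oz J SJ); rewrite -/(Qinv J z) in inv.
have near : locally z (fun w => is_inverse (Qcs (slice_pt J w) T) (Qinv J w)).
  apply: filter_imp (locally_inverse (has_diff_continuous hd) inv) => w.
  exact: op_invP.
have [BNl BNr] := bilinearN (bilinear_mult V).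
have dQ := has_diff_inverse (y := Qinv J) (bilinear_mult V) hd.
have {}dQ := dQ _.
exists (opp (mult (mult (Qinv J z) d) (Qinv J z))).
have cQ : commutes (unit_op V J) (Qinv J z).
  apply: (commutes_inverse inv); rewrite Qcs_slice //.
  apply: commutes_plus; first by apply: commutes_sym; exact: scalar_unit (scalar_Qa z).
  apply: commutes_mult; last exact: commutes_refl.
  by apply: commutes_sym; exact: scalar_unit (scalar_Qb z).
have cdJ := commutes_sym cd.
split; last first.
  by apply: commutes_sym; apply: commutes_opp; repeat apply: commutes_mult.
apply: has_diff_eq (dQ _) _ _ => //.
- apply: filter_imp near => w inv'.
  have [h1 h2] := inv; have [h3 h4] := inv'.
  rewrite /minus mult_distr_l BNr h4 mult_distr_r mult_one_l BNl -mult_assoc h1 mult_one_r.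
  by lin_eq.
- rewrite -opp_mult_l; congr opp; rewrite -!mult_assoc; congr mult.
  by rewrite cQ.
Qed.

Lemma rslice_resolvent P :
  rslice resolvent_region (fun J z => resolvent_L P (slice_pt J z) T).
Proof.
have iQ := intrinsic_Qinv; have iQn n := intrinsic_pow n iQ.
have iT := intrinsic_paraB resolvent_region scalar_T0.
have rx (c : BV5 V) := slice_paraB resolvent_region false c.
case: P.
- exact: (slice_scal (-4) (intrinsic_slice _ iQ)).
- exact: (slice_scal 16 (intrinsic_slice _ (iQn 2%N))).
- exact: (slice_scal (-8) (rslice_mult (rx (op_conj T)) (iQn 2%N))).
- exact: (slice_plus (slice_scal 4 (rslice_mult (rslice_mult (rx (op_conj T)) (iQn 2%N)) iT))
           (slice_scal 2 (intrinsic_slice _ iQ))).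
- exact: (slice_scal 32 (rslice_mult (rslice_mult (rx (op_conj T)) (iQn 3%N)) (intrinsic_pow 2 iT))).
- exact: (slice_scal (-64) (rslice_mult (rslice_mult (rx (op_conj T)) (iQn 3%N)) iT)).
- exact: (slice_scal (-8) (rslice_mult (rx T) (iQn 2%N))).
Qed.

Lemma lslice_resolvent P :
  lslice resolvent_region (fun J z => resolvent_R P (slice_pt J z) T).
Proof.
have iQ := intrinsic_Qinv; have iQn n := intrinsic_pow n iQ.
have iT := intrinsic_paraB resolvent_region scalar_T0.
have lx (c : BV5 V) := slice_paraB resolvent_region true c.
case: P.
- exact: (slice_scal (-4) (intrinsic_slice _ iQ)).
- exact: (slice_scal 16 (intrinsic_slice _ (iQn 2%N))).
- exact: (slice_scal (-8) (lslice_mult (iQn 2%N) (lx (op_conj T)))).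
- exact: (slice_plus (slice_scal 4 (lslice_mult (intrinsic_mult iT (iQn 2%N)) (lx (op_conj T))))
           (slice_scal 2 (intrinsic_slice _ iQ))).
- exact: (slice_scal 32 (lslice_mult (intrinsic_mult (intrinsic_pow 2 iT) (iQn 3%N)) (lx (op_conj T)))).
- exact: (slice_scal (-64) (lslice_mult (intrinsic_mult iT (iQn 3%N)) (lx (op_conj T)))).
- exact: (slice_scal (-8) (lslice_mult (iQn 2%N) (lx T))).
Qed.

End Resolvent.
(** * Slice hyperholomorphic functions as functions on the plane *)

Lemma is_derive_unique_norm (X : NormedModule R_AbsRing) (f : R -> X) u (a b : X) :
  is_derive f u a ->
  (forall eps, 0 < eps -> locally u (fun x : R =>
     norm (minus (minus (f x) (f u)) (scal (x - u) b)) <= eps * Rabs (x - u))) ->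
  a = b.
Proof.
move=> [_ da] db; apply: eq_minus_r; apply: vec_eq0_of_small => eps e0.
have e2 : 0 < eps / 2 by lra.
have := da u (fun P hP => hP) (mkposreal _ e2) => {}da.
have [d d0 hd] := locally_interval (filter_and _ _ da (db _ e2)).
have [|/= h1 h2] := hd (u + d / 2); first by rewrite Rabs_pos_eq; lra.
change (norm (minus (minus (f (u + d / 2)) (f u)) (scal (u + d / 2 - u) a))
  <= eps / 2 * Rabs (u + d / 2 - u)) in h1.
have e : u + d / 2 - u = d / 2 by ring.
rewrite e Rabs_pos_eq in h1; last lra.
rewrite e Rabs_pos_eq in h2; last lra.
have -> : minus a b = scal (2 / d)
   (plus (minus (minus (f (u + d / 2)) (f u)) (scal (d / 2) b))
         (opp (minus (minus (f (u + d / 2)) (f u)) (scal (d / 2) a)))).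
  by lin_eq; field; lra.
apply: Rle_trans (norm_scal_le _ _) _.
rewrite -norm_opp in h1.
have h := norm_plus_le h2 h1.
have p : 0 <= Rabs (2 / d) by exact: Rabs_pos.
apply: Rle_trans (Rmult_le_compat_l _ _ _ p h) _.
rewrite Rabs_pos_eq; last by left; apply: Rdiv_lt_0_compat; lra.
by apply: Req_le; field; lra.
Qed.

(** By uniqueness of derivatives, a and b are the values of the differential on
    the basis vectors. *)
Lemma has_diff_of_filterdiff (X : NormedModule R_AbsRing) (f : R -> R -> X) u v a b :
  ex_filterdiff (fun p : R * R => f p.1 p.2) (locally (u, v)) ->
  is_derive (fun x => f x v) u a -> is_derive (fun y => f u y) v b ->
  has_diff (fun p : C => f p.1 p.2) (u, v) a b.
Proof.
move=> [l [[lD lS _] dl]] da db.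
have h : has_diff (fun p : C => f p.1 p.2) (u, v) (l (1, 0)) (l (0, 1)).
  move=> eps e0; have := dl (u, v) (fun P hP => hP) (mkposreal _ e0).
  apply: filter_imp => q /= hq.
  have lE : l (minus q (u, v)) =
      plus (scal (q.1 - u) (l (1, 0))) (scal (q.2 - v) (l (0, 1))).
    by rewrite -!lS -lD; congr l; complex_ring.
  rewrite lE in hq; apply: Rle_trans hq _; apply: Rmult_le_compat_l; first lra.
  change (sqrt (Rabs (q.1 - u) ^ 2 + Rabs (q.2 - v) ^ 2)
    <= Rabs (q.1 - u) + Rabs (q.2 - v)).
  have p1 := Rabs_pos (q.1 - u); have p2 := Rabs_pos (q.2 - v).
  have p12 := Rmult_le_pos _ _ p1 p2.
  apply: Rsqr_incr_0_var; last lra.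
  by rewrite Rsqr_sqrt /Rsqr; nra.
have ea : a = l (1, 0).
  apply: (is_derive_unique_norm da) => eps e0.
  have [d d0 hd] := locally_box (h eps e0).
  exists (mkposreal _ d0) => x hx.
  move: (hd x v hx); rewrite Rminus_diag Rabs_R0 => /(_ d0) /=.
  by rewrite Rplus_0_r (scal_zero_l (K := R_Ring)) plus_zero_r.
have eb : b = l (0, 1).
  apply: (is_derive_unique_norm db) => eps e0.
  have [d d0 hd] := locally_box (h eps e0).
  exists (mkposreal _ d0) => y hy.
  move: (hd u y); rewrite Rminus_diag Rabs_R0 => /(_ d0 hy) /=.
  by rewrite Rplus_0_l (scal_zero_l (K := R_Ring)) plus_zero_l.
by rewrite ea eb.
Qed.

Lemma sphere_coord J i : sphere J -> Rabs (J i) <= 1.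
Proof.
move=> SJ; have p : 0 <= \big[Rplus/0]_(k : 'I_5 | k != i) (J k) ^ 2.
  by apply: (big_ind (Rle 0)) => [|u v|k _]; [lra|lra|exact: pow2_ge_0].
have sq : (J i) ^ 2 <= 1.
  rewrite -(sphere_sum SJ) (bigD1 i) //= -[X in X <= _]Rplus_0_r.
  exact: Rplus_le_compat_l.
by apply: Rabs_le; nra.
Qed.

Lemma locally_slice J z (P : paravector -> Prop) : sphere J ->
  locally (slice_pt J z) P -> locally z (fun w => P (slice_pt J w)).
Proof.
move=> SJ [d hd]; exists d => w [h1 h2]; apply: hd; split=> //= i.
move: h2; rewrite /ball /= /AbsRing_ball /= /abs /minus /plus /opp /= => h2.
have -> : w.2 * J i + - (z.2 * J i) = (w.2 + - z.2) * J i by ring.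
rewrite Rabs_mult; apply: Rle_lt_trans h2; rewrite -[X in _ <= X]Rmult_1_r.
by apply: Rmult_le_compat_l; [exact: Rabs_pos|exact: sphere_coord].
Qed.

Definition slice_region (D : paravector -> Prop) (z : C) :=
  forall J, sphere J -> D (slice_pt J z).

Lemma slice_region_of D J z : axially_symmetric D -> sphere J ->
  D (slice_pt J z) -> slice_region D z.
Proof. by case: z => u v symD SJ Dz; apply: symD; exists J. Qed.

Section Hyperholomorphic.

Variables (V : CompleteNormedModule R_AbsRing) (D : paravector -> Prop) (f : paravector -> R5).

Lemma slice_CR_diff (al be : R -> R -> R5) z J : slice_CR D al be -> sphere J ->
  D (slice_pt J z) -> exists a b : BV5 V,
  has_diff (fun w : C => cliff_op V (al w.1 w.2)) z a b /\
  has_diff (fun w : C => cliff_op V (be w.1 w.2)) z (opp b) a.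
Proof.
case: z => u v cr SJ Dz.
have [|_ _ dal dbe [a [b [h1 h2 h3 h4]]]] := cr u v; first by exists J.
exists (cliff_op V a), (cliff_op V b); split.
  exact: has_diff_linear (is_linear_cliff_op V) (has_diff_of_filterdiff dal h1 h3).
rewrite -cliff_op_opp.
exact: has_diff_linear (is_linear_cliff_op V) (has_diff_of_filterdiff dbe h4 h2).
Qed.

Lemma slice_fun_CR left (al be : R -> R -> R5) : open D -> slice_CR D al be ->
  (forall J z, sphere J -> D (slice_pt J z) -> cliff_op V (f (slice_pt J z))
     = plus (cliff_op V (al z.1 z.2)) (unit_mult left (cliff_op V (be z.1 z.2)) (unit_op V J))) ->
  slice_fun (slice_region D) left (fun J z => cliff_op V (f (slice_pt J z))).
Proof.
move=> oD cr fE; split.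
  by exists (fun z => cliff_op V (al z.1 z.2)), (fun z => cliff_op V (be z.1 z.2)) => J z SJ Oz;
    apply: fE => //; exact: Oz.
move=> J z SJ Oz; have Dz := Oz J SJ; have [a [b [hA hB]]] := slice_CR_diff cr SJ Dz.
have lJ := is_linear_unit_mult left (unit_op V J).
exists (plus a (unit_mult left (opp b) (unit_op V J))).
apply: has_diff_ext (has_diff_eq (has_diff_plus hA (has_diff_linear lJ hB)) (erefl _) _).
- by apply: filter_imp (locally_slice SJ (oD _ Dz)) => w Dw; rewrite fE.
- rewrite (linear_plus _ lJ) plus_comm; congr plus; case: (left) => /=.
    by rewrite mult_assoc unit_op_sqr // -opp_mult_l mult_one_l opp_opp.
  by rewrite -mult_assoc unit_op_sqr // -opp_mult_r mult_one_r opp_opp.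
Qed.

Lemma lslice_hyperholomorphic : slice_hyperholomorphic_L D f ->
  lslice (slice_region D) (fun J z => cliff_op V (f (slice_pt J z))).
Proof.
move=> [oD sD [[al be] /= cr fE]]; apply: (slice_fun_CR oD cr) => J [u v] SJ Dz.
by rewrite fE // cliff_op_plus cliff_op_mult.
Qed.

Lemma rslice_hyperholomorphic : slice_hyperholomorphic_R D f ->
  rslice (slice_region D) (fun J z => cliff_op V (f (slice_pt J z))).
Proof.
move=> [oD sD [[al be] /= cr fE]]; apply: (slice_fun_CR oD cr) => J [u v] SJ Dz.
by rewrite fE // cliff_op_plus cliff_op_mult.
Qed.

End Hyperholomorphic.

(** * Curves as chains of arcs *)

Lemma velocityE (g h : R -> C) (dh : C) t :
  locally t (fun s => g s = h s) ->
  is_derive (V := C_R_NormedModule) h t dh -> velocity g t = dh.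
Proof.
move=> gh dht.
have d1 : is_derive (fun s => fst (h s)) t dh.1.
  exact: (filterdiff_comp' h fst t _ _ dht (filterdiff_linear _ is_linear_fst)).
have d2 : is_derive (fun s => snd (h s)) t dh.2.
  exact: (filterdiff_comp' h snd t _ _ dht (filterdiff_linear _ is_linear_snd)).
rewrite /velocity; case: dh d1 d2 {dht} => a b /= d1 d2; congr pair.
  rewrite (Derive_ext_loc _ (fun s => fst (h s))); first exact: is_derive_unique.
  by apply: filter_imp gh => s ->.
rewrite (Derive_ext_loc _ (fun s => snd (h s))); first exact: is_derive_unique.
by apply: filter_imp gh => s ->.
Qed.

(** Integration along the curve g from 0 to b is integration along the chain L;
    the values of the velocity at the corners do not matter. *)
Definition represents (g : R -> C) (b : R) (L : seq arc) :=
  [/\ forall A, List.In A L -> continuous_arc A,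
      forall A, List.In A L -> forall t, lo A <= t <= hi A -> 0 <= t <= b /\ pos A t = g t
    & forall (X : CompleteNormedModule R_AbsRing) (psi : C -> C -> X),
        (forall A, List.In A L -> forall t, lo A <= t <= hi A ->
           continuous (fun t => psi (pos A t) (vel A t)) t) ->
        is_RInt (fun t => psi (g t) (velocity g t)) 0 b (chain_int L psi)].

Lemma piecewise_C1_chain g : piecewise_C1 g -> exists L, represents g 1 L.
Proof.
move=> [m [tau [tau0 taum hC]]].
suff h k : (k <= m)%N -> 0 <= tau k /\ exists L, represents g (tau k) L.
  by have [_] := h m (leqnn m); rewrite taum.
elim: k => [_|k IH ltkm].
  split; first by rewrite tau0; lra.
  exists [::]; split=> // X psi _; rewrite tau0 /chain_int big_nil; exact: is_RInt_point.
have [|tk [L [cL Lg Lint]]] := IH; first exact: ltnW.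
have [lt [h [dh [gh dhh cdh]]]] := hC k ltkm.
have hder t : is_derive (V := C_R_NormedModule) h t (dh t) := dhh t.
have ch t : continuous h t.
  by apply: (ex_derive_continuous (V := C_R_NormedModule)); exists (dh t).
split; first lra.
pose A0 := Arc (tau k) (tau k.+1) h dh.
have cA0 : continuous_arc A0 by split=> /=; [lra|move=> t _; split].
exists (rcons L A0).
have inL A : List.In A (rcons L A0) <-> List.In A L \/ A = A0.
  elim: (L) => [|B L' IHL] /=; first by split; [case=> [->|//]; right|case=> [//|->]; left].
  by rewrite IHL; tauto.
split.
- by move=> A /inL[|->]; [exact: cL|].
- move=> A /inL[hA t ht|->].
    by have [? ?] := Lg A hA t ht; split=> //; lra.
  by move=> /= t ht; split; [lra|rewrite gh].
- move=> X psi cpsi.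
  have -> : chain_int (rcons L A0) psi = plus (chain_int L psi)
      (RInt (fun t => psi (h t) (dh t)) (tau k) (tau k.+1)).
    by rewrite /chain_int -cats1 big_cat big_seq1.
  apply: is_RInt_Chasles; first by apply: Lint => A hA; apply: cpsi; apply/inL; left.
  have ex : ex_RInt (fun t => psi (h t) (dh t)) (tau k) (tau k.+1).
    apply: ex_RInt_continuous_le; first lra.
    by apply: (cpsi A0); apply/inL; right.
  apply: is_RInt_ext (RInt_correct _ _ _ ex) => t.
  rewrite Rmin_left ?Rmax_right; try lra; move=> ht.
  rewrite -gh; last lra; congr psi; symmetry; apply: velocityE (hder t).
  have [|d [d0 [d1 [d2 _]]]] := @pos_below [:: t - tau k; tau k.+1 - t].
    by repeat split; lra.
  exists (mkposreal _ d0) => s hs; change (Rabs (s - t) < d) in hs.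
  by move: hs => /Rabs_def2 ?; apply: gh; lra.
Qed.
(** * Chains that bound a plane region *)

(** All that the argument needs to know of a positively oriented boundary; the
    orientation is expressed by the winding numbers. *)
Definition bounds (A : C -> Prop) (L : seq arc) :=
  [/\ forall B, List.In B L -> continuous_arc B,
      forall B, List.In B L -> forall t, lo B <= t <= hi B -> boundary A (pos B t)
    & forall w, ~ boundary A w ->
        (A w -> winding_int L w = (2 * PI * Ci)%C) /\ (~ A w -> winding_int L w = RtoC 0)].

Lemma chain_int_cat (X : CompleteNormedModule R_AbsRing) L1 L2 (psi : C -> C -> X) :
  chain_int (L1 ++ L2) psi = plus (chain_int L1 psi) (chain_int L2 psi).
Proof. by rewrite /chain_int big_cat. Qed.

Lemma In_cat (T : Type) (x : T) (s1 s2 : seq T) :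
  List.In x (s1 ++ s2) <-> List.In x s1 \/ List.In x s2.
Proof. exact: List.in_app_iff. Qed.

Lemma jordan_chain (A : C -> Prop) n (g : 'I_n -> R -> C) :
  jordan_boundary A g -> positively_oriented A g ->
  exists2 L, bounds A L &
    forall (X : CompleteNormedModule R_AbsRing) (psi : C -> C -> X),
      (forall B, List.In B L -> forall t, lo B <= t <= hi B ->
         continuous (fun t => psi (pos B t) (vel B t)) t) ->
      exists I : 'I_n -> X,
        (forall k, is_RInt (fun t => psi (g k t) (velocity (g k) t)) 0 1 (I k)) /\
        chain_int L psi = \big[plus/zero]_(k : 'I_n) I k.
Proof.
move=> [jg _ bg] og.
have ex k : exists L, represents (g k) 1 L by have [h _ _] := jg k; exact: piecewise_C1_chain.
pose Lk k := proj1_sig (constructive_indefinite_description _ (ex k)).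
have Lkg k : represents (g k) 1 (Lk k) := proj2_sig (constructive_indefinite_description _ (ex k)).
pose L := flatten [seq Lk k | k <- enum 'I_n].
have inL B : List.In B L -> exists k, List.In B (Lk k).
  rewrite /L; elim: (enum _) => //= k s IH /In_cat[h|/IH //]; by exists k.
have inLk B k : List.In B (Lk k) -> List.In B L.
  have : k \in enum 'I_n by rewrite mem_enum.
  rewrite /L; elim: (enum _) => //= k' s IH; rewrite inE => /orP[/eqP -> h|ks h].
    by apply/In_cat; left.
  by apply/In_cat; right; exact: IH.
have LE (X : CompleteNormedModule R_AbsRing) (psi : C -> C -> X) :
    chain_int L psi = \big[plus/zero]_(k : 'I_n) chain_int (Lk k) psi.
  by rewrite /chain_int /L big_flatten big_map big_enum.
have Lint (X : CompleteNormedModule R_AbsRing) (psi : C -> C -> X) :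
    (forall B, List.In B L -> forall t, lo B <= t <= hi B ->
       continuous (fun t => psi (pos B t) (vel B t)) t) ->
    exists I : 'I_n -> X,
      (forall k, is_RInt (fun t => psi (g k t) (velocity (g k) t)) 0 1 (I k)) /\
      chain_int L psi = \big[plus/zero]_(k : 'I_n) I k.
  move=> cpsi; exists (fun k => chain_int (Lk k) psi); split; last exact: LE.
  by move=> k; have [_ _ h] := Lkg k; apply: h => B /inLk; exact: cpsi.
have cL B : List.In B L -> continuous_arc B by move=> /inL[k]; case: (Lkg k) => h _ _; exact: h.
have LbA B : List.In B L -> forall t, lo B <= t <= hi B -> boundary A (pos B t).
  move=> /inL[k hB] t ht; have [_ h _] := Lkg k; have [ht' ->] := h B hB t ht.
  by apply/bg; exists k, t.
exists L => //; split=> // w nbw.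
have [|I [hI IE]] := Lint C_R_CompleteNormedModule (fun z c => c / (z - w))%C.
  move=> B hB t ht; have [_ /(_ t ht) [cp cv]] := cL B hB.
  apply: continuous_Cdiv => //; first by apply: continuous_Cminus => //; exact: continuous_const.
  by apply: Cminus_neq0 => e; apply: nbw; rewrite -e; exact: LbA hB t ht.
have e : winding_int L w = (2 * PI * Ci * winding g w)%C.
  have p0 : (2 * PI * Ci)%C <> RtoC 0.
    by move=> h; move: (f_equal snd h) => /=; have := PI_RGT_0; lra.
  rewrite /winding_int IE /winding Cmult_assoc Cinv_r // Cmult_1_l.
  apply: eq_bigr => k _; symmetry.
  exact: (is_RInt_unique (V := C_R_CompleteNormedModule) _ _ _ _ (hI k)).
have [w1 w0] := og w nbw; split=> hw.
  by rewrite e w1 // Cmult_1_r.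
by rewrite e w0 // Cmult_0_r.
Qed.

Section RegionPair.

Variables (X : CompleteNormedModule R_AbsRing) (h : C -> X * X) (O : C -> Prop).
Hypothesis O_open : forall z, O z -> locally z O.
Hypothesis O_holo : forall z, O z -> holo h z.

Lemma continuous_on_chain A L : bounds A L -> (forall z, boundary A z -> O z) ->
  forall B, List.In B L -> forall t, lo B <= t <= hi B ->
    continuous (fun t => pairing (h (pos B t)) (Ci * vel B t)%C) t.
Proof.
move=> [cL bL _] bO B hB t ht; have [_ /(_ t ht) [cp cv]] := cL B hB.
apply: (continuous_bilinear (bilinear_pairing X)).
  by apply: (continuous_comp (pos B) h) => //; apply: holo_continuous; apply: O_holo;
    apply: bO; exact: bL hB t ht.
apply: (continuous_bilinear bilinear_Cmult (f := fun _ => Ci)) => //.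
exact: continuous_const.
Qed.

Lemma adherent_box (A : C -> Prop) z eps : adherent A z -> 0 < eps ->
  exists2 w, A w & Rabs (w.1 - z.1) < eps /\ Rabs (w.2 - z.2) < eps.
Proof.
move=> adh e0; apply: (adh (fun w : C => Rabs (w.1 - z.1) < eps /\ Rabs (w.2 - z.2) < eps)).
by case: z {adh} => u v; apply: (box_locally e0).
Qed.

Lemma not_adherent_open (A : C -> Prop) z : ~ adherent A z ->
  locally z (fun w => ~ adherent A w).
Proof.
move=> na; have [P [lP nP]] : exists P, locally z P /\ ~ exists2 y, A y & P y.
  apply: NNPP => no; apply: na => P lP; apply: NNPP => nP; apply: no.
  by exists P.
by apply: filter_imp (locally_locally _ _ lP) => w lw adh; apply: nP; exact: adh.
Qed.

Lemma open_boundary (A : C -> Prop) z : (forall w, A w -> locally w A) ->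
  boundary A z -> ~ A z.
Proof. by move=> oA [_ adh] Az; have [y] := adh _ (oA z Az). Qed.

Lemma adherent_sub (A : C -> Prop) z : A z -> adherent A z.
Proof. by move=> Az P lP; exists z => //; exact: locally_singleton lP. Qed.

(** Cauchy's theorem for the difference of the two chains, with E the set of
    the points in one of the two closures but not in both regions.  Off E the
    two winding numbers agree: both are 1 in the intersection of A and A', and
    both are 0 outside the closures. *)
Lemma chain_int_bounds_eq A A' L L' M :
  (forall z, A z -> locally z A) -> (forall z, A' z -> locally z A') ->
  (forall z : C, adherent A z -> - M < z.1 < M /\ - M < z.2 < M) ->
  (forall z : C, adherent A' z -> - M < z.1 < M /\ - M < z.2 < M) ->
  (forall z : C, adherent A z -> ~ (A z /\ A' z) -> O z) ->
  (forall z : C, adherent A' z -> ~ (A z /\ A' z) -> O z) ->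
  bounds A L -> bounds A' L' ->
  chain_int L (fun z c => pairing (h z) (Ci * c)%C)
  = chain_int L' (fun z c => pairing (h z) (Ci * c)%C).
Proof.
move=> oA oA' bdA bdA' AO A'O bL bL'.
have [cL LA LW] := bL; have [cL' LA' LW'] := bL'.
pose E z := (adherent A z \/ adherent A' z) /\ ~ (A z /\ A' z).
have bE z : boundary A z -> E z.
  by move=> bz; split; [left; case: bz|case=> Az _; exact: (open_boundary oA bz)].
have bE' z : boundary A' z -> E z.
  by move=> bz; split; [right; case: bz|case=> _ Az; exact: (open_boundary oA' bz)].
have EO z : E z -> O z by move=> [[adz|adz] nz]; [exact: AO|exact: A'O].
pose rev B := Arc (lo B) (hi B) (pos B) (fun t => - vel B t)%C.
have inrev B : List.In B (map rev L') -> exists2 B', List.In B' L' & B = rev B'.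
  by move=> /List.in_map_iff [B' [<- hB']]; exists B'.
have revE (Y : CompleteNormedModule R_AbsRing) (psi : C -> C -> Y) :
    (forall z c, psi z (- c)%C = opp (psi z c)) -> chain_integrable L' psi ->
    chain_int (map rev L') psi = opp (chain_int L' psi).
  move=> psiN ipsi; rewrite /chain_int big_map (big_morph _ (@opp_plus _) (@opp_zero _)).
  apply: eq_big_In => B hB /=; rewrite -RInt_opp; last exact: ipsi.
  by apply: RInt_ext => t _; rewrite psiN.
have hom : chain_int (L ++ map rev L') (fun z c => pairing (h z) (Ci * c)%C) = zero.
  apply: (cauchy_homology (E := E) (M := M)).
  - move=> z nE; case: (classic (A z /\ A' z)) => [[Az A'z]|nAA].
      by apply: filter_imp (filter_and _ _ (oA _ Az) (oA' _ A'z)) => w AA [_].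
    have nad : ~ adherent A z by move=> ad; apply: nE; split; [left|].
    have nad' : ~ adherent A' z by move=> ad; apply: nE; split; [right|].
    apply: filter_imp (filter_and _ _ (not_adherent_open nad) (not_adherent_open nad')).
    by move=> w [n1 n2] [[|]].
  - by move=> z /EO Oz; apply: filter_imp (O_open Oz); exact: O_holo.
  - by move=> z [[adz|adz] _]; [exact: bdA|exact: bdA'].
  - move=> B /In_cat[|/inrev[B' hB' ->]]; first exact: cL.
    have [le c] := cL' _ hB'; split=> //= t /c [cp cv]; split=> //.
    exact: (continuous_opp (V := C_R_NormedModule)).
  - by move=> B /In_cat[hB t /(LA _ hB) /bE //|/inrev[B' hB' ->] t /(LA' _ hB') /bE'].
  - move=> w nE; have nb : ~ boundary A w by move=> /bE.
    have nb' : ~ boundary A' w by move=> /bE'.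
    rewrite /winding_int chain_int_cat revE; last first.
    + move=> B hB; apply: ex_RInt_winding (cL' B hB) _ => t ht e.
      by apply: nb'; rewrite -e; exact: LA' hB t ht.
    + by move=> z c; exact: (esym (opp_mult_l (K := C_Ring) c _)).
    rewrite -/(winding_int L w) -/(winding_int L' w).
    have [W1 W0] := LW w nb; have [W1' W0'] := LW' w nb'.
    case: (classic (A w /\ A' w)) => [[Aw A'w]|nAA].
      by rewrite W1 // W1' //; exact: plus_opp_r.
    have nA : ~ A w by move=> Aw; apply: nE; split=> //; left; exact: adherent_sub.
    have nA' : ~ A' w by move=> Aw; apply: nE; split=> //; right; exact: adherent_sub.
    by rewrite W0 // W0' //; exact: plus_opp_r.
move: hom; rewrite chain_int_cat revE.
- exact: eq_minus_r.
- by move=> z c; rewrite /pairing /=; lin_eq.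
- move=> B hB; have [le _] := cL' _ hB; apply: ex_RInt_continuous_le => //.
  by apply: (continuous_on_chain bL' _ hB) => z /bE'/EO.
Qed.

End RegionPair.

(** Reflection in the real axis reverses the orientation, so the reflected
    chain is traversed backwards. *)
Definition reflect_arc (B : arc) :=
  Arc (lo B) (hi B) (fun t => Cconj (pos B t)) (fun t => - Cconj (vel B t))%C.

Lemma is_linear_Cconj : is_linear (Cconj : C_R_NormedModule -> C_R_NormedModule).
Proof.
split=> [x y|k x|].
- by complex_ring.
- by complex_ring.
- by exists 1; split; [lra|move=> x; rewrite !norm_C_R Cmod_conj Rmult_1_l; exact: Rle_refl].
Qed.

Lemma bounds_reflect A L : (forall z, A z -> A (Cconj z)) -> bounds A L ->
  bounds A (map reflect_arc L).
Proof.
move=> symA [cL LA LW].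
have cc z : continuous (Cconj : C -> C) z.
  exact: (linear_cont (Cconj : C_R_NormedModule -> C_R_NormedModule) z is_linear_Cconj).
have symA' z : A (Cconj z) -> A z by move=> /symA; rewrite Cconj_conj.
have symb z : boundary A z -> boundary A (Cconj z).
  case=> [ad nad]; split=> P lP.
    have [|y Ay Py] := ad (fun w => P (Cconj w)); first exact: cc P lP.
    by exists (Cconj y) => //; exact: symA.
  have [|y Ay Py] := nad (fun w => P (Cconj w)); first exact: cc P lP.
  by exists (Cconj y) => // /symA'.
have inr B : List.In B (map reflect_arc L) -> exists2 B', List.In B' L & B = reflect_arc B'.
  by move=> /List.in_map_iff [B' [<- hB']]; exists B'.
split.
- move=> B /inr[B' hB' ->]; have [le c] := cL _ hB'; split=> //= t /c [cp cv]; split.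
    exact: (continuous_comp (pos B') Cconj).
  apply: (continuous_opp (V := C_R_NormedModule)).
  exact: (continuous_comp (vel B') Cconj).
- by move=> B /inr[B' hB' ->] t ht /=; apply: symb; exact: LA hB' t ht.
- move=> w nb; have nbc : ~ boundary A (Cconj w) by move=> /symb; rewrite Cconj_conj.
  have e : winding_int (map reflect_arc L) w = (- Cconj (winding_int L (Cconj w)))%C
      :> C_R_CompleteNormedModule.
    have lN : is_linear (fun z : C_R_NormedModule => (- Cconj z)%C : C_R_NormedModule).
      exact: (is_linear_comp _ _ is_linear_Cconj (is_linear_opp' C_R_NormedModule)).
    have l0 : (- Cconj (RtoC 0))%C = RtoC 0 by complex_ring.
    rewrite /winding_int /chain_int big_map.
    rewrite (big_morph (fun z : C_R_NormedModule => (- Cconj z)%C : C_R_NormedModule)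
               (linear_plus _ lN) l0).
    apply: eq_big_In => B hB /=; have [le c] := cL _ hB.
    have neq t : lo B <= t <= hi B -> pos B t <> Cconj w.
      by move=> ht eq; apply: nbc; rewrite -eq; exact: LA hB t ht.
    have ex := ex_RInt_winding (cL B hB) neq.
    have iN := is_RInt_linear lN (RInt_correct _ _ _ ex).
    rewrite -[RHS](is_RInt_unique (V := C_R_CompleteNormedModule) _ _ _ _ iN).
    apply: (RInt_eq_le (X := C_R_CompleteNormedModule) le) => t ht.
    have nz := Cminus_neq0 (neq t ht).
    rewrite /Cdiv Cmult_conj Cinv_conj // Cminus_conj Cconj_conj.
    by lazymatch goal with |- @eq _ ?a ?b => change (@eq C a b) end; ring.
  rewrite e; have [W1 W0] := LW _ nbc; split=> [Aw|nAw].
    by rewrite W1; [complex_ring|exact: symA].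
  by rewrite W0; [complex_ring|move=> /symA'].
Qed.
(** * Independence of the imaginary unit and of the domain *)

Lemma has_diff_pair (X : NormedModule R_AbsRing) (f g : C -> X) p a b c d :
  has_diff f p a b -> has_diff g p c d ->
  has_diff (fun w => (f w, g w)) p (a, c) (b, d).
Proof.
move=> df dg eps e0; have e2 : 0 < eps / 2 by lra.
apply: filter_imp (filter_and _ _ (df _ e2) (dg _ e2)) => q [h1 h2].
have np (x y : X) : norm (x, y) <= norm x + norm y.
  have x0 := norm_ge_0 x; have y0 := norm_ge_0 y; have xy0 := Rmult_le_pos _ _ x0 y0.
  apply: Rsqr_incr_0_var; last lra.
  rewrite -[norm (x, y)]/(sqrt (norm x ^ 2 + norm y ^ 2)).
  by rewrite Rsqr_sqrt /Rsqr; nra.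
set u := minus (minus _ _) _ in h1; set v := minus (minus _ _) _ in h2.
by apply: Rle_trans (np u v) _; lra.
Qed.

Section SliceForm.

Variables (V : CompleteNormedModule R_AbsRing) (O : C -> Prop).
Variables (F G : ('I_5 -> R) -> C -> BV5 V).
Hypotheses (rF : rslice O F) (lG : lslice O G).
Hypothesis F_pt : forall J z, F (opp_unit J) (Cconj z) = F J z.
Hypothesis G_pt : forall J z, G (opp_unit J) (Cconj z) = G J z.

Definition slice_pair J z : BV5 V * BV5 V :=
  (mult (F J z) (G J z), mult (mult (F J z) (unit_op V J)) (G J z)).

(** F(s) ds_J G(s), where c is the direction ds; the factor - J of ds_J turns c
    into - i c. *)
Definition slice_form J z (c : C) : BV5 V := opp (pairing (slice_pair J z) (Ci * c)%C).

Lemma slice_formE J z c : sphere J -> slice_form J z c =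
  mult (mult (F J z)
    (mult (plus (scal c.1 (one : BV5 V)) (scal c.2 (unit_op V J))) (opp (unit_op V J))))
    (G J z).
Proof.
move=> SJ; rewrite /slice_form /pairing /slice_pair /=.
rewrite -opp_mult_r !mult_distr_r !scal_multl mult_one_l unit_op_sqr //.
rewrite -opp_mult_r !mult_distr_l -opp_mult_l !mult_distr_r !scal_multr !scal_multl.
rewrite -opp_mult_r -opp_mult_l mult_one_r.
by lin_eq.
Qed.

Lemma holo_slice_pair J z : sphere J -> O z -> holo (slice_pair J) z.
Proof.
move=> SJ Oz; have [_ /(_ J z SJ Oz) [d1 h1]] := rF; have [_ /(_ J z SJ Oz) [d2 h2]] := lG.
set j := unit_op V J in h1 h2; have bl := bilinear_mult V.
have hFj := has_diff_bilinear bl h1 (has_diff_const j z).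
have hH := has_diff_bilinear bl h1 h2; have hK := has_diff_bilinear bl hFj h2.
eexists; apply: (has_diff_eq (has_diff_pair hH hK)); first by [].
have jj : mult j j = opp one by exact: unit_op_sqr.
rewrite /rot /=; congr pair; rewrite !mult_zero_r !plus_zero_r.
  by rewrite mult_assoc.
rewrite -(mult_assoc d1) jj -opp_mult_r mult_one_r (mult_assoc (mult (F J z) j)).
by rewrite -(mult_assoc (F J z) j j) jj -!opp_mult_r mult_one_r -!opp_mult_l opp_plus.
Qed.

Lemma continuous_slice_form A L J : sphere J -> bounds A L ->
  (forall z, boundary A z -> O z) ->
  forall B, List.In B L -> forall t, lo B <= t <= hi B ->
    continuous (fun t => slice_form J (pos B t) (vel B t)) t.
Proof.
move=> SJ bL bO B hB t ht; apply: continuous_opp.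
exact: (continuous_on_chain (fun z => @holo_slice_pair J z SJ) bL bO hB ht).
Qed.

(** For F = A + B J and G = C + J D, the reflection of z in the real axis
    replaces J by - J.  In the sum below the terms with an odd number of
    factors J cancel, and the others do not depend on J. *)
Lemma slice_form_reflect z c : O z -> exists w : BV5 V, forall J, sphere J ->
  plus (slice_form J z c) (slice_form J (Cconj z) (- Cconj c)%C) = w.
Proof.
move=> Oz; have [[A [B FE]] _] := rF; have [[C' [D GE]] _] := lG.
exists (scal 2 (plus (scal c.2 (minus (mult (A z) (C' z)) (mult (B z) (D z))))
                     (scal c.1 (plus (mult (A z) (D z)) (mult (B z) (C' z)))))) => J SJ.
have SJ' := sphere_opp SJ.
have FN : F J (Cconj z) = minus (A z) (mult (B z) (unit_op V J)).
  rewrite -(F_pt J (Cconj z)) Cconj_conj FE // /unit_mult unit_op_opp -opp_mult_r //.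
have GN : G J (Cconj z) = minus (C' z) (mult (unit_op V J) (D z)).
  rewrite -(G_pt J (Cconj z)) Cconj_conj GE // /unit_mult unit_op_opp -opp_mult_l //.
rewrite !slice_formE // FN GN FE // GE // /unit_mult.
have jj : mult (unit_op V J) (unit_op V J) = opp one by exact: unit_op_sqr.
move: (unit_op V J) (A z) (B z) (C' z) (D z) jj => j a b c' d jj.
have jjx x : mult j (mult j x) = opp x by rewrite mult_assoc jj -opp_mult_l mult_one_l.
have e (u v : R) : mult (plus (scal u (one : BV5 V)) (scal v j)) (opp j)
    = plus (scal v (one : BV5 V)) (scal (- u) j).
  by rewrite -opp_mult_r mult_distr_r !scal_multl mult_one_l jj; lin_eq.
rewrite !e /= /minus !mult_distr_r !mult_distr_l -!opp_mult_l -!opp_mult_r.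
rewrite !mult_distr_r -?opp_mult_l -?opp_mult_r !scal_multr !scal_multl ?mult_one_r.
rewrite -!mult_assoc ?jjx -?opp_mult_r.
by lin_eq.
Qed.

Hypothesis O_open : forall z, O z -> locally z O.

(** Regions of the plane over which the form is integrated: S stands for the
    spectrum and O for the points of the domain outside it. *)
Definition admissible_region (S A : C -> Prop) (L : seq arc) :=
  [/\ forall z, A z -> locally z A,
      exists M, forall z : C, A z -> - M < z.1 < M /\ - M < z.2 < M,
      forall z, A z -> A (Cconj z),
      (forall z, S z -> A z) /\ (forall z, adherent A z -> O z \/ S z)
    & bounds A L].

Variable S : C -> Prop.

Lemma admissible_boundary A L z : admissible_region S A L -> boundary A z -> O z.
Proof.
move=> [oA _ _ [SA AO] _] bz; have [//|/SA Az] := AO z (proj1 bz).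
by case: (open_boundary oA bz).
Qed.

Lemma chain_integrable_slice_form A L J : sphere J -> admissible_region S A L ->
  chain_integrable L (slice_form J).
Proof.
move=> SJ rA B hB; have [_ _ _ _ bL] := rA; have [cL _ _] := bL; have [le _] := cL B hB.
apply: ex_RInt_continuous_le => // t ht.
by apply: (continuous_slice_form SJ bL _ hB ht) => z; exact: admissible_boundary rA.
Qed.

Lemma adherent_bounded (A : C -> Prop) M (z : C) : (forall w, A w -> - M < w.1 < M /\ - M < w.2 < M) ->
  adherent A z -> - (M + 1) < z.1 < M + 1 /\ - (M + 1) < z.2 < M + 1.
Proof.
move=> bA /adherent_box /(_ Rlt_0_1) [w /bA [h1 h2] [/Rabs_def2 [h3 h4] /Rabs_def2 [h5 h6]]].
by split; lra.
Qed.

Lemma chain_int_region A A' L L' J : sphere J ->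
  admissible_region S A L -> admissible_region S A' L' ->
  chain_int L (slice_form J) = chain_int L' (slice_form J).
Proof.
move=> SJ rA rA'; have iA := chain_integrable_slice_form SJ rA.
have iA' := chain_integrable_slice_form SJ rA'.
have oppE K : chain_integrable K (slice_form J) -> chain_int K (slice_form J)
    = opp (chain_int K (fun z c => pairing (slice_pair J z) (Ci * c)%C)).
  move=> iK; rewrite /chain_int (big_morph _ (@opp_plus _) (@opp_zero _)).
  apply: eq_big_In => B hB; rewrite -RInt_opp //.
  apply: ex_RInt_ext (ex_RInt_opp _ _ _ (iK B hB)) => t _.
  by rewrite /slice_form opp_opp.
rewrite !oppE //; congr opp.
have [oA [M bA] _ [SA AO] bL] := rA; have [oA' [M' bA'] _ [SA' AO'] bL'] := rA'.
pose N := Rmax M M' + 1; have NM := Rmax_l M M'; have NM' := Rmax_r M M'.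
apply: (@chain_int_bounds_eq _ _ _ O_open (fun z => @holo_slice_pair J z SJ) A A' L L' N) => //.
- by move=> z /(adherent_bounded bA) [? ?]; rewrite /N; split; lra.
- by move=> z /(adherent_bounded bA') [? ?]; rewrite /N; split; lra.
- by move=> z /AO[//|Sz] []; split; [exact: SA|exact: SA'].
- by move=> z /AO'[//|Sz] []; split; [exact: SA|exact: SA'].
Qed.

(** The reflected chain bounds the same region, so the integral is half of the
    integral of the symmetrized form, which does not involve the unit. *)
Lemma chain_int_unit A L J K : sphere J -> sphere K -> admissible_region S A L ->
  chain_int L (slice_form J) = chain_int L (slice_form K).
Proof.
move=> SJ SK rA; have [oA bA symA SA bL] := rA.
have rA' : admissible_region S A (map reflect_arc L).
  by split=> //; exact: bounds_reflect.
have half I : sphere I -> scal 2 (chain_int L (slice_form I)) =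
    chain_int L (fun z c => plus (slice_form I z c)
                                 (slice_form I (Cconj z) (- Cconj c)%C)).
  move=> SI; have iA := chain_integrable_slice_form SI rA.
  have iA' := chain_integrable_slice_form SI rA'.
  rewrite chain_int_plus //; last first.
    by move=> B hB; apply: (iA' (reflect_arc B)); apply/List.in_map_iff; exists B.
  have -> : chain_int L (fun z c => slice_form I (Cconj z) (- Cconj c)%C)
      = chain_int L (slice_form I).
    by rewrite [RHS](chain_int_region SI rA rA') /chain_int big_map.
  by lin_eq.
have e : scal 2 (chain_int L (slice_form J)) = scal 2 (chain_int L (slice_form K)).
  rewrite !half //; have [cL LA _] := bL.
  apply: (eq_chain_int (E := O)) => //.
    by move=> B hB t ht; apply: (admissible_boundary rA); exact: LA hB t ht.
  by move=> z c Oz; have [w hw] := slice_form_reflect c Oz; rewrite !hw.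
have -> : chain_int L (slice_form J) = scal (/ 2) (scal 2 (chain_int L (slice_form J))).
  by lin_eq.
by rewrite e; lin_eq.
Qed.

End SliceForm.

Section Main.

Variables (V : CompleteNormedModule R_AbsRing) (T : BV5 V).
Hypothesis hT : BC01 T.

Lemma resolvent_region_open z : (exists J, sphere J) -> resolvent_region T z ->
  locally z (resolvent_region T).
Proof.
move=> [J SJ] Oz; have [d [hd _]] := has_diff_Qcs hT z SJ; have [Y inv] := Oz J SJ.
apply: filter_imp (locally_inverse (has_diff_continuous hd) inv) => w hw.
by apply: (resolvent_region_of hT SJ); apply.
Qed.

Lemma slice_region_open D J z : sphere J -> open D -> axially_symmetric D ->
  slice_region D z -> locally z (slice_region D).
Proof.
move=> SJ oD sD Dz; apply: filter_imp (locally_slice SJ (oD _ (Dz J SJ))) => w.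
exact: slice_region_of.
Qed.

Lemma slice_conj U J z : axially_symmetric U -> sphere J ->
  slice U J z -> slice U J (Cconj z).
Proof.
move=> sU SJ Uz; have := slice_region_of sU SJ Uz (sphere_opp SJ).
by rewrite -(slice_pt_opp (opp_unit J)) /slice /opp_unit; congr (U (slice_pt _ _));
  apply: functional_extensionality => i; ring.
Qed.

Lemma para_norm_slice J (z : C) : sphere J ->
  Rabs z.1 <= para_norm (slice_pt J z) /\ Rabs z.2 <= para_norm (slice_pt J z).
Proof.
move=> SJ; have -> : para_norm (slice_pt J z) = Cmod z.
  have e : \big[Rplus/0]_(i : 'I_5) (z.2 * J i) ^ 2 = z.2 ^ 2.
    rewrite (eq_bigr (fun i => z.2 ^ 2 * (J i) ^ 2)); last by move=> i _; ring.
    by rewrite -(big_morph _ (Rmult_plus_distr_l (z.2 ^ 2)) (Rmult_0_r _)) sphere_sum // Rmult_1_r.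
  by rewrite /para_norm /Cmod [(slice_pt J z).1]/= e.
have h := Rmax_Cmod z.
by split; [exact: Rle_trans (Rmax_l _ _) h|exact: Rle_trans (Rmax_r _ _) h].
Qed.

Definition regular_region D z := resolvent_region T z /\ slice_region D z.

Lemma admissible_regionP D J U n (g : 'I_n -> R -> C) L :
  axially_symmetric D -> admissible T D J U g -> bounds (slice U J) L ->
  admissible_region (regular_region D) (fun z => ~ resolvent_region T z) (slice U J) L.
Proof.
move=> sD [SJ [[M bU] [oU sU _]] specU adU _] bL; split=> //.
- by move=> z Uz; exact: (locally_slice SJ (oU _ Uz)).
- exists (M + 1) => z /bU h; have [h1 h2] := para_norm_slice z SJ.
  have [|? ?] := Rabs_def2 z.1 (M + 1); first lra.
  have [|? ?] := Rabs_def2 z.2 (M + 1); first lra.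
  by [].
- by move=> z; exact: slice_conj.
- split=> z.
    move=> nz; apply: specU => nspec; apply: nz.
    by apply: (resolvent_region_of hT SJ) => spec; exact: spec.
  move=> adz; case: (classic (resolvent_region T z)) => [Oz|]; [left|by right].
  split=> //; apply: (slice_region_of sD SJ); apply: adU => P lP.
  by have [w Uw Pw] := adz _ (locally_slice SJ lP); exists (slice_pt J w).
Qed.

(** The two parts of the theorem are this statement, for F the resolvent
    operator and G the function, and conversely. *)
Lemma slice_integral_independent (D : paravector -> Prop) (F G : paravector -> BV5 V) :
  open D -> axially_symmetric D ->
  rslice (regular_region D) (fun J z => F (slice_pt J z)) ->
  lslice (regular_region D) (fun J z => G (slice_pt J z)) ->
  exists I : BV5 V, forall J U n (g : 'I_n -> R -> C), admissible T D J U g ->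
    is_contour_integral (fun k t =>
      mult (mult (F (slice_pt J (g k t))) (cliff_op V (dsJ J (g k) t)))
           (G (slice_pt J (g k t)))) I.
Proof.
move=> oD sD rF lG.
pose Fs J z := F (slice_pt J z); pose Gs J z := G (slice_pt J z).
have F_pt J z : Fs (opp_unit J) (Cconj z) = Fs J z by rewrite /Fs slice_pt_opp.
have G_pt J z : Gs (opp_unit J) (Cconj z) = Gs J z by rewrite /Gs slice_pt_opp.
pose S z := ~ resolvent_region T z.
have contour J U n (g : 'I_n -> R -> C) : admissible T D J U g ->
    exists L, admissible_region (regular_region D) S (slice U J) L /\
    is_contour_integral (fun k t =>
      mult (mult (F (slice_pt J (g k t))) (cliff_op V (dsJ J (g k) t)))
           (G (slice_pt J (g k t)))) (scal (/ (2 * PI)) (chain_int L (slice_form Fs Gs J))).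
  move=> adm; have [SJ _ _ _ [jU oU]] := adm; have [L bL Lint] := jordan_chain jU oU.
  have rL := admissible_regionP sD adm bL; exists L; split=> //.
  have [|I [hI IE]] := Lint _ (slice_form Fs Gs J).
    move=> B hB t ht; apply: (continuous_slice_form rF lG SJ bL _ hB ht) => z.
    exact: admissible_boundary rL.
  exists I; split=> [k|]; last by rewrite IE.
  apply: is_RInt_ext (hI k) => t _; rewrite slice_formE // /dsJ cliff_op_mult cliff_op_opp.
  by congr (mult (mult _ (mult _ _)) _); rewrite -para_op_slice.
case: (classic (exists J U n (g : 'I_n -> R -> C), admissible T D J U g)); last first.
  by move=> no; exists zero => J U n g adm; case: no; exists J, U, n, g.
move=> [J0 [U0 [n0 [g0 adm0]]]]; have [L0 [r0 _]] := contour _ _ _ _ adm0.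
have [SJ0 _ _ _ _] := adm0.
exists (scal (/ (2 * PI)) (chain_int L0 (slice_form Fs Gs J0))) => J U n g adm.
have [L [rL int]] := contour _ _ _ _ adm; have [SJ _ _ _ _] := adm.
have oO z : regular_region D z -> locally z (regular_region D).
  move=> [Oz Dz]; apply: filter_and; last exact: slice_region_open SJ oD sD Dz.
  by apply: resolvent_region_open => //; exists J.
rewrite (chain_int_unit rF lG F_pt G_pt oO SJ0 SJ r0).
by rewrite (chain_int_region rF lG oO SJ r0 rL).
Qed.

End Main.

Theorem theorem9p6 (V : CompleteNormedModule R_AbsRing) (T : BV5 V)
    (hT : BC01 T) (P : fine_op) :
  (forall (D : paravector -> Prop) (f : paravector -> R5),
     slice_hyperholomorphic_L D f -> (forall s, S_spectrum T s -> D s) ->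
     exists PfT : BV5 V,
       forall (J : 'I_5 -> R) (U : paravector -> Prop) (n : nat)
              (g : 'I_n -> R -> C),
         admissible T D J U g ->
         is_contour_integral (fun k => integrand_L P T f J (g k)) PfT) /\
  (forall (D : paravector -> Prop) (f : paravector -> R5),
     slice_hyperholomorphic_R D f -> (forall s, S_spectrum T s -> D s) ->
     exists fPT : BV5 V,
       forall (J : 'I_5 -> R) (U : paravector -> Prop) (n : nat)
              (g : 'I_n -> R -> C),
         admissible T D J U g ->
         is_contour_integral (fun k => integrand_R P T f J (g k)) fPT).
Proof.
split=> D f hf _; have [oD sD _] := hf.
- apply: (slice_integral_independent hT (F := fun s => resolvent_L P s T)
            (G := fun s => cliff_op V (f s)) oD sD).
    by apply: slice_fun_sub (rslice_resolvent hT P) => z [].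
  by apply: slice_fun_sub (lslice_hyperholomorphic V hf) => z [].
- apply: (slice_integral_independent hT (F := fun s => cliff_op V (f s))
            (G := fun s => resolvent_R P s T) oD sD).
    by apply: slice_fun_sub (rslice_hyperholomorphic V hf) => z [].
  by apply: slice_fun_sub (lslice_resolvent hT P) => z [].
Qed.
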